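(* Let $\{k\}_{k\in\mathcal K}$ be a finite collection of kernels satisfying, with a constant $\Gamma\ge 1$, $\sup_{x}\int k(x,y)^2d\mu(y)\vee\sup_{x,y}|k(x,y)|\le \Gamma n$ for all $k\in\mathcal K$. Assume that there is a constant $\Upsilon>0$ such that for all $k,k'\in\mathcal K$: $$\big(\Gamma(1+\|s\|_\infty)\big)\vee\sup_{k\in\mathcal K}\|s_k\|^2\le\Upsilon,\qquad P(\chi_k^2)\le\Upsilon n P\Theta_k,\qquad \|s_k-s_{k'}\|_\infty\le\Upsilon\vee\big(\sqrt{\Upsilon n}\,\|s_k-s_{k'}\|\big),$$ $$\mathbb E[A_k(X,Y)^2]\le\Upsilon P\Theta_k,\qquad \sup_{x\in\mathbb X}\mathbb E[A_k(X,x)^2]\le\Upsilon n,\qquad v_k^2\le\Upsilon\vee\sqrt{\Upsilon P\Theta_k}.$$ Let $\mathrm{pen}:\mathcal K\to\mathbb R$ be a (possibly data-dependent) penalty and let $\hat k$ denote any minimizer over $\mathcal K$ of $\mathcal C_{\mathrm{pen}}(k)=P_n\gamma(\hat s_k)+\mathrm{pen}(k)$. (i) There is an absolute constant $c_0>0$ such that for any $x\ge1$, with probability larger than $1-c_0|\mathcal K|^2e^{-x}$, for any $\theta\in(0,1)$, any minimizer $\hat k$ satisfies $$\forall k\in\mathcal K,\quad (1-4\theta)\|s-\hat s_{\hat k}\|^2\le(1+4\theta)\|s-\hat s_k\|^2+\Big(\mathrm{pen}(k)-2\frac{P\chi_k}{n}\Big)-\Big(\mathrm{pen}(\hat k)-2\frac{P\chi_{\hat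 k}}{n}\Big)+c_0\frac{\Upsilon x^2}{\theta n}.$$ (ii) Let $c_1>0$ be an absolute constant. Assume moreover that there exist $C>0$, $\delta'\ge\delta>0$ and $r\ge0$ such that for any $x\ge1$, with probability larger than $1-Ce^{-x}$, for any $k\in\mathcal K$, $$(\delta-1)\frac{P\Theta_k}{n}-c_1 r\frac{\Upsilon x^2}{n}\le\mathrm{pen}(k)-\frac{2P\chi_k}{n}\le(\delta'-1)\frac{P\Theta_k}{n}+c_1 r\frac{\Upsilon x^2}{n}.$$ Then there is an absolute constant $c_2>0$ (depending only on $c_1$) such that for all $\theta\in(0,1)$ and all $x\ge1$, with probability at least $1-c_2(C+|\mathcal K|^2)e^{-x}$, $$\frac{(\delta\wedge1)-5\theta}{(\delta'\vee1)+(4+\delta')\theta}\,\|s-\hat s_{\hat k}\|^2\le\inf_{k\in\mathcal K}\|s-\hat s_k\|^2+c_2\Big(r+\frac1{\theta^3}\Big)\frac{\Upsilon x^2}{n}.$$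
   Context: Let $X,Y,X_1,\dots,X_n$ be i.i.d. random variables with values in a measure space $(\mathbb X,\mathcal X,\mu)$, with common distribution $P$ having a uniformly bounded density $s$ with respect to $\mu$ (so $s\in L^2(\mu)$). $\|\cdot\|$ and $\langle\cdot,\cdot\rangle$ are the norm and inner product of $L^2(\mu)$, $\|\cdot\|_\infty$ is the supremum norm, $a\vee b=\max(a,b)$, $a\wedge b=\min(a,b)$, and $|A|$ is the cardinality of $A$. For a real function $t$, $P_nt=\frac1n\sum_{i=1}^nt(X_i)$ and $Pt=\int t\,s\,d\mu=\mathbb E[t(X)]$. A kernel is a symmetric (measurable) function $k:\mathbb X^2\to\mathbb R$ with $\sup_x\int k(x,y)^2d\mu(y)\vee\sup_{x,y}|k(x,y)|<\infty$. For a kernel $k$: - $\hat s_k(x)=\frac1n\sum_{i=1}^nk(X_i,x)$ is the associated estimator of $s$; - $s_k(x)=\int k(y,x)s(y)d\mu(y)=\mathbb E[k(X,x)]$; - $\chi_k(x)=k(x,x)$; - $A_k(x,y)=\int k(x,z)k(z,y)d\mu(z)$ and $\Theta_k(x)=A_k(x,x)$; - $\mathbb B_k$ is the set of functions of the form $t(x)=\int a(z)k(z,x)d\mu(z)$ with $a\in L^2(\mu)$, $\|a\|\le1$, and $v_k^2=\sup_{t\in\mathbb B_k}Pt^2$. The least-squares contrast is $\gamma(t)=\|t\|^2-2t$ for $t\in L^2(\mu)$, so $P_n\gamma(\hat s_k)=\|\hat s_k\|^2-2P_n\hat s_k$. An absolute constant is a positive number not depending on any of the quantities in the problem. *)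

(* Defs.v *)
From HB Require Import structures.
From mathcomp Require Export all_boot all_order all_algebra.
From mathcomp Require Export all_classical all_reals all_analysis.

Set Implicit Arguments.
Unset Strict Implicit.
Unset Printing Implicit Defensive.

Import Order.TTheory GRing.Theory Num.Theory.
Import numFieldNormedType.Exports.

Local Open Scope classical_set_scope.
Local Open Scope ring_scope.

Section Norms.
Context {d : measure_display} {T : measurableType d} {R : realType}.
Implicit Types (mu : {measure set T -> \bar R}) (t : T -> R).

(* Extended-real valued, so that [<= c%:E] includes membership in L^2. *)
Definition normL2 mu t : \bar R := ('N[mu]_2%:E [EFin \o t])%E.

Definition supnorm t : \bar R := ereal_sup (range (fun x => `|t x|%:E)).

End Norms.

Section Kernels.
Context {d : measure_display} {T : measurableType d} {R : realType}.
Variable mu : {measure set T -> \bar R}.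
Implicit Types (k : T -> T -> R) (s t a : T -> R).

Definition kernel_size k : \bar R :=
  maxe (ereal_sup (range (fun x => (\int[mu]_y ((k x y) ^+ 2)%:E)%E)))
       (ereal_sup (range (fun xy : T * T => `|k xy.1 xy.2|%:E))).

Record is_kernel k : Prop := IsKernel {
  kernel_sym : forall x y, k x y = k y x ;
  kernel_measurable :
    measurable_fun [set: T * T] (fun xy : T * T => k xy.1 xy.2) ;
  kernel_size_fin : (kernel_size k < +oo)%E }.

(* [P t], for the law P with density [s] with respect to [mu]. *)
Definition law_mean s t : R := \int[mu]_x (t x * s x).

Definition s_ker s k : T -> R := fun x => \int[mu]_y (k y x * s y).

Definition chi_ker k : T -> R := fun x => k x x.

Definition A_ker k : T -> T -> R := fun x y => \int[mu]_z (k x z * k z y).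

Definition Theta_ker k : T -> R := fun x => A_ker k x x.

Definition B_ker k : set (T -> R) :=
  [set t | exists a, [/\ measurable_fun [set: T] a, (normL2 mu a <= 1)%E
                       & t = fun x => \int[mu]_z (a z * k z x)]].

Definition v2_ker s k : \bar R :=
  ereal_sup [set (law_mean s (fun x => t x ^+ 2))%:E | t in B_ker k].

End Kernels.

Section Estimation.
Context {d : measure_display} {T : measurableType d} {R : realType}.
Variables (mu : {measure set T -> \bar R}) (n : nat).
Implicit Types (xs : 'I_n -> T) (t : T -> R).

Definition emp_mean xs t : R := n%:R^-1 * \sum_(i < n) t (xs i).

Definition s_hat xs (k : T -> T -> R) : T -> R := fun x => n%:R^-1 * \sum_(i < n) k (xs i) x.

(* Meaningful for [t] in L^2(mu), where the norm is finite; every [s_hat] of a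
   kernel is such a function. *)
Definition contrast t : T -> R := fun x => fine (normL2 mu t ^+ 2)%E - 2 * t x.

Definition crit_pen xs (K : finType) (ker : K -> T -> T -> R) (pen : K -> R)
    (k : K) : R :=
  emp_mean xs (contrast (s_hat xs (ker k))) + pen k.

Definition minimizes (K : finType) (C : K -> R) (khat : K) : Prop :=
  forall k : K, C khat <= C k.

End Estimation.

Section Probability.
Context {d0 : measure_display} {Omega : measurableType d0} {R : realType}.
Variable Pr : probability Omega R.

(* Independence of a finite family; taking some of the [B i] to be the whole
   space gives the product rule for every subfamily. *)
Definition independent_family {d : measure_display} {T : measurableType d}
    (I : finType) (Z : I -> {RV Pr >-> T}) : Prop :=
  forall B : I -> set T, (forall i, measurable (B i)) ->
    Pr (\bigcap_(i in [set: I]) (Z i @^-1` B i)) =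
    (\prod_(i : I) Pr (Z i @^-1` B i))%E.

(* The property [Q] need not itself define a measurable event. *)
Definition with_prob_ge (p : R) (Q : Omega -> Prop) : Prop :=
  exists E : set Omega,
    [/\ measurable E, (p%:E <= Pr E)%E & forall w, E w -> Q w].

End Probability.

Section Setting.
Context {d d0 : measure_display} {T : measurableType d}
  {Omega : measurableType d0} {R : realType}.
Variables (mu : {measure set T -> \bar R}) (Pr : probability Omega R).
Variables (s : T -> R) (n : nat).
Variables (X Y : {RV Pr >-> T}) (Xs : 'I_n -> {RV Pr >-> T}).

Definition all_variables (i : bool + 'I_n) : {RV Pr >-> T} :=
  match i with inl b => if b then X else Y | inr j => Xs j end.

Record iid_with_density : Prop := IidWithDensity {
  density_measurable : measurable_fun [set: T] s ;
  density_ge0 : forall x, 0 <= s x ;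
  density_bounded : (supnorm s < +oo)%E ;
  variables_law : forall i (B : set T), measurable B ->
    Pr (all_variables i @^-1` B) = (\int[mu]_(x in B) (s x)%:E)%E ;
  variables_independent : independent_family all_variables }.

Variables (K : finType) (ker : K -> T -> T -> R) (Gamma Upsilon : R).

Record kernel_assumptions : Prop := KernelAssumptions {
  all_kernels : forall k, is_kernel mu (ker k) ;
  Gamma_ge1 : 1 <= Gamma ;
  kernels_size : forall k, (kernel_size mu (ker k) <= (Gamma * n%:R)%:E)%E ;
  Upsilon_gt0 : 0 < Upsilon ;
  Upsilon_s :
    (maxe (Gamma%:E * (1 + supnorm s))
          (ereal_sup (range (fun k => normL2 mu (s_ker mu s (ker k)) ^+ 2)))
     <= Upsilon%:E)%E ;
  Upsilon_chi : forall k,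
    law_mean mu s (fun x => chi_ker (ker k) x ^+ 2) <=
    Upsilon * n%:R * law_mean mu s (Theta_ker mu (ker k)) ;
  Upsilon_sup : forall k k',
    (supnorm (s_ker mu s (ker k) \- s_ker mu s (ker k'))%R <=
     maxe Upsilon%:E
          ((Num.sqrt (Upsilon * n%:R))%:E *
           normL2 mu (s_ker mu s (ker k) \- s_ker mu s (ker k'))%R))%E ;
  (* What makes [A_ker] of random points a random variable; automatic by
     Tonelli when [mu] is sigma-finite, but not for a general [mu]. *)
  A_measurable : forall k, measurable_fun [set: T * T]
    (fun xy : T * T => A_ker mu (ker k) xy.1 xy.2) ;
  Upsilon_AXY : forall k,
    ('E_Pr[(fun w => A_ker mu (ker k) (X w) (Y w) ^+ 2)%R] <=
     (Upsilon * law_mean mu s (Theta_ker mu (ker k)))%:E)%E ;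
  Upsilon_AX : forall k,
    (ereal_sup (range (fun x =>
       'E_Pr[(fun w => A_ker mu (ker k) (X w) x ^+ 2)%R])) <=
     (Upsilon * n%:R)%:E)%E ;
  Upsilon_v : forall k,
    (v2_ker mu s (ker k) <=
     (Num.max Upsilon
        (Num.sqrt (Upsilon * law_mean mu s (Theta_ker mu (ker k)))))%:E)%E }.

Definition data (w : Omega) : 'I_n -> T := fun i => Xs i w.

Definition loss (w : Omega) (k : K) : \bar R :=
  (normL2 mu (s \- s_hat (data w) (ker k))%R ^+ 2)%E.

Definition pen_dev (pen : Omega -> K -> R) (w : Omega) (k : K) : R :=
  pen w k - 2 * law_mean mu s (chi_ker (ker k)) / n%:R.

Definition selected (pen : Omega -> K -> R) (w : Omega) (khat : K) : Prop :=
  minimizes (crit_pen mu (data w) ker (pen w)) khat.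

End Setting.

(* Main.v *)
(** Up to lower order terms the expected risk of [hat s_k] is
    [||s - s_k||^2 + P Theta_k / n].  Expanding the squares, [||s - hat s_k||^2] is
    this risk plus centered terms: a sum and a degenerate U-statistic coming from
    [Theta_k] and [A_k], and a linear cross term.  Likewise
    [P_n gamma (hat s_k) = ||s - hat s_k||^2 - ||s||^2 - 2 P chi_k / n - 2 F_k],
    and [F_k - F_k'] involves, up to [O(Upsilon / n)], only sums of [chi_k],
    degenerate U-statistics of kernel [k], and the sum of [s_k - s_k'].  On one event
    of probability at least [1 - 6 |K|^2 e^-x] each of these terms is at most an
    [eps]-fraction of the risks plus a multiple of [Upsilon x^2 / n], and the two
    oracle inequalities become real arithmetic.

    The tails come from even moments of order about [x].  Convexity of [t^(2m)]
    lets one attach independent signs to a degenerate chaos without a ghost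
    sample; a two-point inequality and Minkowski's inequality give
    hypercontractivity conditionally on the sample; what is left are moments of
    nonnegative sums and pair sums, which are bounded by expanding one factor of
    the power at a time and integrating out the points it selects. *)

From HB Require Import structures.
Require Import Defs.
From mathcomp Require Import measurable_realfun ring lra zify.

Set Implicit Arguments.
Unset Strict Implicit.
Unset Printing Implicit Defensive.

Import Order.TTheory GRing.Theory Num.Theory.
Import numFieldNormedType.Exports.

Local Open Scope classical_set_scope.
Local Open Scope ring_scope.

(** * Bounded measurable functions and iterated expectations *)

(** The event has to serve every [theta] at once. Each deviation is therefore kept squared, as
    [y ^+ 2 <= C * (p * q + q ^+ 2)] with [q = Upsilon * x ^+ 2 / n] and [p] comparable to a part of
    the risks; the arithmetic-geometric mean inequality then gives [e * p + C * q / e] for all [e]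
    on the same event. The linear cross term is the exception: its variance is only bounded by the
    bias times [Upsilon + sqrt (Upsilon * P Theta_k)], and separating this product costs [e ^- 3].
    In part (i) the loss is compared with the risk at a fixed [e], and only the fluctuation sees
    [theta], whence [1 / theta]; in part (ii) the penalty is compared with the risk up to a fraction
    of [theta], whence [1 / theta ^+ 3]. Only differences [F_k - F_k'] can be bounded in this way:
    [F_k] alone contains the centered sum of [s_k], which the risk does not control, while the norm
    of [s_k - s_k'] is controlled by the two biases. *)

Section BoundedMeasurable.
Context {d : measure_display} {T : measurableType d} {R : realType}.
Implicit Types f g : T -> R.

(** Kernels are bounded by [Gamma * n], so the integrands of the probabilistic part stay in this
    class. It is closed under sums and products, and linearity and Fubini hold in it for real-valued
    integrals. *)
Definition bmeas f := measurable_fun [set: T] f /\ exists M, forall x, `|f x| <= M.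

Lemma bmeas_cst c : bmeas (fun=> c).
Proof. by split => //; exists `|c|. Qed.

Lemma bmeasD f g : bmeas f -> bmeas g -> bmeas (fun x => f x + g x).
Proof.
move=> [mf [M fM]] [mg [N gN]]; split; first exact: measurable_funD.
by exists (M + N) => x; rewrite (le_trans (ler_normD _ _))// lerD.
Qed.

Lemma bmeasM f g : bmeas f -> bmeas g -> bmeas (fun x => f x * g x).
Proof.
move=> [mf [M fM]] [mg [N gN]]; split; first exact: measurable_funM.
by exists (M * N) => x; rewrite normrM ler_pM.
Qed.

Lemma bmeasN f : bmeas f -> bmeas (fun x => - f x).
Proof.
move=> [mf [M fM]]; split; first exact: measurableT_comp.
by exists M => x; rewrite normrN.
Qed.

Lemma bmeasB f g : bmeas f -> bmeas g -> bmeas (fun x => f x - g x).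
Proof. by move=> bf bg; apply: bmeasD => //; exact: bmeasN. Qed.

Lemma bmeasX f n : bmeas f -> bmeas (fun x => f x ^+ n).
Proof.
move=> bf; elim: n => [|n ih].
  by under eq_fun do rewrite expr0; exact: bmeas_cst.
by under eq_fun do rewrite exprS; exact: bmeasM.
Qed.

Lemma bmeas_sum (I : Type) (r : seq I) (p : pred I) (F : I -> T -> R) :
  (forall i, bmeas (F i)) -> bmeas (fun x => \sum_(i <- r | p i) F i x).
Proof.
move=> bF; elim: r => [|i r ih].
  by under eq_fun do rewrite big_nil; exact: bmeas_cst.
under eq_fun do rewrite big_cons.
by case: (p i) => //; exact: bmeasD.
Qed.

End BoundedMeasurable.

Lemma bmeas_comp {d d' : measure_display} {T : measurableType d} {T' : measurableType d'}
    {R : realType} (h : T' -> R) (phi : T -> T') :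
  bmeas h -> measurable_fun [set: T] phi -> bmeas (fun x => h (phi x)).
Proof.
move=> [mh [M hM]] mphi; split; first exact: measurableT_comp.
by exists M.
Qed.

Section Expectation.
Context {d : measure_display} {T : measurableType d} {R : realType}.
Variable P : probability T R.
Implicit Types f g : T -> R.

Lemma bmeas_integrable f : bmeas f -> P.-integrable [set: T] (EFin \o f).
Proof.
move=> [mf [M fM]]; apply: measurable_bounded_integrable => //.
  by rewrite -ge0_fin_numE// fin_num_measure.
by exists M; split; [exact: num_real|move=> N MN x _; exact: le_trans (fM x) (ltW MN)].
Qed.

Lemma exD f g : bmeas f -> bmeas g ->
  \int[P]_x (f x + g x) = \int[P]_x f x + \int[P]_x g x.
Proof. by move=> bf bg; rewrite RintegralD//; exact: bmeas_integrable. Qed.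

Lemma exB f g : bmeas f -> bmeas g ->
  \int[P]_x (f x - g x) = \int[P]_x f x - \int[P]_x g x.
Proof. by move=> bf bg; rewrite RintegralB//; exact: bmeas_integrable. Qed.

Lemma exZ f c : bmeas f -> \int[P]_x (c * f x) = c * \int[P]_x f x.
Proof. by move=> bf; rewrite RintegralZl//; exact: bmeas_integrable. Qed.

Lemma ex_cst c : \int[P]_x c = c :> R.
Proof.
rewrite Rintegral_cst// [fine _](_ : _ = 1) ?mulr1//.
exact: (congr1 fine (probability_setT P)).
Qed.

Lemma ex_sum (I : Type) (r : seq I) (p : pred I) (F : I -> T -> R) :
  (forall i, bmeas (F i)) ->
  \int[P]_x (\sum_(i <- r | p i) F i x) = \sum_(i <- r | p i) \int[P]_x F i x.
Proof.
move=> bF; elim: r => [|i r ih].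
  by rewrite big_nil; under eq_Rintegral do rewrite big_nil; rewrite ex_cst.
rewrite big_cons; under eq_Rintegral do rewrite big_cons.
case: (p i) => //; rewrite exD ?ih//; exact: bmeas_sum.
Qed.

Lemma ex_le f g : bmeas f -> bmeas g -> (forall x, f x <= g x) ->
  \int[P]_x f x <= \int[P]_x g x.
Proof. by move=> bf bg fg; apply: le_Rintegral => //; exact: bmeas_integrable. Qed.

Lemma ex_le_cst f c : bmeas f -> (forall x, f x <= c) -> \int[P]_x f x <= c.
Proof.
move=> bf fc; rewrite -[leRHS]ex_cst; apply: ex_le => //; exact: bmeas_cst.
Qed.

Lemma ex_EFin f : bmeas f -> (\int[P]_x f x)%:E = (\int[P]_x (f x)%:E)%E.
Proof.
by move=> bf; rewrite /Rintegral fineK//; apply: integrable_fin_num => //; exact: bmeas_integrable.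
Qed.

Lemma ex_norm f c : bmeas f -> (forall x, `|f x| <= c) -> `|\int[P]_x f x| <= c.
Proof.
move=> bf fc; rewrite ler_norml -[X in _ <= X <= _]mul1r; apply/andP; split.
  rewrite -[leLHS]ex_cst mul1r; apply: ex_le => //; first exact: bmeas_cst.
  by move=> x; have := fc x; rewrite ler_norml => /andP[].
rewrite mul1r; apply: ex_le_cst => // x; exact: le_trans (ler_norm _) (fc x).
Qed.

End Expectation.

Section Fubini.
Context {d1 d2 : measure_display} {T1 : measurableType d1} {T2 : measurableType d2}
  {R : realType}.
Variables (P1 : probability T1 R) (P2 : probability T2 R).

Lemma bmeas_ex2 (f : T1 * T2 -> R) : bmeas f -> bmeas (fun x => \int[P2]_y f (x, y)).
Proof.
move=> bf; have [mf [M fM]] := bf.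
have bs x : bmeas (fun y => f (x, y)) by apply: bmeas_comp => //; exact: pair1_measurable.
split; last by exists M => x; apply: ex_norm.
apply/measurable_EFinP.
apply: (eq_measurable_fun (fubini_F P2 (EFin \o f))).
  by move=> x _; rewrite /fubini_F /= ex_EFin.
apply: (@measurable_fubini_F _ _ _ _ R P1 P2).
exact: (@bmeas_integrable _ _ R (P1 \x P2)%E).
Qed.

Lemma ex_prod (f : T1 * T2 -> R) : bmeas f ->
  \int[(P1 \x P2)%E]_z f z = \int[P1]_x \int[P2]_y f (x, y).
Proof.
move=> bf; have [mf [M fM]] := bf.
have bs x : bmeas (fun y => f (x, y)) by apply: bmeas_comp => //; exact: pair1_measurable.
apply: EFin_inj; apply: (etrans (@ex_EFin _ _ R (P1 \x P2)%E _ bf)).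
rewrite ex_EFin; last exact: bmeas_ex2.
have := @integral12_prod_meas1 _ _ _ _ R P1 P2 _ (@bmeas_integrable _ _ R (P1 \x P2)%E _ bf).
move=> <-.
by apply: eq_integral => x _; rewrite /fubini_F/= ex_EFin.
Qed.

End Fubini.

Section FubiniSwap.
Context {d1 d2 : measure_display} {T1 : measurableType d1} {T2 : measurableType d2}
  {R : realType}.
Variables (P1 : probability T1 R) (P2 : probability T2 R).

Lemma bmeas_swap (f : T1 * T2 -> R) : bmeas f -> bmeas (fun z : T2 * T1 => f (z.2, z.1)).
Proof.
move=> bf; apply: (bmeas_comp (phi := fun z : T2 * T1 => (z.2, z.1)) bf).
exact: measurable_fun_pair.
Qed.

Lemma bmeas_ex1 (f : T1 * T2 -> R) : bmeas f -> bmeas (fun y => \int[P1]_x f (x, y)).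
Proof. by move=> bf; exact: (@bmeas_ex2 _ _ _ _ R P2 P1 _ (bmeas_swap bf)). Qed.

Lemma ex_swap (f : T1 * T2 -> R) : bmeas f ->
  \int[P1]_x \int[P2]_y f (x, y) = \int[P2]_y \int[P1]_x f (x, y).
Proof.
move=> bf; have [mf [M fM]] := bf.
have b1 x : bmeas (fun y => f (x, y)) by apply: bmeas_comp => //; exact: pair1_measurable.
have b2 y : bmeas (fun x => f (x, y)) by apply: bmeas_comp => //; exact: pair2_measurable.
apply: EFin_inj; rewrite ex_EFin; last exact: bmeas_ex2.
rewrite ex_EFin; last exact: bmeas_ex1.
under eq_integral do rewrite ex_EFin//.
under [RHS]eq_integral do rewrite ex_EFin//.
exact: (@Fubini _ _ _ _ R P1 P2 (EFin \o f) (bmeas_integrable _ bf)).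
Qed.

End FubiniSwap.

(** * Moments of Rademacher chaos *)

Section PowerInequalities.
Context {R : realType}.
Implicit Types (a b g h r s u v x y : R) (m : nat).

(** Induction on the remainder of the tangent at [r]: the next remainder is [s] times the previous
    one plus [m.+1%:R * r ^+ m * (s - r) ^+ 2]. *)
Lemma bernoulli_tangent r s m : 0 <= r -> 0 <= s ->
  r ^+ m.+1 + m.+1%:R * r ^+ m * (s - r) <= s ^+ m.+1.
Proof.
move=> r0 s0; elim: m => [|m ih]; first by rewrite !expr1 expr0; lra.
rewrite -subr_ge0.
have -> : s ^+ m.+2 - (r ^+ m.+2 + m.+2%:R * r ^+ m.+1 * (s - r)) =
  s * (s ^+ m.+1 - (r ^+ m.+1 + m.+1%:R * r ^+ m * (s - r))) +
  m.+1%:R * r ^+ m * (s - r) ^+ 2 by rewrite !exprS -(natr1 m.+1); ring.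
apply: addr_ge0; first by rewrite mulr_ge0// subr_ge0.
by rewrite mulr_ge0 ?sqr_ge0// mulr_ge0// exprn_ge0.
Qed.

(** The tangent of the power is taken at the squares, and [v ^+ 2 - u ^+ 2] exceeds
    [2 * u * (v - u)] by a square. *)
Lemma even_tangent u v m :
  (u ^+ 2) ^+ m.+1 + 2 * m.+1%:R * (u ^+ 2) ^+ m * u * (v - u) <= (v ^+ 2) ^+ m.+1.
Proof.
apply: le_trans (bernoulli_tangent m (sqr_ge0 u) (sqr_ge0 v)).
rewrite lerD2l -subr_ge0.
have -> : m.+1%:R * (u ^+ 2) ^+ m * (v ^+ 2 - u ^+ 2) -
  2 * m.+1%:R * (u ^+ 2) ^+ m * u * (v - u) =
  m.+1%:R * (u ^+ 2) ^+ m * (v - u) ^+ 2 by ring.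
by rewrite mulr_ge0 ?sqr_ge0// mulr_ge0// exprn_ge0// sqr_ge0.
Qed.

(* Convexity of the even power: the midpoint inequality between [a] and
   [a + 2 y], then the tangent at [a] evaluated at [a - 2 y]. *)
Lemma symmetrize_pow a y m :
  ((a + y) ^+ 2) ^+ m.+1 <=
  2^-1 * (((a + 2 * y) ^+ 2) ^+ m.+1 + ((a - 2 * y) ^+ 2) ^+ m.+1)
  + 2 * m.+1%:R * (a ^+ 2) ^+ m * a * y.
Proof.
have t1 := even_tangent (a + y) (a + 2 * y) m.
have t2 := even_tangent (a + y) a m.
have t3 := even_tangent a (a - 2 * y) m.
move: t1 t2 t3.
have -> : a + 2 * y - (a + y) = y by ring.
have -> : a - (a + y) = - y by ring.
have -> : a - 2 * y - a = - (2 * y) by ring.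
set A := ((a + y) ^+ 2) ^+ m.+1; set B := ((a + 2 * y) ^+ 2) ^+ m.+1.
set C := ((a - 2 * y) ^+ 2) ^+ m.+1; set E := (a ^+ 2) ^+ m.+1.
set X := 2 * m.+1%:R * ((a + y) ^+ 2) ^+ m * (a + y).
set Y := 2 * m.+1%:R * (a ^+ 2) ^+ m * a.
rewrite mulrN (mulrN Y) (mulrCA Y).
by move: (X * y) (Y * y) => p q; lra.
Qed.

(** Both factors on the left have the same sign, and the increment of the power is at most its slope
    at the larger point times the distance. *)
Lemma pow_increment_mul x y m : 0 <= x -> 0 <= y ->
  (x - y) * (x ^+ m.+1 - y ^+ m.+1) <=
  m.+1%:R * (x - y) ^+ 2 * (x ^+ m + y ^+ m).
Proof.
move=> x0 y0.
have tx := bernoulli_tangent m x0 y0; have ty := bernoulli_tangent m y0 x0.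
have px : 0 <= m.+1%:R * (x - y) ^+ 2 * x ^+ m.
  by rewrite mulr_ge0 ?exprn_ge0// mulr_ge0// sqr_ge0.
have py : 0 <= m.+1%:R * (x - y) ^+ 2 * y ^+ m.
  by rewrite mulr_ge0 ?exprn_ge0// mulr_ge0// sqr_ge0.
rewrite [leRHS]mulrDr.
have [yx|xy] := leP y x.
  apply: (@le_trans _ _ ((x - y) * (m.+1%:R * x ^+ m * (x - y)))).
    by rewrite ler_wpM2l ?subr_ge0//; lra.
  rewrite [leLHS](_ : _ = m.+1%:R * (x - y) ^+ 2 * x ^+ m); first by lra.
  by rewrite expr2; ring.
apply: (@le_trans _ _ ((y - x) * (m.+1%:R * y ^+ m * (y - x)))).
  rewrite -[leLHS]mulrNN !opprB ler_wpM2l ?subr_ge0 ?(ltW xy)//; lra.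
rewrite [leLHS](_ : _ = m.+1%:R * (x - y) ^+ 2 * y ^+ m); first by lra.
by rewrite expr2; ring.
Qed.

(** Hypercontractivity of a single random sign. The means of [A ^+ m] and [B ^+ m] satisfy a
    three-term recursion, in which [(A - B) ^+ 2 = 16 * u * v] brings in the factor of order [m]
    before [h ^+ 2]. *)
Lemma two_point_pow g h m :
  2^-1 * (((g + h) ^+ 2) ^+ m + ((g - h) ^+ 2) ^+ m) <=
  (g ^+ 2 + 4 * m%:R * h ^+ 2) ^+ m.
Proof.
set A := (g + h) ^+ 2; set B := (g - h) ^+ 2.
set u := g ^+ 2; set v := h ^+ 2.
have u0 : 0 <= u by exact: sqr_ge0.
have v0 : 0 <= v by exact: sqr_ge0.
have w0 n : 0 <= u + 4 * n%:R * v by rewrite addr_ge0// mulr_ge0// mulr_ge0.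
(* The recursion links three consecutive exponents, so the induction carries two of them. *)
suff [] : 2^-1 * (A ^+ m + B ^+ m) <= (u + 4 * m%:R * v) ^+ m /\
  2^-1 * (A ^+ m.+1 + B ^+ m.+1) <= (u + 4 * m.+1%:R * v) ^+ m.+1 by [].
elim: m => [|m [ih0 ih1]].
  rewrite !expr0 !expr1; split; first by lra.
  have -> : 2^-1 * (A + B) = u + v by rewrite /A /B /u /v; field.
  by lra.
split=> //.
set w := u + 4 * m.+1%:R * v in ih1 *.
have ww : 0 <= w by exact: w0.
have uw : u <= w by rewrite lerDl mulr_ge0// mulr_ge0.
have p0 : 0 <= A ^+ m + B ^+ m by rewrite addr_ge0// exprn_ge0// sqr_ge0.
have e4 : A - B = 4 * (g * h) by rewrite /A /B; ring.
have step : 2^-1 * (A ^+ m.+2 + B ^+ m.+2) <=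
  (u + v) * (2^-1 * (A ^+ m.+1 + B ^+ m.+1)) +
  8 * m.+1%:R * u * v * (2^-1 * (A ^+ m + B ^+ m)).
  have := pow_increment_mul m (sqr_ge0 (g + h)) (sqr_ge0 (g - h)).
  rewrite -/A -/B => H.
  have -> : 2^-1 * (A ^+ m.+2 + B ^+ m.+2) = (u + v) * (2^-1 * (A ^+ m.+1 + B ^+ m.+1))
     + 4^-1 * ((A - B) * (A ^+ m.+1 - B ^+ m.+1)).
    have -> : u + v = 2^-1 * (A + B) by rewrite /A /B /u /v; field.
    by rewrite !(exprS _ m.+1); field.
  rewrite lerD2l.
  apply: (le_trans (ler_wpM2l _ H)); first by rewrite invr_ge0.
  rewrite e4 le_eqVlt; apply/orP; left; apply/eqP.
  by rewrite /u /v; field.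
have q0 : 0 <= 2^-1 * (A ^+ m + B ^+ m) by rewrite mulr_ge0// invr_ge0.
have ih0' : 2^-1 * (A ^+ m + B ^+ m) <= w ^+ m.
  apply: (le_trans ih0); apply: lerXn2r; rewrite ?nnegrE//.
  by rewrite /w lerD2l ler_wpM2r// ler_wpM2l// ler_nat.
apply: (le_trans step).
apply: (@le_trans _ _ ((u + v) * w ^+ m.+1 + 8 * m.+1%:R * v * w ^+ m.+1)).
  apply: lerD; first by rewrite ler_wpM2l// addr_ge0.
  have -> : 8 * m.+1%:R * u * v * (2^-1 * (A ^+ m + B ^+ m)) =
    8 * m.+1%:R * v * (u * (2^-1 * (A ^+ m + B ^+ m))) by ring.
  rewrite ler_wpM2l//; first by rewrite mulr_ge0// mulr_ge0.
  by rewrite exprS ler_pM.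
(* The target is bounded below by its tangent at [w] with increment [4 * v]; compared with it, the
   sum obtained so far leaves the slack [3 * v * w ^+ m.+1]. *)
have -> : u + 4 * m.+2%:R * v = w + 4 * v by rewrite /w -(natr1 m.+1); ring.
apply: le_trans (bernoulli_tangent m.+1 ww _); last by rewrite addr_ge0// mulr_ge0.
have -> : w + 4 * v - w = 4 * v by ring.
have -> : u = w - 4 * m.+1%:R * v by rewrite /w; ring.
rewrite -subr_ge0.
have -> : w ^+ m.+2 + m.+2%:R * w ^+ m.+1 * (4 * v) -
  ((w - 4 * m.+1%:R * v + v) * w ^+ m.+1 + 8 * m.+1%:R * v * w ^+ m.+1) =
  3 * v * w ^+ m.+1 by rewrite (exprS _ m.+1) -(natr1 m.+1); ring.
by rewrite mulr_ge0 ?exprn_ge0// mulr_ge0.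
Qed.

(** Jensen's inequality for the power at the points [u / a] and [v / b], with weights proportional
    to [a] and [b]. When [a] and [b] play the role of norms, averaging it gives Minkowski's
    inequality without taking roots. *)
Lemma pow_convex_split u v a b m : 0 <= u -> 0 <= v -> 0 < a -> 0 < b ->
  (u + v) ^+ m.+1 <=
  (a + b) ^+ m * (u ^+ m.+1 / a ^+ m + v ^+ m.+1 / b ^+ m).
Proof.
move=> u0 v0 a0 b0; have ab0 : 0 < a + b by exact: addr_gt0.
set z := (u + v) / (a + b).
have z0 : 0 <= z by rewrite divr_ge0// ?addr_ge0// ltW.
have tu := bernoulli_tangent m z0 (divr_ge0 u0 (ltW a0)).
have tv := bernoulli_tangent m z0 (divr_ge0 v0 (ltW b0)).
have key : (a + b) * z ^+ m.+1 <= a * (u / a) ^+ m.+1 + b * (v / b) ^+ m.+1.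
  apply: le_trans (lerD (ler_wpM2l (ltW a0) tu) (ler_wpM2l (ltW b0) tv)).
  rewrite le_eqVlt; apply/orP; left; apply/eqP.
  have -> : u / a - z = (u - a * z) / a by field; rewrite gt_eqF.
  have -> : v / b - z = (v - b * z) / b by field; rewrite gt_eqF.
  have e : v - b * z = - (u - a * z) by rewrite /z; field; rewrite gt_eqF.
  by rewrite e; field; rewrite !gt_eqF.
apply: (@le_trans _ _ ((a + b) ^+ m * ((a + b) * z ^+ m.+1))).
  rewrite /z expr_div_n le_eqVlt; apply/orP; left; apply/eqP.
  by rewrite (exprS (a + b)); field; rewrite !expf_neq0 ?gt_eqF.
rewrite ler_wpM2l ?exprn_ge0 ?(ltW ab0)//; apply: (le_trans key).
rewrite !expr_div_n le_eqVlt; apply/orP; left; apply/eqP.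
by rewrite (exprS a) (exprS b); field; rewrite !expf_neq0 ?gt_eqF.
Qed.

(** Removes the enlargement of the norms that makes them positive, as the divisions in
    [pow_convex_split] require. *)
Lemma le_pow_limit x c m : 0 <= c -> (forall e, 0 < e -> x <= (c + e) ^+ m) ->
  x <= c ^+ m.
Proof.
move=> c0 H; case: m => [|m] in H *; first by have := H 1 ltr01; rewrite !expr0.
rewrite leNgt; apply/negP => lt.
have x0 : 0 < x by apply: le_lt_trans lt; rewrite exprn_ge0.
set y := x `^ (m.+1%:R^-1).
have ym : y ^+ m.+1 = x.
  by rewrite -powR_mulrn ?powR_ge0// /y -powRrM mulVf ?powRr1 ?ltW// pnatr_eq0.
have cy : c < y.
  rewrite ltNge; apply/negP => yc; move: lt; rewrite ltNge => /negP; apply.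
  by rewrite -ym lerXn2r// nnegrE// ?powR_ge0.
have e0 : 0 < (y - c) / 2 by rewrite divr_gt0// subr_gt0.
have := H _ e0; rewrite -ym leNgt => /negP; apply.
by rewrite ltrXn2r// ?nnegrE ?addr_ge0 ?powR_ge0//; lra.
Qed.

End PowerInequalities.

Section SignAverage.
Context {R : realType}.
Implicit Types F G H : seq R -> R.

(** The mean over all sign lists of length [n]. The head is averaged innermost: one unfolding is a
    two-point mean with the other signs fixed, which matches the recursion of [lin] and [quad]. *)
Fixpoint sign_avg n F : R :=
  if n is n'.+1 then
    sign_avg n' (fun es => 2^-1 * (F (1 :: es) + F (- 1 :: es)))
  else F [::].

Lemma sign_avgS n F : sign_avg n.+1 F =
  sign_avg n (fun es => 2^-1 * (F (1 :: es) + F (- 1 :: es))).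
Proof. by []. Qed.

Lemma sign_avg_le n F G : (forall es, F es <= G es) -> sign_avg n F <= sign_avg n G.
Proof.
elim: n F G => [|n ih] F G FG //=; apply: ih => es.
by rewrite ler_wpM2l ?invr_ge0// lerD.
Qed.

Lemma sign_avgD n F G :
  sign_avg n (fun es => F es + G es) = sign_avg n F + sign_avg n G.
Proof.
elim: n F G => [|n ih] F G //=; rewrite -ih; congr sign_avg; apply/funext => es.
by ring.
Qed.

Lemma sign_avgZ n c F : sign_avg n (fun es => c * F es) = c * sign_avg n F.
Proof.
elim: n F => [|n ih] F //=; rewrite -ih; congr sign_avg; apply/funext => es.
by ring.
Qed.

Lemma sign_avg_cst n c : sign_avg n (fun=> c) = c.
Proof.
by elim: n => [|n ih] //=; rewrite -[RHS]ih; congr sign_avg; apply/funext => es; field.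
Qed.

(** Minkowski's inequality in L^m: [pow_convex_split] is averaged with [a] and [b] enlarged by
    [e / 2], and [e] then tends to 0. *)
Lemma sign_avg_pos_minkowski n F G a b m : (forall es, 0 <= F es) ->
  (forall es, 0 <= G es) -> 0 <= a -> 0 <= b ->
  sign_avg n (fun es => F es ^+ m) <= a ^+ m ->
  sign_avg n (fun es => G es ^+ m) <= b ^+ m ->
  sign_avg n (fun es => (F es + G es) ^+ m) <= (a + b) ^+ m.
Proof.
move=> F0 G0 a0 b0; case: m => [_ _|m Fa Gb].
  rewrite expr0; under eq_fun do rewrite expr0.
  by rewrite sign_avg_cst.
apply: le_pow_limit; first exact: addr_ge0.
move=> e e0; set a' := a + e / 2; set b' := b + e / 2.
have e2 : 0 < e / 2 by rewrite divr_gt0.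
have a'0 : 0 < a' by rewrite ltr_wpDl.
have b'0 : 0 < b' by rewrite ltr_wpDl.
have -> : a + b + e = a' + b' by rewrite /a' /b'; field.
apply: (@le_trans _ _ (sign_avg n (fun es => (a' + b') ^+ m *
    (a' ^- m * F es ^+ m.+1 + b' ^- m * G es ^+ m.+1)))).
  apply: sign_avg_le => es; rewrite [a' ^- m * _]mulrC [b' ^- m * _]mulrC.
  exact: pow_convex_split.
rewrite sign_avgZ sign_avgD !sign_avgZ exprSr.
have ab0 : 0 <= a' + b' by rewrite addr_ge0// ltW.
rewrite ler_wpM2l ?exprn_ge0//.
have bd (c c' : R) : 0 <= c -> 0 < c' -> c <= c' -> forall x : R, x <= c ^+ m.+1 ->
    c' ^- m * x <= c'.
  move=> c0 c'0 cc' x xc; rewrite ler_pdivrMl ?exprn_gt0// -exprSr.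
  by apply: (le_trans xc); apply: lerXn2r; rewrite ?nnegrE// ltW.
by apply: lerD; [apply: (bd a)|apply: (bd b)] => //; rewrite lerDl ltW.
Qed.

End SignAverage.

Section Chaos.
Context {T : Type} {R : realType}.
Implicit Types (l : T -> R) (g : T -> T -> R) (es : seq R) (xs : seq T).

Fixpoint lin l es xs : R :=
  match es, xs with
  | e :: es', x :: xs' => e * l x + lin l es' xs'
  | _, _ => 0
  end.

(** For symmetric [g], the sum of [e_i * e_j * g x_i x_j] over ordered pairs of distinct positions;
    the factor 2 counts both orders. *)
Fixpoint quad g es xs : R :=
  match es, xs with
  | e :: es', x :: xs' => 2 * e * lin (g x) es' xs' + quad g es' xs'
  | _, _ => 0
  end.

(** The sum of the squared coefficients of [quad] over unordered pairs; the 4 is the square of the 2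
    there. *)
Fixpoint energy g xs : R :=
  if xs is x :: xs' then 4 * \sum_(y <- xs') g x y ^+ 2 + energy g xs' else 0.

Lemma linZ c l es xs : lin (fun y => c * l y) es xs = c * lin l es xs.
Proof.
elim: es xs => [|e es ih] [|x xs] /=; rewrite ?mulr0//.
by rewrite ih; ring.
Qed.

Lemma linD l l' es xs : lin (fun y => l y + l' y) es xs = lin l es xs + lin l' es xs.
Proof.
elim: es xs => [|e es ih] [|x xs] /=; rewrite ?addr0//.
by rewrite ih; ring.
Qed.

Lemma lin_scale c l es xs : lin l [seq c * e | e <- es] xs = c * lin l es xs.
Proof.
elim: es xs => [|e es ih] [|x xs] /=; rewrite ?mulr0//.
by rewrite ih; ring.
Qed.

Lemma quad_scale c g es xs : quad g [seq c * e | e <- es] xs = c ^+ 2 * quad g es xs.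
Proof.
elim: es xs => [|e es ih] [|x xs] /=; rewrite ?mulr0//.
by rewrite ih lin_scale; ring.
Qed.

Lemma energy_ge0 g xs : 0 <= energy g xs.
Proof.
elim: xs => //= x xs ih; rewrite addr_ge0// mulr_ge0// sumr_ge0// => y _.
exact: sqr_ge0.
Qed.

(* One step of the hypercontractive induction: the sign of the head is averaged
   first, and [two_point_pow] turns it into a nonnegative sum, to which
   Minkowski's inequality in L^m applies. *)
Lemma sign_avg_step n (G H : seq R -> R) a b m : 0 <= a -> 0 <= b ->
  sign_avg n (fun es => (G es ^+ 2) ^+ m) <= a ^+ m ->
  sign_avg n (fun es => (H es ^+ 2) ^+ m) <= b ^+ m ->
  sign_avg n (fun es => 2^-1 * (((G es + H es) ^+ 2) ^+ m + ((G es - H es) ^+ 2) ^+ m))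
    <= (a + 4 * m%:R * b) ^+ m.
Proof.
move=> a0 b0 Ga Hb.
apply: (le_trans (sign_avg_le n (fun es => two_point_pow (G es) (H es) m))).
have c0 : 0 <= 4 * m%:R :> R by rewrite mulr_ge0.
move: (4 * m%:R) c0 => c c0.
apply: sign_avg_pos_minkowski => //.
- by move=> es; exact: sqr_ge0.
- by move=> es; rewrite mulr_ge0// sqr_ge0.
- exact: mulr_ge0.
under eq_fun do rewrite exprMn.
by rewrite sign_avgZ exprMn ler_wpM2l// exprn_ge0.
Qed.

(** Khintchine's inequality. The offset [c] serves [quad_moment], where the coefficient of the head
    sign is a sign sum shifted by [l x]. *)
Lemma lin_moment c l xs m :
  sign_avg (size xs) (fun es => ((c + lin l es xs) ^+ 2) ^+ m) <=
  (c ^+ 2 + 4 * m%:R * \sum_(x <- xs) l x ^+ 2) ^+ m.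
Proof.
elim: xs => [|x xs ih]; first by rewrite big_nil /= addr0 mulr0 addr0.
rewrite [leLHS]/=.
have -> : (fun es => 2^-1 * (((c + (1 * l x + lin l es xs)) ^+ 2) ^+ m +
    ((c + (-1 * l x + lin l es xs)) ^+ 2) ^+ m)) =
  (fun es => 2^-1 * (((c + lin l es xs + l x) ^+ 2) ^+ m +
    ((c + lin l es xs - l x) ^+ 2) ^+ m)).
  by apply/funext => es; congr (_ * (_ ^+ _ ^+ _ + _ ^+ _ ^+ _)); ring.
rewrite big_cons [l x ^+ 2 + _]addrC mulrDr addrA.
apply: (@sign_avg_step _ (fun es => c + lin l es xs) (fun=> l x)) => //.
- rewrite addr_ge0 ?sqr_ge0// mulr_ge0// ?mulr_ge0// sumr_ge0// => y _.
  exact: sqr_ge0.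
- exact: sqr_ge0.
by rewrite sign_avg_cst.
Qed.

(** The coefficient of the head sign is [l x] plus a linear sign sum in the remaining signs, and its
    moments come from [lin_moment]. Each of the two averagings costs a factor [4 * m%:R], hence the
    square in front of [energy]. *)
Lemma quad_moment c l g xs m :
  sign_avg (size xs) (fun es => ((c + lin l es xs + quad g es xs) ^+ 2) ^+ m) <=
  (c ^+ 2 + 4 * m%:R * \sum_(x <- xs) l x ^+ 2 + (4 * m%:R) ^+ 2 * energy g xs) ^+ m.
Proof.
elim: xs => [|x xs ih]; first by rewrite big_nil /= !addr0 !mulr0 !addr0.
rewrite [leLHS]/=.
have -> : (fun es => 2^-1 * (((c + (1 * l x + lin l es xs) +
      (2 * 1 * lin (g x) es xs + quad g es xs)) ^+ 2) ^+ m +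
    ((c + (-1 * l x + lin l es xs) +
      (2 * -1 * lin (g x) es xs + quad g es xs)) ^+ 2) ^+ m)) =
  (fun es => 2^-1 * (((c + lin l es xs + quad g es xs
       + (l x + lin (fun y => 2 * g x y) es xs)) ^+ 2) ^+ m +
    ((c + lin l es xs + quad g es xs
       - (l x + lin (fun y => 2 * g x y) es xs)) ^+ 2) ^+ m)).
  by apply/funext => es; rewrite linZ; congr (_ * (_ ^+ _ ^+ _ + _ ^+ _ ^+ _)); ring.
have s0 (h : T -> R) : 0 <= \sum_(y <- xs) h y ^+ 2.
  by rewrite sumr_ge0// => y _; exact: sqr_ge0.
apply: le_trans (sign_avg_step _ _ ih (lin_moment (l x) (fun y => 2 * g x y) xs m)) _.
- by rewrite !addr_ge0 ?sqr_ge0// mulr_ge0 ?sqr_ge0 ?energy_ge0 ?s0// mulr_ge0.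
- by rewrite addr_ge0 ?sqr_ge0// mulr_ge0 ?s0// mulr_ge0.
rewrite le_eqVlt; apply/orP; left; apply/eqP.
congr (_ ^+ _); rewrite big_cons /=.
have -> : \sum_(y <- xs) (2 * g x y) ^+ 2 = 4 * \sum_(y <- xs) g x y ^+ 2.
  by rewrite mulr_sumr; apply: eq_bigr => y _; ring.
by ring.
Qed.

End Chaos.

(** * Symmetrization of i.i.d. samples *)

Section IidLaw.
Context {d : measure_display} {T : measurableType d} {R : realType}.
Variable P : probability T R.

Definition cons_pair n (z : T * n.-tuple T) : n.+1.-tuple T := [tuple of z.1 :: z.2].

Lemma measurable_cons_pair n : measurable_fun [set: T * n.-tuple T] (@cons_pair n).
Proof. exact: measurable_cons. Qed.

HB.instance Definition _ n :=
  isMeasurableFun.Build _ _ _ _ (@cons_pair n) (@measurable_cons_pair n).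

(** Built from binary products one head at a time, so that an expectation unfolds by Fubini as in
    [ex_iidS]; [sample_law] identifies it with the law of the observations. *)
Fixpoint iid_law n : probability (n.-tuple T) R :=
  if n is n'.+1 then distribution (P \x iid_law n')%E (@cons_pair n')
  else dirac [tuple].

Lemma bmeas_cons n (f : n.+1.-tuple T -> R) :
  bmeas f -> bmeas (fun z => f (@cons_pair n z)).
Proof. by move=> bf; apply: (bmeas_comp bf); exact: measurable_cons_pair. Qed.

Lemma ex_iidS n (f : n.+1.-tuple T -> R) : bmeas f ->
  \int[iid_law n.+1]_t f t = \int[P]_x \int[iid_law n]_t f (cons_pair (x, t)).
Proof.
move=> bf; have bc := bmeas_cons bf.
rewrite -(@ex_prod _ _ _ _ _ _ _ _ bc) /Rintegral; congr fine.
rewrite -(@integral_distribution _ _ _ _ _ (P \x iid_law n)%E (@cons_pair n) (EFin \o f)) //.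
  by case: bf => mf _; exact/measurable_EFinP.
exact: (@bmeas_integrable _ _ _ (P \x iid_law n)%E).
Qed.

End IidLaw.

Section SectionsOfBounded.
Context {d1 d2 : measure_display} {T1 : measurableType d1} {T2 : measurableType d2}
  {R : realType}.

Lemma bmeas_pair1 (f : T1 * T2 -> R) x : bmeas f -> bmeas (fun y => f (x, y)).
Proof. by move=> bf; apply: (bmeas_comp bf); exact: pair1_measurable. Qed.

Lemma bmeas_pair2 (f : T1 * T2 -> R) y : bmeas f -> bmeas (fun x => f (x, y)).
Proof. by move=> bf; apply: (bmeas_comp bf); exact: pair2_measurable. Qed.

Lemma bmeas_fst (f : T1 -> R) : bmeas f -> bmeas (fun z : T1 * T2 => f z.1).
Proof. by move=> bf; apply: (bmeas_comp bf); exact: measurable_fst. Qed.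

Lemma bmeas_snd (f : T2 -> R) : bmeas f -> bmeas (fun z : T1 * T2 => f z.2).
Proof. by move=> bf; apply: (bmeas_comp bf); exact: measurable_snd. Qed.

End SectionsOfBounded.

Section BoundedTuple.
Context {d : measure_display} {T : measurableType d} {R : realType}.

Lemma bmeas_tnth n (f : T -> R) (i : 'I_n) :
  bmeas f -> bmeas (fun t : n.-tuple T => f (tnth t i)).
Proof. by move=> bf; apply: (bmeas_comp bf); exact: measurable_tnth. Qed.

Lemma lin_tuple n (l : T -> R) es (t : n.-tuple T) :
  lin l es t = \sum_(i < n) nth 0 es i * l (tnth t i).
Proof.
elim: n es t => [|n ih] es t; first by rewrite tuple0 big_ord0; case: es.
rewrite big_ord_recl [t in LHS]tuple_eta; case: es => [|e es] /=.
  by rewrite mul0r add0r big1// => i _; rewrite mul0r.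
congr (_ * _ + _); rewrite -[behead t]/(tval [tuple of behead t]) ih.
by apply: eq_bigr => i _ /=; rewrite [t in RHS]tuple_eta tnthS.
Qed.

Lemma bmeas_lin {d'} {S : measurableType d'} n (g : S * T -> R) es : bmeas g ->
  bmeas (fun z : S * n.-tuple T => lin (fun y => g (z.1, y)) es z.2).
Proof.
move=> bg; under eq_fun do rewrite lin_tuple.
apply: bmeas_sum => i; apply: bmeasM; first exact: bmeas_cst.
apply: (bmeas_comp (h := g) (phi := fun z : S * n.-tuple T => (z.1, tnth z.2 i)) bg).
apply: measurable_fun_pair => //.
by apply: measurableT_comp (measurable_tnth i) _.
Qed.

Lemma bmeas_lin1 n (l : T -> R) es : bmeas l -> bmeas (fun t : n.-tuple T => lin l es t).
Proof.
move=> bl; under eq_fun do rewrite lin_tuple.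
by apply: bmeas_sum => i; apply: bmeasM; [exact: bmeas_cst|exact: bmeas_tnth].
Qed.

Lemma bmeas_quad n (g : T -> T -> R) es : bmeas (fun z : T * T => g z.1 z.2) ->
  bmeas (fun t : n.-tuple T => quad g es t).
Proof.
move=> bg; elim: n es => [|n ih] es.
  rewrite (_ : (fun _ => _) = fun=> 0); first exact: bmeas_cst.
  by apply/funext => t; rewrite tuple0; case: es.
case: es => [|e es]; first exact: bmeas_cst.
pose F (z : T * n.-tuple T) := 2 * e * lin (fun y => g z.1 y) es z.2 + quad g es z.2.
have bF : bmeas F.
  apply: bmeasD; first by apply: bmeasM; [exact: bmeas_cst|exact: (bmeas_lin _ _ bg)].
  exact: (bmeas_snd (T1 := T) (ih es)).
rewrite (_ : (fun _ => _) = fun t : n.+1.-tuple T => F (thead t, [tuple of behead t])).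
  apply: (bmeas_comp (phi := fun t : n.+1.-tuple T => (thead t, [tuple of behead t])) bF).
  by apply: measurable_fun_pair; [exact: measurable_tnth|exact: measurable_behead].
by apply/funext => t; rewrite [t in LHS]tuple_eta.
Qed.

End BoundedTuple.

Section Symmetrization.
Context {R : realType}.

Lemma ex_sign_avg {d} {T : measurableType d} (P : probability T R) n
    (F : seq R -> T -> R) : (forall es, bmeas (F es)) ->
  \int[P]_x sign_avg n (fun es => F es x) = sign_avg n (fun es => \int[P]_x F es x).
Proof.
elim: n F => [|n ih] F bF //=.
rewrite ih; last first.
  by move=> es; apply: bmeasM; [exact: bmeas_cst|exact: bmeasD].
congr sign_avg; apply/funext => es.
by rewrite exZ ?exD//; exact: bmeasD.
Qed.

Lemma bmeas_sign_avg {d} {T : measurableType d} n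
    (F : seq R -> T -> R) : (forall es, bmeas (F es)) ->
  bmeas (fun x => sign_avg n (fun es => F es x)).
Proof.
elim: n F => [|n ih] F bF //=.
by apply: ih => es; apply: bmeasM; [exact: bmeas_cst|exact: bmeasD].
Qed.

(** [symmetrize_pow] is integrated in [x] with [t] fixed; its linear term vanishes because [Y] is
    centered in [x]. *)
Lemma symmetrize_coord {d1 d2} {T1 : measurableType d1} {T2 : measurableType d2}
    (P1 : probability T1 R) (P2 : probability T2 R) (A : T2 -> R) (Y : T1 * T2 -> R) m :
  bmeas A -> bmeas Y -> (forall t, \int[P1]_x Y (x, t) = 0) ->
  \int[P1]_x \int[P2]_t ((A t + Y (x, t)) ^+ 2) ^+ m.+1 <=
  2^-1 * (\int[P1]_x \int[P2]_t ((A t + 2 * Y (x, t)) ^+ 2) ^+ m.+1 +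
          \int[P1]_x \int[P2]_t ((A t - 2 * Y (x, t)) ^+ 2) ^+ m.+1).
Proof.
move=> bA bY Y0.
have bA2 : bmeas (fun z : T1 * T2 => A z.2) by exact: bmeas_snd.
have b1 c : bmeas (fun z => ((A z.2 + c * Y z) ^+ 2) ^+ m.+1).
  by do 2!apply: bmeasX; apply: bmeasD => //; apply: bmeasM => //; exact: bmeas_cst.
have e1 c : \int[P1]_x \int[P2]_t ((A t + c * Y (x, t)) ^+ 2) ^+ m.+1 =
   \int[P2]_t \int[P1]_x ((A t + c * Y (x, t)) ^+ 2) ^+ m.+1.
  exact: (ex_swap _ _ (b1 c)).
have -> : \int[P1]_x \int[P2]_t ((A t + Y (x, t)) ^+ 2) ^+ m.+1 =
   \int[P1]_x \int[P2]_t ((A t + 1 * Y (x, t)) ^+ 2) ^+ m.+1.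
  by apply: eq_Rintegral => x _; apply: eq_Rintegral => t _; rewrite mul1r.
have -> : \int[P1]_x \int[P2]_t ((A t - 2 * Y (x, t)) ^+ 2) ^+ m.+1 =
   \int[P1]_x \int[P2]_t ((A t + (- 2) * Y (x, t)) ^+ 2) ^+ m.+1.
  by apply: eq_Rintegral => x _; apply: eq_Rintegral => t _; rewrite mulNr.
rewrite !e1 -exD; [|exact: (bmeas_ex1 P1 P2 (b1 _))..].
rewrite -exZ; last by apply: bmeasD; exact: (bmeas_ex1 P1 P2 (b1 _)).
apply: ex_le; first exact: (bmeas_ex1 P1 P2 (b1 _)).
  by apply: bmeasM; [exact: bmeas_cst|apply: bmeasD; exact: (bmeas_ex1 P1 P2 (b1 _))].
move=> t.
have bt c := bmeas_pair2 t (b1 c); have bYt := bmeas_pair2 t bY.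
rewrite /= in bt.
set u := fun c x => ((A t + c * Y (x, t)) ^+ 2) ^+ m.+1 in bt *.
set k := 2 * m.+1%:R * (A t ^+ 2) ^+ m * A t.
have bs : bmeas (fun x => 2^-1 * (u 2 x + u (- 2) x)).
  by apply: bmeasM; [exact: bmeas_cst|apply: bmeasD; exact: bt].
have bk : bmeas (fun x => k * Y (x, t)) by apply: bmeasM; [exact: bmeas_cst|exact: bYt].
apply: (@le_trans _ _ (\int[P1]_x (2^-1 * (u 2 x + u (- 2) x) + k * Y (x, t)))).
  apply: ex_le; [exact: bt|exact: bmeasD|].
  by move=> x; rewrite /u mul1r mulNr; exact: symmetrize_pow.
rewrite exD// (@exZ _ _ _ _ (fun x => Y (x, t)))// Y0 mulr0 addr0 exZ; last by apply: bmeasD; exact: bt.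
by rewrite exD//; exact: bt.
Qed.

Context {d : measure_display} {T : measurableType d}.
Variables (P : probability T R).

(** Conditioning on the head moves [l x] into the constant and [2 * g x] into the linear part, so
    the induction runs over all [c] and [l]. The signs come out doubled because of the [2 * y] in
    [symmetrize_pow]. *)
Lemma symmetrize_iid n m c (l : T -> R) (g : T -> T -> R) :
  bmeas l -> bmeas (fun z : T * T => g z.1 z.2) ->
  \int[P]_x l x = 0 -> (forall x, \int[P]_y g x y = 0) -> (forall y, \int[P]_x g x y = 0) ->
  \int[iid_law P n]_t ((c + lin l (nseq n 1) t + quad g (nseq n 1) t) ^+ 2) ^+ m.+1 <=
  sign_avg n (fun es => \int[iid_law P n]_t
    ((c + lin l [seq 2 * e | e <- es] t + quad g [seq 2 * e | e <- es] t) ^+ 2) ^+ m.+1).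
Proof.
move=> + bg + gx0 gy0; elim: n c l => [|n ih] c l bl l0 //.
have bF N c' l' es : bmeas l' -> bmeas (fun t : N.-tuple T =>
    ((c' + lin l' es t + quad g es t) ^+ 2) ^+ m.+1).
  move=> bl'; do 2!apply: bmeasX; apply: bmeasD; last exact: bmeas_quad.
  by apply: bmeasD; [exact: bmeas_cst|exact: bmeas_lin1].
have bS : bmeas (fun z : T * T => l z.2 + 2 * g z.1 z.2).
  by apply: bmeasD; [exact: bmeas_snd|apply: bmeasM => //; exact: bmeas_cst].
have bL es : bmeas (fun z : T * n.-tuple T =>
   ((c + l z.1 + lin (fun y => l y + 2 * g z.1 y) es z.2 + quad g es z.2) ^+ 2) ^+ m.+1).
  do 2!apply: bmeasX; apply: bmeasD; last exact: (bmeas_snd (T1 := T) (bmeas_quad n es bg)).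
  apply: bmeasD; last exact: (bmeas_lin _ _ bS).
  by apply: bmeasD; [exact: bmeas_cst|exact: bmeas_fst].
rewrite ex_iidS; last exact: bF.
(* The tail is symmetrized first, with the head [x] fixed; its linear part [l y + 2 * g x y] is
   again centered in [y]. *)
apply: (@le_trans _ _ (\int[P]_x sign_avg n (fun es => \int[iid_law P n]_t
   ((c + l x + lin (fun y => l y + 2 * g x y) [seq 2 * e | e <- es] t +
     quad g [seq 2 * e | e <- es] t) ^+ 2) ^+ m.+1))).
  apply: ex_le.
  - exact: (bmeas_ex2 P (iid_law P n) (bmeas_cons (bF _ _ _ _ bl))).
  - by apply: bmeas_sign_avg => es; exact: (bmeas_ex2 P (iid_law P n) (bL _)).
  move=> x; apply: le_trans (ih (c + l x) (fun y => l y + 2 * g x y) _ _).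
  - rewrite le_eqVlt; apply/orP; left; apply/eqP; apply: eq_Rintegral => t _ /=.
    by congr (_ ^+ _ ^+ _); rewrite linD linZ; ring.
  - exact: (bmeas_pair1 x bS).
  rewrite exD//; last first.
    by apply: bmeasM; [exact: bmeas_cst|exact: (bmeas_pair1 x bg)].
  by rewrite exZ ?gx0 ?l0 ?mulr0 ?addr0//; exact: (bmeas_pair1 x bg).
rewrite ex_sign_avg; last by move=> es; exact: (bmeas_ex2 P (iid_law P n) (bL _)).
rewrite sign_avgS; apply: sign_avg_le => es; set es2 := [seq 2 * e | e <- es].
(* With the signs of the tail fixed, the head enters only through [Y], which is linear in [l z.1]
   and [g z.1] and hence centered in the head. *)
pose A (t : n.-tuple T) := c + lin l es2 t + quad g es2 t.
pose Y (z : T * n.-tuple T) := l z.1 + 2 * lin (g z.1) es2 z.2.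
have bA : bmeas A.
  by apply: bmeasD; [apply: bmeasD; [exact: bmeas_cst|exact: bmeas_lin1]|exact: bmeas_quad].
have bY : bmeas Y.
  apply: bmeasD; first exact: bmeas_fst.
  by apply: bmeasM; [exact: bmeas_cst|exact: (bmeas_lin _ _ bg)].
have Y0 t : \int[P]_x Y (x, t) = 0.
  rewrite /Y /= exD//; last first.
    apply: bmeasM; first exact: bmeas_cst.
    exact: (bmeas_pair2 t (bmeas_lin n es2 bg)).
  rewrite l0 add0r exZ; last exact: (bmeas_pair2 t (bmeas_lin n es2 bg)).
  under eq_Rintegral do rewrite lin_tuple.
  rewrite ex_sum; last first.
    by move=> i; apply: bmeasM; [exact: bmeas_cst|exact: (bmeas_pair2 _ bg)].
  rewrite big1 ?mulr0// => i _.
  by rewrite exZ ?gy0 ?mulr0//; exact: (bmeas_pair2 _ bg).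
have H := symmetrize_coord (iid_law P n) m bA bY Y0.
apply: le_trans (le_trans H _); rewrite le_eqVlt; apply/orP; left; apply/eqP.
  apply: eq_Rintegral => x _; apply: eq_Rintegral => t _.
  by congr (_ ^+ _ ^+ _); rewrite /A /Y /= linD linZ; ring.
congr (_ * (_ + _)).
  rewrite ex_iidS; last exact: bF.
  apply: eq_Rintegral => x _; apply: eq_Rintegral => t _.
  by congr (_ ^+ _ ^+ _); rewrite /A /Y /= -/es2; ring.
rewrite ex_iidS; last exact: bF.
apply: eq_Rintegral => x _; apply: eq_Rintegral => t _.
by congr (_ ^+ _ ^+ _); rewrite /A /Y /= -/es2; ring.
Qed.

End Symmetrization.

(** * Moments of nonnegative sums and pair sums *)

Section Resampling.
Context {d : measure_display} {T : measurableType d} {R : realType}.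
Variable P : probability T R.

Definition upd n (i : 'I_n) (x : T) (t : n.-tuple T) : n.-tuple T :=
  [tuple if j == i then x else tnth t j | j < n].

Lemma measurable_upd n (i : 'I_n) :
  measurable_fun [set: T * n.-tuple T] (fun z => upd i z.1 z.2).
Proof.
apply/measurable_fun_tnthP => j /=.
rewrite (_ : _ \o _ = fun z => if j == i then z.1 else tnth z.2 j); last first.
  by apply/funext => z /=; rewrite tnth_mktuple.
case: eqP => _ /=; first exact: measurable_fst.
by apply: measurableT_comp (measurable_tnth j) _.
Qed.

Lemma upd0 n x x0 (t : n.-tuple T) : upd ord0 x (cons_pair (x0, t)) = cons_pair (x, t).
Proof.
apply/eq_from_tnth => j; rewrite tnth_mktuple.
have [->//|j0] := eqVneq j ord0.
by case: (unliftP ord0 j) j0 => [k ->|->]; rewrite ?eqxx// => _; rewrite /cons_pair !tnthS.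
Qed.

Lemma updS n (i : 'I_n) x x0 (t : n.-tuple T) :
  upd (lift ord0 i) x (cons_pair (x0, t)) = cons_pair (x0, upd i x t).
Proof.
apply/eq_from_tnth => j; rewrite tnth_mktuple.
case: (unliftP ord0 j) => [k ->|->].
  rewrite (inj_eq lift_inj) /cons_pair !tnthS tnth_mktuple.
  by [].
by rewrite eq_liftF.
Qed.

Lemma bmeas_upd n (i : 'I_n) (f : n.-tuple T -> R) :
  bmeas f -> bmeas (fun z : T * n.-tuple T => f (upd i z.1 z.2)).
Proof. by move=> bf; apply: (bmeas_comp bf); exact: measurable_upd. Qed.

(** Makes it possible to integrate over one point of the sample with the others held fixed: the
    fresh draw is exchanged by Fubini with the coordinates before it. *)
Lemma ex_resample n (i : 'I_n) (f : n.-tuple T -> R) : bmeas f ->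
  \int[iid_law P n]_t f t = \int[P]_x \int[iid_law P n]_t f (upd i x t).
Proof.
elim: n i f => [[]//|n ih] i f bf; rewrite ex_iidS//.
have bfi x : bmeas (fun t => f (upd i x t)) by exact: (bmeas_pair1 x (bmeas_upd i bf)).
under [RHS]eq_Rintegral do rewrite ex_iidS//.
case: (unliftP ord0 i) => [j ij|i0].
  have e x x0 (t : n.-tuple T) : upd i x (cons_pair (x0, t)) = cons_pair (x0, upd j x t).
    by rewrite ij updS.
  under eq_Rintegral => x0 _.
    rewrite (ih j); last exact: (bmeas_pair1 x0 (bmeas_cons bf)).
    over.
  under [RHS]eq_Rintegral => x _ do under eq_Rintegral => x0 _ do under eq_Rintegral do rewrite e.
  apply: (@ex_swap _ _ _ _ _ P P (fun z => \int[iid_law P n]_t f (cons_pair (z.1, upd j z.2 t)))).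
  apply: (@bmeas_ex2 _ _ _ _ _ (P \x P)%E (iid_law P n)
    (fun z => f (cons_pair (z.1.1, upd j z.1.2 z.2)))).
  apply: (bmeas_comp (phi := fun z : (T * T) * n.-tuple T => (z.1.1, upd j z.1.2 z.2)) (bmeas_cons bf)).
  apply: measurable_fun_pair; first exact: measurableT_comp measurable_fst measurable_fst.
  apply: (@measurableT_comp _ _ _ _ _ _ (fun z => upd j z.1 z.2) _
    (fun z : (T * T) * n.-tuple T => (z.1.2, z.2)) (@measurable_upd n j)).
  apply: measurable_fun_pair => //.
  exact: measurableT_comp measurable_snd measurable_fst.
apply: eq_Rintegral => x _.
rewrite -[LHS](ex_cst P); apply: eq_Rintegral => x0 _.
by apply: eq_Rintegral => t _; rewrite i0 upd0.
Qed.

End Resampling.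

Section PairSum.
Context {T : Type} {R : realType}.
Implicit Types (w : T -> T -> R) (xs ys : seq T).

(** Ordered pairs of distinct positions, not of distinct values: a point repeated in the list is
    paired with its copies. *)
Definition pairsum w xs : R :=
  \sum_(u <- xs) \sum_(v <- xs) w u v - \sum_(u <- xs) w u u.

Lemma pairsum_nil w : pairsum w [::] = 0.
Proof. by rewrite /pairsum !big_nil subrr. Qed.

Lemma pairsum_cons w x xs : (forall u v, w u v = w v u) ->
  pairsum w (x :: xs) = 2 * \sum_(y <- xs) w x y + pairsum w xs.
Proof.
move=> ws; rewrite /pairsum !big_cons.
under [X in _ + _ + X - _]eq_bigr do rewrite big_cons.
rewrite big_split /=.
have -> : \sum_(i <- xs) w i x = \sum_(y <- xs) w x y by apply: eq_bigr => y _.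
by ring.
Qed.

Lemma pairsum_cat w xs ys : (forall u v, w u v = w v u) ->
  pairsum w (xs ++ ys) =
  pairsum w xs + 2 * \sum_(x <- xs) \sum_(y <- ys) w x y + pairsum w ys.
Proof.
move=> ws; elim: xs => [|x xs ih] /=.
  by rewrite pairsum_nil big_nil mulr0 !add0r.
by rewrite !pairsum_cons// ih big_cat big_cons /=; ring.
Qed.

Lemma pairsum_ge0 w xs : (forall u v, w u v = w v u) -> (forall u v, 0 <= w u v) ->
  0 <= pairsum w xs.
Proof.
move=> ws w0; elim: xs => [|x xs ih]; first by rewrite pairsum_nil.
by rewrite pairsum_cons// addr_ge0// mulr_ge0// sumr_ge0.
Qed.

Lemma sum_seq_le (f : T -> R) c xs : (forall u, f u <= c) ->
  \sum_(u <- xs) f u <= (size xs)%:R * c.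
Proof.
move=> fc; elim: xs => [|x xs ih]; first by rewrite big_nil mul0r.
by rewrite big_cons /= -natr1 mulrDl mul1r addrC lerD.
Qed.

Lemma pairsum_le w D xs : (forall u v, 0 <= w u v <= D) ->
  pairsum w xs <= (size xs)%:R ^+ 2 * D.
Proof.
move=> wD; rewrite lerBlDr.
apply: (@le_trans _ _ ((size xs)%:R ^+ 2 * D)); last first.
  by rewrite lerDl sumr_ge0// => u _; case/andP: (wD u u).
rewrite expr2 -mulrA; apply: sum_seq_le => u; apply: sum_seq_le => v.
by case/andP: (wD u v).
Qed.

End PairSum.

Section PositiveMoments.
Context {d : measure_display} {T : measurableType d} {R : realType}.
Variables (P : probability T R) (n : nat).
Local Notation Q := (iid_law P n).

Lemma size_uniq_ord (J : seq 'I_n) : uniq J -> (size J <= n)%N.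
Proof. by move=> uJ; rewrite -[leqRHS]card_ord -(card_uniqP uJ) max_card. Qed.

(* One factor of the power is expanded and the point it selects is resampled; in
   the other factors that point is bounded by [b], whence the offset [k b]. *)
Lemma sum_positive_moment (z : T -> R) (a b : R) m k (J : seq 'I_n) :
  bmeas z -> (forall x, 0 <= z x <= b) -> \int[P]_x z x <= a -> uniq J ->
  \int[Q]_t (\sum_(j <- J) z (tnth t j) + k%:R * b) ^+ m <=
  (n%:R * a + (k + m)%:R * b) ^+ m.
Proof.
move=> bz zb za; elim: m k J => [|m ih] k J uJ.
  by under eq_Rintegral do rewrite expr0; rewrite ex_cst expr0.
have b0 : 0 <= b by have /andP[z0 z1] := zb point; exact: le_trans z0 z1.
have iz0 : 0 <= \int[P]_x z x by apply: Rintegral_ge0 => x _; case/andP: (zb x).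
have a0 : 0 <= a := le_trans iz0 za.
set B := n%:R * a + (k + m.+1)%:R * b.
have B0 : 0 <= B by rewrite addr_ge0// mulr_ge0.
pose Z (K : seq 'I_n) (t : n.-tuple T) := \sum_(j <- K) z (tnth t j).
have bZ K c : bmeas (fun t => (Z K t + c%:R * b) ^+ m).
  by apply: bmeasX; apply: bmeasD; [apply: bmeas_sum => j; exact: bmeas_tnth|exact: bmeas_cst].
have Z0 K t : 0 <= Z K t by apply: sumr_ge0 => j _; case/andP: (zb (tnth t j)).
rewrite [X in X <= _](_ : _ = \int[Q]_t (\sum_(j <- J) z (tnth t j) * (Z J t + k%:R * b) ^+ m
    + k%:R * b * (Z J t + k%:R * b) ^+ m)); last first.
  by apply: eq_Rintegral => t _; rewrite exprS mulrDl mulr_suml.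
have bzZ j : bmeas (fun t => z (tnth t j) * (Z J t + k%:R * b) ^+ m).
  by apply: bmeasM => //; exact: bmeas_tnth.
rewrite exD; last 2 first.
- exact: bmeas_sum.
- by apply: bmeasM => //; exact: bmeas_cst.
rewrite ex_sum// exZ//.
have key j : j \in J -> \int[Q]_t (z (tnth t j) * (Z J t + k%:R * b) ^+ m) <= a * B ^+ m.
  move=> jJ.
  have bu := bmeas_upd j (bzZ j).
  rewrite (ex_resample P j)//.
  apply: (@le_trans _ _ (\int[P]_x (B ^+ m * z x))); last first.
    by rewrite exZ// mulrC ler_wpM2r// exprn_ge0.
  apply: ex_le; [exact: (@bmeas_ex2 _ _ _ _ _ P Q _ bu)|by apply: bmeasM => //; exact: bmeas_cst|].
  move=> x.
  apply: (@le_trans _ _ (\int[Q]_t (z x * (Z (rem j J) t + k.+1%:R * b) ^+ m))).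
    apply: ex_le; [exact: (bmeas_pair1 x bu)|by apply: bmeasM => //; exact: bmeas_cst|].
    move=> t; rewrite tnth_mktuple eqxx; have /andP[zx0 zxb] := zb x.
    rewrite ler_wpM2l//; apply: lerXn2r.
    - by rewrite nnegrE addr_ge0// mulr_ge0.
    - by rewrite nnegrE addr_ge0// mulr_ge0.
    rewrite -natr1 mulrDl mul1r addrA -addrA [k%:R * b + b]addrC addrA lerD2r.
    rewrite /Z (perm_big _ (perm_to_rem jJ)) big_cons /= tnth_mktuple eqxx addrC lerD//.
    rewrite le_eqVlt; apply/orP; left; apply/eqP; apply: eq_big_seq => i.
    rewrite mem_rem_uniq// inE => /andP[ij _].
    by rewrite tnth_mktuple (negbTE ij).
  have /andP[zx0 zxb] := zb x.
  rewrite exZ// mulrC ler_wpM2r//.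
  by apply: (le_trans (ih _ _ (rem_uniq j uJ))); rewrite /B addSnnS.
(* The first two summands match the expanded sum and the offset; the third is nonnegative and is
   dropped. *)
have -> : B ^+ m.+1 = n%:R * a * B ^+ m + k%:R * b * B ^+ m + m.+1%:R * b * B ^+ m.
  by rewrite exprS {1}/B natrD; ring.
rewrite -[leLHS]addr0; apply: lerD; last by rewrite mulr_ge0 ?exprn_ge0// mulr_ge0.
apply: lerD.
  apply: (@le_trans _ _ (\sum_(j <- J) a * B ^+ m)).
    by rewrite big_seq [leRHS]big_seq; exact: ler_sum.
  rewrite -mulrA; apply: le_trans (sum_seq_le _ (fun=> lexx _)) _.
  by rewrite ler_wpM2r ?mulr_ge0 ?exprn_ge0// ler_nat size_uniq_ord.
rewrite ler_wpM2l//; first by rewrite mulr_ge0.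
apply: (le_trans (ih k J uJ)); apply: lerXn2r; rewrite ?nnegrE//.
  by rewrite addr_ge0// mulr_ge0.
by rewrite lerD2l ler_wpM2r// ler_nat addnS.
Qed.

Section Pairs.
Variables (w : T -> T -> R) (a c D : R).
Hypothesis bw : bmeas (fun z : T * T => w z.1 z.2).
Hypothesis ws : forall u v, w u v = w v u.
Hypothesis wD : forall u v, 0 <= w u v <= D.
Hypothesis wa : \int[P]_x \int[P]_y w x y <= a.
Hypothesis wc : forall x, \int[P]_y w x y <= c.

(** [y] holds the points already frozen, [J] the indices of the points still random. *)
Let H y (J : seq 'I_n) (t : n.-tuple T) := pairsum w (y ++ map (tnth t) J).
(** The bound on the mean of the pair sum when [r] points are frozen: pairs of random points, mixed
    pairs, and pairs of frozen points. *)
Let kappa (r : nat) : R := n%:R ^+ 2 * a + 2 * r%:R * n%:R * c + r%:R ^+ 2 * D.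

Let w0 u v : 0 <= w u v. Proof. by case/andP: (wD u v). Qed.

Let H0 y J t : 0 <= H y J t. Proof. exact: pairsum_ge0. Qed.

Let bmeas_w1 u : bmeas (w u). Proof. exact: (bmeas_pair1 u bw). Qed.

Let bmeas_w2 (i j : 'I_n) : bmeas (fun t : n.-tuple T => w (tnth t i) (tnth t j)).
Proof.
apply: (bmeas_comp (phi := fun t : n.-tuple T => (tnth t i, tnth t j)) bw).
by apply: measurable_fun_pair; exact: measurable_tnth.
Qed.

Let HE y J t : H y J t = pairsum w y + 2 * \sum_(u <- y) \sum_(j <- J) w u (tnth t j)
  + (\sum_(i <- J) \sum_(j <- J) w (tnth t i) (tnth t j) - \sum_(i <- J) w (tnth t i) (tnth t i)).
Proof.
rewrite /H pairsum_cat//; congr (_ + 2 * _ + _).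
  by apply: eq_bigr => u _; rewrite big_map.
rewrite /pairsum !big_map; congr (_ - _); apply: eq_bigr => i _; by rewrite big_map.
Qed.

Let bmeas_H y J : bmeas (H y J).
Proof.
rewrite (funext (HE y J)).
apply: bmeasD.
  apply: bmeasD; first exact: bmeas_cst.
  apply: bmeasM; first exact: bmeas_cst.
  by apply: bmeas_sum => u; apply: bmeas_sum => j; apply: bmeas_tnth.
apply: bmeasB; last exact: bmeas_sum.
by apply: bmeas_sum => i; exact: bmeas_sum.
Qed.

Let H_move y J j x t : uniq J -> j \in J ->
  H y J (upd j x t) = H (x :: y) (rem j J) t.
Proof.
move=> uJ jJ; rewrite /H.
rewrite [RHS](_ : _ = pairsum w (x :: (y ++ map (tnth t) (rem j J))))// pairsum_cons//.
have -> : map (tnth t) (rem j J) = map (tnth (upd j x t)) (rem j J).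
  apply/eq_in_map => i; rewrite mem_rem_uniq// inE => /andP[ij _].
  by rewrite tnth_mktuple (negbTE ij).
set s := upd j x t.
have -> : pairsum w (y ++ map (tnth s) J) = pairsum w (y ++ map (tnth s) (j :: rem j J)).
  by rewrite -!/(H _ _ _) !HE; congr (_ + 2 * _ + (_ - _));
    [apply: eq_bigr => u _|rewrite (perm_big _ (perm_to_rem jJ)); apply: eq_bigr => u _|];
    rewrite (perm_big _ (perm_to_rem jJ)).
rewrite pairsum_cat// /= pairsum_cons//.
have -> : tnth s j = x by rewrite tnth_mktuple eqxx.
rewrite pairsum_cat// big_cat /= mulrDr.
under [X in _ + 2 * X + _]eq_bigr do rewrite big_cons.
rewrite big_split /=.
have -> : \sum_(i <- y) w i x = \sum_(i <- y) w x i by apply: eq_bigr => i _.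
ring.
Qed.

Let c0 : 0 <= c.
Proof. by apply: le_trans (wc point); apply: Rintegral_ge0 => y _. Qed.

Let a0 : 0 <= a.
Proof.
by apply: le_trans wa; apply: Rintegral_ge0 => x _; apply: Rintegral_ge0 => y _.
Qed.

Let D0 : 0 <= D. Proof. exact: le_trans (w0 point point) (proj2 (andP (wD point point))). Qed.

Let kappa_ge0 r : 0 <= kappa r.
Proof.
by rewrite !addr_ge0// mulr_ge0 ?exprn_ge0// mulr_ge0// mulr_ge0.
Qed.

Let kappa_mono r s : (r <= s)%N -> kappa r <= kappa s.
Proof.
move=> rs; have rs' : r%:R <= s%:R :> R by rewrite ler_nat.
apply: lerD; last by rewrite ler_wpM2r// lerXn2r ?nnegrE.
by rewrite lerD2l ler_wpM2r// ler_wpM2r// ler_wpM2l.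
Qed.

(** The resampled point becomes one more frozen point of [H], and the bound [B] is uniform in frozen
    points; only the weight [w x z] remains to be integrated. *)
Let one_extraction y J j x m B : uniq J -> j \in J ->
  (forall x', \int[Q]_t H (x' :: y) (rem j J) t ^+ m <= B) ->
  \int[Q]_t (w x (tnth t j) * H y J t ^+ m) <= B * \int[P]_z w x z.
Proof.
move=> uJ jJ HB.
have bf : bmeas (fun t : n.-tuple T => w x (tnth t j) * H y J t ^+ m).
  by apply: bmeasM; [exact: bmeas_tnth|exact: bmeasX].
have bu := bmeas_upd j bf.
rewrite (ex_resample P j)// -exZ//.
apply: ex_le; [exact: (@bmeas_ex2 _ _ _ _ _ P Q _ bu)|by apply: bmeasM => //; exact: bmeas_cst|].
move=> z; under eq_Rintegral do rewrite tnth_mktuple eqxx H_move//.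
by rewrite exZ; [rewrite mulrC ler_wpM2r|exact: bmeasX].
Qed.

Let two_extraction y J i j m B : uniq J -> i \in J -> j \in rem i J ->
  (forall x x', \int[Q]_t H (x' :: x :: y) (rem j (rem i J)) t ^+ m <= B) ->
  \int[Q]_t (w (tnth t i) (tnth t j) * H y J t ^+ m) <= B * a.
Proof.
move=> uJ iJ jJ HB.
have B0 : 0 <= B.
  apply: le_trans (HB point point); apply: Rintegral_ge0 => t _.
  exact: exprn_ge0.
have ij : j != i by move: jJ; rewrite mem_rem_uniq// inE => /andP[].
have bf : bmeas (fun t : n.-tuple T => w (tnth t i) (tnth t j) * H y J t ^+ m).
  by apply: bmeasM; [exact: bmeas_w2|exact: bmeasX].
have bu := bmeas_upd i bf.
rewrite (ex_resample P i)//.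
apply: (@le_trans _ _ (\int[P]_x (B * \int[P]_z w x z))); last first.
  by rewrite exZ ?ler_wpM2l//; exact: (@bmeas_ex2 _ _ _ _ _ P P _ bw).
apply: ex_le; [exact: (@bmeas_ex2 _ _ _ _ _ P Q _ bu)| |].
  by apply: bmeasM; [exact: bmeas_cst|exact: (@bmeas_ex2 _ _ _ _ _ P P _ bw)].
move=> x; under eq_Rintegral do rewrite tnth_mktuple eqxx tnth_mktuple (negbTE ij) H_move//.
exact: one_extraction (rem_uniq i uJ) jJ (HB x).
Qed.

(* Same scheme: the points selected by the expanded factor are frozen, and [y]
   collects the frozen points. *)
Lemma pairsum_positive_moment m y J : uniq J ->
  \int[Q]_t H y J t ^+ m <= kappa (size y + 2 * m) ^+ m.
Proof.
elim: m y J => [|m ih] y J uJ.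
  by under eq_Rintegral do rewrite expr0; rewrite ex_cst expr0.
set q := size y; set r := (q + 2 * m.+1)%N; set B := kappa r ^+ m.
have B0 : 0 <= B by exact: exprn_ge0.
(* Expanding one factor freezes at most two further points, which the argument of [kappa] allows
   for: [(q + 2) + 2 * m = q + 2 * m.+1]. *)
have ihB y' J' : uniq J' -> (size y' <= q + 2)%N -> \int[Q]_t H y' J' t ^+ m <= B.
  move=> uJ' sy'; apply: (le_trans (ih _ _ uJ')).
  by apply: lerXn2r; rewrite ?nnegrE// kappa_mono// /r; lia.
have bHm : bmeas (fun t => H y J t ^+ m) by exact: bmeasX.
have bw1 u j : bmeas (fun t : n.-tuple T => w u (tnth t j) * H y J t ^+ m).
  by apply: bmeasM => //; exact: bmeas_tnth.
have bw2 i j : bmeas (fun t : n.-tuple T => w (tnth t i) (tnth t j) * H y J t ^+ m).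
  by apply: bmeasM => //; exact: bmeas_w2.
(* The pairs of the expanded factor are sorted by their number of frozen points: two, one, none. The
   three groups yield the three terms of [kappa q]. *)
pose S t := pairsum w y * H y J t ^+ m
  + 2 * (\sum_(u <- y) \sum_(j <- J) w u (tnth t j) * H y J t ^+ m)
  + \sum_(i <- J) \sum_(j <- rem i J) w (tnth t i) (tnth t j) * H y J t ^+ m.
have -> : \int[Q]_t H y J t ^+ m.+1 = \int[Q]_t S t.
  apply: eq_Rintegral => t _; rewrite exprS {1}HE /S mulrDl mulrDl -mulrA mulr_suml.
  congr (_ + 2 * _ + _); first by apply: eq_bigr => u _; rewrite mulr_suml.
  rewrite -sumrB mulr_suml [LHS]big_seq [RHS]big_seq; apply: eq_bigr => i iJ.
  rewrite (perm_big _ (perm_to_rem iJ)) big_cons addrAC subrr add0r.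
  by rewrite mulr_suml.
have bs1 : bmeas (fun t => \sum_(u <- y) \sum_(j <- J) w u (tnth t j) * H y J t ^+ m).
  by do 2!apply: bmeas_sum => ?.
have bs2 : bmeas (fun t => \sum_(i <- J) \sum_(j <- rem i J) w (tnth t i) (tnth t j) * H y J t ^+ m).
  by do 2!apply: bmeas_sum => ?.
rewrite /S exD//; last first.
  by apply: bmeasD; apply: bmeasM => //; exact: bmeas_cst.
rewrite exD; [|by apply: bmeasM => //; exact: bmeas_cst..].
rewrite !exZ// ex_sum; last by move=> u; exact: bmeas_sum.
rewrite ex_sum; last by move=> u; exact: bmeas_sum.
rewrite exprS -/B.
apply: (@le_trans _ _ (kappa q * B)); last first.
  by rewrite ler_wpM2r// kappa_mono// /r leq_addr.
rewrite /kappa.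
rewrite [leRHS](_ : _ = (q%:R ^+ 2 * D) * B + 2 * (q%:R * (n%:R * (B * c))) +
  n%:R * (n%:R * (B * a))); last by ring.
have sJ := size_uniq_ord uJ.
apply: lerD; [apply: lerD|].
- apply: ler_pM; [exact: pairsum_ge0| |exact: pairsum_le|by apply: ihB => //; exact: leq_addr].
  by apply: Rintegral_ge0 => t _; exact: exprn_ge0.
- rewrite ler_wpM2l//; apply: sum_seq_le => u.
  rewrite ex_sum//; apply: (@le_trans _ _ (\sum_(j <- J) B * c)).
    rewrite big_seq [leRHS]big_seq; apply: ler_sum => j jJ.
    apply: (@le_trans _ _ (B * \int[P]_z w u z)); last by rewrite ler_wpM2l.
    apply: one_extraction => // x'; apply: ihB; first exact: rem_uniq.
    by rewrite /=; lia.
  apply: le_trans (sum_seq_le _ (fun=> lexx _)) _.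
  by rewrite ler_wpM2r ?mulr_ge0// ler_nat.
apply: (@le_trans _ _ (\sum_(i <- J) n%:R * (B * a))); last first.
  apply: le_trans (sum_seq_le _ (fun=> lexx _)) _.
  by rewrite ler_wpM2r ?mulr_ge0// ler_nat.
rewrite big_seq [leRHS]big_seq; apply: ler_sum => i iJ.
rewrite ex_sum//; apply: (@le_trans _ _ (\sum_(j <- rem i J) B * a)).
  rewrite big_seq [leRHS]big_seq; apply: ler_sum => j jJ.
  apply: two_extraction => // x x'; apply: ihB; last by rewrite /=; lia.
  by do 2!apply: rem_uniq.
apply: le_trans (sum_seq_le _ (fun=> lexx _)) _.
rewrite ler_wpM2r ?mulr_ge0// ler_nat.
exact: size_uniq_ord (rem_uniq i uJ).
Qed.

End Pairs.
End PositiveMoments.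

(** * Tails of sums and degenerate U-statistics *)

Section Markov.
Context {d : measure_display} {T : measurableType d} {R : realType}.
Variable P : probability T R.

Lemma measurable_bmeas_gt (f : T -> R) c : bmeas f -> measurable [set x | c < f x].
Proof.
move=> [mf _]; rewrite (_ : [set x | _] = [set: T] `&` f @^-1` `]c, +oo[%classic); last first.
  by rewrite setTI; apply/seteqP; split=> x; rewrite /= in_itv /= andbT.
exact: mf.
Qed.

(** Markov's inequality at [e] times the moment bound leaves the ratio [e ^- m]; a moment of order
    at least [x] therefore gives the tail [expR (- x)]. *)
Lemma moment_tail (f : T -> R) (B : R) m : bmeas f -> (forall x, 0 <= f x) ->
  0 < B -> \int[P]_x f x ^+ m <= B ^+ m ->
  (P [set x | (expR 1 * B < f x)%R] <= (expR (- m%:R))%:E)%E.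
Proof.
move=> bf f0 B0 fB; set A := [set x | _].
have mA : measurable A by exact: measurable_bmeas_gt.
have bA : bmeas (\1_A : T -> R).
  split=> //; exists 1 => x; rewrite indicE; case: (x \in A); by rewrite ?normr1 ?normr0.
have eB : 0 < expR 1 * B by rewrite mulr_gt0// expR_gt0.
have -> : P A = (\int[P]_x (\1_A x : R))%:E.
  by rewrite ex_EFin// integral_indic// setIT.
rewrite lee_fin; apply: (@le_trans _ _ (\int[P]_x ((expR 1 * B) ^- m * f x ^+ m))).
  apply: ex_le => //; first by apply: bmeasM; [exact: bmeas_cst|exact: bmeasX].
  move=> x; rewrite indicE; case: (boolP (x \in A)) => [|_] /=; last first.
    by rewrite mulr_ge0 ?exprn_ge0 ?invr_ge0 ?exprn_ge0// ltW.
  rewrite inE => xA; rewrite ler_pdivlMl ?exprn_gt0// mulr1.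
  by apply: lerXn2r; rewrite ?nnegrE// ltW.
rewrite exZ; last exact: bmeasX.
rewrite ler_pdivrMl ?exprn_gt0// exprMn -expRM_natl mulr1 mulrAC -expRD.
by rewrite addrN expR0 mul1r.
Qed.

End Markov.

Section Tails.
Context {d : measure_display} {T : measurableType d} {R : realType}.
Variables (P : probability T R) (n : nat).
Local Notation Q := (iid_law P n).

Lemma energyE (g : T -> T -> R) xs : (forall u v, g u v = g v u) ->
  energy g xs = 2 * pairsum (fun u v => g u v ^+ 2) xs.
Proof.
move=> gs; elim: xs => [|x xs ih]; first by rewrite pairsum_nil mulr0.
rewrite pairsum_cons; last by move=> u v; rewrite gs.
by rewrite /= ih; ring.
Qed.

Lemma energy_scale (g : T -> T -> R) c xs :
  energy (fun u v => c * g u v) xs = c ^+ 2 * energy g xs.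
Proof.
elim: xs => [|x xs ih] /=; first by rewrite mulr0.
rewrite ih; under eq_bigr do rewrite exprMn.
by rewrite -mulr_sumr; ring.
Qed.

Lemma lin_ones (l : T -> R) xs : lin l (nseq (size xs) 1) xs = \sum_(x <- xs) l x.
Proof.
by elim: xs => [|x xs ih]; rewrite ?big_nil// big_cons /= mul1r ih.
Qed.

Lemma quad_ones (g : T -> T -> R) xs : (forall u v, g u v = g v u) ->
  quad g (nseq (size xs) 1) xs = pairsum g xs.
Proof.
move=> gs; elim: xs => [|x xs ih]; first by rewrite pairsum_nil.
by rewrite pairsum_cons//= ih lin_ones mulr1.
Qed.

Lemma bmeas_tuple_sum (f : T -> R) : bmeas f -> bmeas (fun t : n.-tuple T => \sum_(x <- t) f x).
Proof.
move=> bf; under eq_fun do rewrite big_tuple.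
by apply: bmeas_sum => i; exact: bmeas_tnth.
Qed.

Lemma bmeas_pairsum (g : T -> T -> R) : bmeas (fun z : T * T => g z.1 z.2) ->
  bmeas (fun t : n.-tuple T => pairsum g t).
Proof.
move=> bg; rewrite (_ : (fun _ => _) = fun t : n.-tuple T =>
   \sum_(i < n) \sum_(j < n) g (tnth t i) (tnth t j) - \sum_(i < n) g (tnth t i) (tnth t i)).
  have b2 (i j : 'I_n) : bmeas (fun t : n.-tuple T => g (tnth t i) (tnth t j)).
    apply: (bmeas_comp (phi := fun t : n.-tuple T => (tnth t i, tnth t j)) bg).
    by apply: measurable_fun_pair; exact: measurable_tnth.
  by apply: bmeasB; [do 2!apply: bmeas_sum => ?|apply: bmeas_sum => ?].
apply/funext => t; rewrite /pairsum !big_tuple; congr (_ - _).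
by apply: eq_bigr => i _; rewrite big_tuple.
Qed.

(** Doubled signs amount to using [2 * l] and [4 * g] in [quad_moment], and [energy] is twice a pair
    sum. Hence the constants [4 * 2 ^+ 2 = 16] and [4 ^+ 2 * 4 ^+ 2 * 2 = 16 * 32]. *)
Lemma iid_chaos_moment m (l : T -> R) (g : T -> T -> R) :
  bmeas l -> bmeas (fun z : T * T => g z.1 z.2) -> (forall u v, g u v = g v u) ->
  \int[P]_x l x = 0 -> (forall x, \int[P]_y g x y = 0) ->
  \int[Q]_t ((\sum_(x <- t) l x + pairsum g t) ^+ 2) ^+ m.+1 <=
  \int[Q]_t (16 * m.+1%:R * \sum_(x <- t) l x ^+ 2 +
    16 * 32 * m.+1%:R ^+ 2 * pairsum (fun u v => g u v ^+ 2) t) ^+ m.+1.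
Proof.
move=> bl bg gs l0 gx0.
have gy0 y : \int[P]_x g x y = 0.
  by rewrite -[RHS](gx0 y); apply: eq_Rintegral => x _.
have -> : \int[Q]_t ((\sum_(x <- t) l x + pairsum g t) ^+ 2) ^+ m.+1 =
    \int[Q]_t ((0 + lin l (nseq n 1) t + quad g (nseq n 1) t) ^+ 2) ^+ m.+1.
  apply: eq_Rintegral => t _; rewrite add0r.
  by rewrite -[in nseq n 1](size_tuple t) lin_ones quad_ones.
apply: (le_trans (symmetrize_iid n m 0 bl bg l0 gx0 gy0)).
have bF es : bmeas (fun t : n.-tuple T => ((0 + lin l [seq 2 * e | e <- es] t
    + quad g [seq 2 * e | e <- es] t) ^+ 2) ^+ m.+1).
  do 2!apply: bmeasX; apply: bmeasD; last exact: bmeas_quad.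
  by apply: bmeasD; [exact: bmeas_cst|exact: bmeas_lin1].
rewrite -ex_sign_avg//.
have bg2 : bmeas (fun z : T * T => g z.1 z.2 ^+ 2) by exact: bmeasX.
apply: ex_le; first exact: bmeas_sign_avg.
  apply: bmeasX; apply: bmeasD; apply: bmeasM; try exact: bmeas_cst.
    by apply: bmeas_tuple_sum; exact: bmeasX.
  exact: bmeas_pairsum.
move=> t; have := quad_moment 0 (fun x => 2 * l x) (fun u v => 4 * g u v) t m.+1.
rewrite size_tuple => H.
apply: le_trans (le_trans H _); rewrite le_eqVlt; apply/orP; left; apply/eqP.
  congr sign_avg; apply/funext => es; congr (_ ^+ _ ^+ _).
  rewrite linZ lin_scale; congr (_ + _).
  rewrite quad_scale; elim: es (tval t) => [|e es ih] [|x xs] //=; rewrite ?mulr0//.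
  by rewrite mulrDr ih linZ; ring.
congr (_ ^+ _); rewrite energy_scale energyE//.
under eq_bigr do rewrite exprMn.
by rewrite -mulr_sumr; ring.
Qed.

(** The moment order is an integer: at least [x] for the probability, at most [2 * x] for the size
    of the bound. *)
Lemma nat_above (x : R) : 1 <= x -> exists m, x <= m.+1%:R <= 2 * x.
Proof.
move=> x1; have x0 : 0 <= x by lra.
exists (Num.truncn x).
have /andP[h1 h2] := truncn_itv x0.
by rewrite (ltW h2) /= -natr1; lra.
Qed.

(** Centering at most doubles the bound [b], so its square becomes [4 * b ^+ 2]; with moment order
    [M <= 2 * x], [16 * M * (n * v + 4 * M * b ^+ 2)] is at most
    [256 * x * (n * v + x * b ^+ 2)]. *)
Lemma sum_tail (f : T -> R) (b v x : R) : bmeas f -> 0 < b ->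
  (forall y, `|f y| <= b) -> \int[P]_y f y ^+ 2 <= v -> 1 <= x ->
  (Q [set t | (expR 1 * (256 * x * (n%:R * v + x * b ^+ 2)) <
       (\sum_(y <- t) (f y - \int[P]_z f z)) ^+ 2)%R] <= (expR (- x))%:E)%E.
Proof.
move=> bf b0 fb fv x1.
have [m /andP[xm mx]] := nat_above x1.
set M := m.+1%:R in xm mx.
pose l y := f y - \int[P]_z f z.
have bl : bmeas l by apply: bmeasB => //; exact: bmeas_cst.
have l0 : \int[P]_y l y = 0 by rewrite exB ?ex_cst ?subrr//; exact: bmeas_cst.
have v0 : 0 <= v.
  by apply: le_trans fv; apply: Rintegral_ge0 => y _; exact: sqr_ge0.
have lv : \int[P]_y l y ^+ 2 <= v.
  apply: le_trans fv.
  have -> : \int[P]_y l y ^+ 2 = \int[P]_y (f y ^+ 2 + ((- 2 * \int[P]_z f z) * f y + (\int[P]_z f z) ^+ 2)).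
    by apply: eq_Rintegral => y _; rewrite /l; ring.
  rewrite exD; [|exact: bmeasX|]; last first.
    by apply: bmeasD; [apply: bmeasM => //; exact: bmeas_cst|exact: bmeas_cst].
  rewrite exD ?ex_cst; [|by apply: bmeasM => //; exact: bmeas_cst|exact: bmeas_cst].
  rewrite exZ// gerDl.
  have := sqr_ge0 (\int[P]_z f z); nra.
have lb y : 0 <= l y ^+ 2 <= 4 * b ^+ 2.
  rewrite sqr_ge0 /= -[leLHS]real_normK ?num_real//.
  have -> : 4 * b ^+ 2 = (2 * b) ^+ 2 by ring.
  apply: lerXn2r; rewrite ?nnegrE ?mulr_ge0// ?(ltW b0)//.
  apply: le_trans (ler_normB _ _) _; have := fb y; have := ex_norm P bf fb; lra.
set B := 16 * M * (n%:R * v + M * (4 * b ^+ 2)).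
have M0 : 0 < M by rewrite /M.
have B0 : 0 < B.
  rewrite mulr_gt0 ?mulr_gt0// ltr_wpDl ?mulr_ge0// mulr_gt0// mulr_gt0// exprn_gt0//.
pose S (t : n.-tuple T) := (\sum_(y <- t) l y) ^+ 2.
have bS : bmeas S by apply: bmeasX; exact: bmeas_tuple_sum.
have H : \int[Q]_t S t ^+ m.+1 <= B ^+ m.+1.
  have ps0 (xs : seq T) : pairsum (fun _ _ : T => 0 : R) xs = 0.
    by rewrite /pairsum big1 ?sub0r ?big1 ?oppr0// => i _; rewrite big1.
  have ps1 (xs : seq T) : pairsum (fun _ _ : T => 0 ^+ 2 : R) xs = 0.
    by rewrite -[RHS](ps0 xs) /pairsum expr0n.
  have HH := @iid_chaos_moment m l (fun _ _ => 0) bl (bmeas_cst _) (fun _ _ => erefl) l0 (fun=> ex_cst _ _).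
  rewrite [leLHS](_ : _ = \int[Q]_t ((\sum_(y <- t) l y + pairsum (fun _ _ : T => 0) t) ^+ 2) ^+ m.+1); last first.
    by apply: eq_Rintegral => t _; rewrite ps0 addr0.
  apply: (le_trans HH).
  rewrite [leLHS](_ : _ = \int[Q]_t ((16 * M) ^+ m.+1 * (\sum_(y <- t) l y ^+ 2) ^+ m.+1)); last first.
    by apply: eq_Rintegral => t _; rewrite ps1 mulr0 addr0 exprMn.
  have bl2 : bmeas (fun y => l y ^+ 2) by exact: bmeasX.
  rewrite exZ; last by apply: bmeasX; exact: bmeas_tuple_sum.
  rewrite /B [leRHS]exprMn ler_wpM2l ?exprn_ge0 ?mulr_ge0//.
  have := @sum_positive_moment _ _ _ P n (fun y => l y ^+ 2) v (4 * b ^+ 2) m.+1 0 (enum 'I_n)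
     bl2 lb lv (enum_uniq _).
  rewrite add0n; apply: le_trans; rewrite le_eqVlt; apply/orP; left; apply/eqP.
  apply: eq_Rintegral => t _; rewrite mul0r addr0; congr (_ ^+ _).
  by rewrite -[in LHS](map_tnth_enum t) big_map.
have tl := moment_tail bS (fun t => sqr_ge0 _) B0 H.
have xM : ((expR (- M))%:E <= (expR (- x))%:E)%E by rewrite lee_fin ler_expR lerN2.
apply: le_trans xM; apply: le_trans tl; apply: le_measure.
- by rewrite inE; exact: (measurable_bmeas_gt _ bS).
- by rewrite inE; exact: (measurable_bmeas_gt _ bS).
move=> t /=; apply: le_lt_trans; rewrite ler_pM2l ?expR_gt0// /B.
have nv : 0 <= n%:R * v by rewrite mulr_ge0.
have b2 : 0 <= b ^+ 2 by exact: sqr_ge0.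
apply: (@le_trans _ _ (32 * x * (n%:R * v + 8 * (x * b ^+ 2)))).
  apply: ler_pM; [by rewrite mulr_ge0// ltW| |lra|].
    by rewrite addr_ge0// mulr_ge0 ?(ltW M0)// mulr_ge0.
  by rewrite lerD2l (mulrA M) (mulrA 8) ler_wpM2r//; lra.
rewrite [leRHS](_ : _ = 32 * x * (8 * (n%:R * v) + 8 * (x * b ^+ 2))); last by ring.
by rewrite ler_wpM2l ?lerD2r; lra.
Qed.

(** With moment order [M <= 2 * x], the factor [16 * 32 * M ^+ 2] is at most [64 * 32 * x ^+ 2], and
    the bound with [2 * M] frozen points is at most 16 times the last factor; [64 * 32 * 16] is the
    cube of 32. *)
Lemma pairsum_tail (g : T -> T -> R) (a c D x : R) :
  bmeas (fun z : T * T => g z.1 z.2) -> (forall u v, g u v = g v u) ->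
  (forall u, \int[P]_v g u v = 0) -> 0 < D ->
  (forall u v, `|g u v| <= D) -> (forall u, \int[P]_v g u v ^+ 2 <= c) ->
  \int[P]_u \int[P]_v g u v ^+ 2 <= a -> 1 <= x ->
  (Q [set t | (expR 1 * (32 * 32 * 32 * x ^+ 2 * (n%:R ^+ 2 * a + x * (n%:R * c) + x ^+ 2 * D ^+ 2)) <
       (pairsum g t) ^+ 2)%R] <= (expR (- x))%:E)%E.
Proof.
move=> bg gs g0 D0 gD gc ga x1.
have [m /andP[xm mx]] := nat_above x1.
set M := m.+1%:R in xm mx.
have M0 : 0 < M by rewrite /M.
have bg2 : bmeas (fun z : T * T => g z.1 z.2 ^+ 2) by exact: bmeasX.
have c0 : 0 <= c.
  by apply: le_trans (gc point); apply: Rintegral_ge0 => y _; exact: sqr_ge0.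
have a0 : 0 <= a.
  apply: le_trans ga; apply: Rintegral_ge0 => y _; apply: Rintegral_ge0 => z _.
  exact: sqr_ge0.
set K := n%:R ^+ 2 * a + 2 * (2 * M) * n%:R * c + (2 * M) ^+ 2 * D ^+ 2.
have K0 : 0 < K.
  rewrite ltr_wpDl//; last by rewrite mulr_gt0// exprn_gt0// mulr_gt0.
  by rewrite addr_ge0// mulr_ge0 ?exprn_ge0// mulr_ge0// mulr_ge0// mulr_ge0// ltW.
set B := 16 * 32 * M ^+ 2 * K.
have B0 : 0 < B.
  by apply: mulr_gt0 => //; apply: mulr_gt0; [apply: mulr_gt0|exact: exprn_gt0].
pose S (t : n.-tuple T) := pairsum g t ^+ 2.
have bS : bmeas S by apply: bmeasX; exact: bmeas_pairsum.
have H : \int[Q]_t S t ^+ m.+1 <= B ^+ m.+1.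
  have HH := @iid_chaos_moment m (fun=> 0) g (bmeas_cst _) bg gs (ex_cst _ _) g0.
  rewrite [leLHS](_ : _ = \int[Q]_t ((\sum_(y <- t) 0 + pairsum g t) ^+ 2) ^+ m.+1); last first.
    by apply: eq_Rintegral => t _; rewrite big1// add0r.
  apply: (le_trans HH).
  rewrite [leLHS](_ : _ = \int[Q]_t ((16 * 32 * M ^+ 2) ^+ m.+1 *
      pairsum (fun u v => g u v ^+ 2) t ^+ m.+1)); last first.
    by apply: eq_Rintegral => t _; rewrite expr0n big1// mulr0 add0r exprMn.
  rewrite exZ; last by apply: bmeasX; exact: bmeas_pairsum.
  rewrite /B [leRHS]exprMn; apply: ler_wpM2l.
    by apply: exprn_ge0; apply: mulr_ge0; [apply: mulr_ge0|exact: exprn_ge0].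
  have gD2 u v : 0 <= g u v ^+ 2 <= D ^+ 2.
    rewrite sqr_ge0 /= -[leLHS]real_normK ?num_real//.
    by apply: lerXn2r; rewrite ?nnegrE// ltW.
  have := @pairsum_positive_moment _ _ _ P n (fun u v => g u v ^+ 2) a c (D ^+ 2)
     bg2 (fun u v => congr1 (fun z => z ^+ 2) (gs u v)) gD2 ga gc m.+1 [::] (enum 'I_n) (enum_uniq _).
  rewrite /= add0n natrM -/M -/K; apply: le_trans.
  rewrite le_eqVlt; apply/orP; left; apply/eqP.
  by apply: eq_Rintegral => t _; rewrite map_tnth_enum.
have tl := moment_tail bS (fun t => sqr_ge0 _) B0 H.
have xM : ((expR (- M))%:E <= (expR (- x))%:E)%E by rewrite lee_fin ler_expR lerN2.
apply: le_trans xM; apply: le_trans tl; apply: le_measure.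
- by rewrite inE; exact: (measurable_bmeas_gt _ bS).
- by rewrite inE; exact: (measurable_bmeas_gt _ bS).
move=> t /=; apply: le_lt_trans; rewrite ler_pM2l ?expR_gt0// /B.
have nc : 0 <= n%:R * c by rewrite mulr_ge0.
have na : 0 <= n%:R ^+ 2 * a by rewrite mulr_ge0// exprn_ge0.
have b2 : 0 <= D ^+ 2 by exact: sqr_ge0.
have M2 : M ^+ 2 <= 4 * x ^+ 2.
  have -> : 4 * x ^+ 2 = (2 * x) ^+ 2 by ring.
  by apply: lerXn2r; rewrite ?nnegrE; lra.
have x2 : 0 <= x ^+ 2 by exact: sqr_ge0.
have ab : 0 <= n%:R ^+ 2 * a by [].
apply: (@le_trans _ _ (64 * 32 * x ^+ 2 * (16 * (n%:R ^+ 2 * a + x * (n%:R * c) + x ^+ 2 * D ^+ 2)))); last first.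
  by rewrite le_eqVlt; apply/orP; left; apply/eqP; ring.
apply: ler_pM; [|exact: ltW| |].
- by apply: mulr_ge0; [apply: mulr_ge0|rewrite exprn_ge0// ltW].
- lra.
rewrite /K !mulrDr; apply: lerD; [apply: lerD|].
- lra.
- rewrite [leLHS](_ : _ = 4 * M * (n%:R * c)); last by ring.
  rewrite [leRHS](_ : _ = 16 * x * (n%:R * c)); last by ring.
  by rewrite ler_wpM2r//; lra.
rewrite [leRHS](_ : _ = 16 * x ^+ 2 * D ^+ 2); last by ring.
by rewrite ler_wpM2r// exprMn; lra.
Qed.

End Tails.

(** * The law of the sample *)

Section Density.
Context {d : measure_display} {T : measurableType d} {R : realType}.
Variables (mu nu : {measure set T -> \bar R}) (s : T -> R).
Hypotheses (ms : measurable_fun [set: T] s) (s0 : forall x, 0 <= s x).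
Hypothesis nuE : forall B, measurable B -> nu B = (\int[mu]_(x in B) (s x)%:E)%E.
Import HBNNSimple.

Lemma integral_density_nnsfun (h : {nnsfun T >-> R}) :
  (\int[nu]_x (h x)%:E = \int[mu]_x (h x * s x)%:E)%E.
Proof.
rewrite integralT_nnsfun sintegralE.
have mh y : measurable (h @^-1` [set y]) by exact: measurable_sfunP.
transitivity (\int[mu]_x (\sum_(y \in range h) y%:E * (\1_(h @^-1` [set y]) x * s x)%:E))%E; last first.
  apply: eq_integral => x _; rewrite [in RHS](fimfunE h x) EFinM -fsumEFin//.
  rewrite ge0_mule_fsuml; last first.
    by move=> y; rewrite lee_fin; exact: nnfun_muleindic_ge0.
  by apply: eq_fsbigr => y _; rewrite EFinM EFinM -muleA.
have m1 y : measurable_fun [set: T] (fun x => (\1_(h @^-1` [set y]) x * s x)%:E).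
  by apply/measurable_EFinP; apply: measurable_funM.
rewrite ge0_integral_fsum//; last 2 first.
- by move=> y; apply: measurable_funeM.
- move=> y x _; rewrite EFinM muleA; apply: mule_ge0; rewrite ?lee_fin//.
  exact: nnfun_muleindic_ge0.
apply: eq_fsbigr => y /[!inE] -[x _ <-].
rewrite ge0_integralZl//; last 2 first.
- by move=> z _; rewrite lee_fin mulr_ge0.
- by rewrite lee_fin.
rewrite nuE//; congr (_ * _)%E.
rewrite integral_mkcond; apply: eq_integral => z _.
by rewrite epatch_indic /= EFinM muleC.
Qed.

Lemma ge0_integral_density (f : T -> \bar R) : measurable_fun [set: T] f ->
  (forall x, 0 <= f x)%E -> (\int[nu]_x f x = \int[mu]_x (f x * (s x)%:E))%E.
Proof.
move=> mf f0.
pose h := nnsfun_approx measurableT mf.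
have hf x : EFin \o h^~ x @ \oo --> f x by exact: cvg_nnsfun_approx.
have hnd x : {homo (fun n => (h n x)%:E) : a b / (a <= b)%N >-> (a <= b)%E}.
  by move=> a b ab; rewrite lee_fin; exact/lefP/nd_nnsfun_approx.
transitivity (limn (fun n => \int[nu]_x (h n x)%:E))%E.
  rewrite -monotone_convergence//.
  - by apply: eq_integral => x _; apply/esym/cvg_lim => //; exact: hf.
  - by move=> n; exact/measurable_EFinP.
  - by move=> n x _; rewrite lee_fin.
rewrite (_ : (fun n => _) = fun n => (\int[mu]_x ((h n x)%:E * (s x)%:E))%E); last first.
  by apply/funext => n; rewrite integral_density_nnsfun.
rewrite -monotone_convergence//.
- apply: eq_integral => x _; apply/cvg_lim => //.
  by apply: cvgeZr => //; exact: hf.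
- by move=> n; apply: emeasurable_funM; exact/measurable_EFinP.
- by move=> n x _; rewrite mule_ge0// lee_fin.
- by move=> x _ a b ab; rewrite lee_wpmul2r ?lee_fin//; exact: hnd.
Qed.

(** Both integrals are by definition differences of those of the positive and negative parts, and
    multiplication by the nonnegative [s] commutes with taking these parts. *)
Lemma integral_density (f : T -> R) : measurable_fun [set: T] f ->
  (\int[nu]_x (f x)%:E = \int[mu]_x (f x * s x)%:E)%E.
Proof.
move=> mf; rewrite [LHS]integralE [RHS]integralE.
have mfe : measurable_fun [set: T] (EFin \o f) by exact/measurable_EFinP.
congr (_ - _)%E.
  rewrite ge0_integral_density; [|exact: measurable_funepos|by move=> x; exact: funepos_ge0].
  apply: eq_integral => x _; rewrite !funeposE /= maxe_pMl ?lee_fin// mul0e.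
  by [].
rewrite ge0_integral_density; [|exact: measurable_funeneg|by move=> x; exact: funeneg_ge0].
apply: eq_integral => x _; rewrite !funenegE /= maxe_pMl ?lee_fin// mul0e -EFinM.
by rewrite mulNr.
Qed.

End Density.

Section TupleBoxes.
Context {d : measure_display} {T : measurableType d} {R : realType}.

Definition box n (B : 'I_n -> set T) : set (n.-tuple T) :=
  [set t | forall i, B i (tnth t i)].

Lemma measurable_box n (B : 'I_n -> set T) :
  (forall i, measurable (B i)) -> measurable (box B).
Proof.
move=> mB; rewrite (_ : box B = \bigcap_(i in [set: 'I_n]) ((fun t => tnth t i) @^-1` B i)).
  apply: fin_bigcap_measurable => // i _; rewrite -[X in measurable X]setTI.
  exact: measurable_tnth.
by apply/seteqP; split=> [t Bt i _|t Bt i]; [exact: Bt|exact: Bt i Logic.I].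
Qed.

Lemma iid_law_box (P : probability T R) n (B : 'I_n -> set T) :
  (forall i, measurable (B i)) -> (iid_law P n (box B) = \prod_(i < n) P (B i))%E.
Proof.
elim: n B => [|n ih] B mB.
  rewrite big_ord0 (_ : box B = [set: _]); first exact: probability_setT.
  by apply/seteqP; split=> // t _ [].
have mB' i : measurable (B (lift ord0 i)) by [].
rewrite big_ord_recl -ih//.
have := @product_measure1E _ _ _ _ R P (iid_law P n) (B ord0) (box (fun i => B (lift ord0 i)))
  (mB ord0) (measurable_box mB').
move=> <-; rewrite /= /distribution /pushforward; congr (_ _).
apply/seteqP; split=> [[x t] /= Bt|[x t] /= [Bx Bt] i].
  by split=> [|i]; [exact: (Bt ord0)|have := Bt (lift ord0 i); rewrite tnthS].
case: (unliftP ord0 i) => [j ->|->]; last exact: Bx.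
by rewrite tnthS; exact: Bt.
Qed.

(** Boxes are stable under intersection and include the one-coordinate cylinders that generate the
    product sigma-algebra, so the uniqueness theorem for finite measures applies. *)
Lemma tuple_law_unique n (m1 m2 : {measure set (n.-tuple T) -> \bar R}) :
  (m1 [set: _] < +oo)%E ->
  (forall B : 'I_n -> set T, (forall i, measurable (B i)) -> m1 (box B) = m2 (box B)) ->
  forall A, measurable A -> m1 A = m2 A.
Proof.
move=> m1T m12 A mA.
pose G : set (set (n.-tuple T)) := [set C | exists2 B : 'I_n -> set T,
  (forall i, measurable (B i)) & C = box B].
have GT : G setT.
  by exists (fun=> setT) => //; apply/seteqP; split.
apply: (measure_unique G (fun=> setT)) => //.
- apply/seteqP; split; last first.
    apply: smallest_sub; first exact: sigma_algebra_measurable.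
    by move=> _ [B mB ->]; exact: measurable_box.
  apply: smallest_sub; first exact: smallest_sigma_algebra.
  move=> C; rewrite -bigcup_seq => -[i _ [B mB <-]].
  apply: sub_sigma_algebra; exists (fun j => if j == i then B else setT).
    by move=> j; case: ifP.
  rewrite setTI; apply/seteqP; split=> [t Bt j|t /(_ i)]; last by rewrite eqxx.
  by case: eqP => [->|].
- move=> _ _ [B mB ->] [C mC ->]; exists (fun i => B i `&` C i).
    by move=> i; exact: measurableI.
  by apply/seteqP; split=> [t [Bt Ct] i|t BC]; [split|split=> i; have [] := BC i].
- by apply/seteqP; split=> // t _; exists 0%N.
- by move=> _ [B mB ->]; exact: m12.
Qed.

End TupleBoxes.

Section SampleLaw.
Context {d d0 : measure_display} {T : measurableType d} {Omega : measurableType d0}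
  {R : realType}.
Variables (mu : {measure set T -> \bar R}) (Pr : probability Omega R) (s : T -> R) (n : nat).
Variables (X Y : {RV Pr >-> T}) (Xs : 'I_n -> {RV Pr >-> T}).
Hypothesis iid : iid_with_density mu s X Y Xs.
Local Notation P := (distribution Pr X).

Definition sample (w : Omega) : n.-tuple T := [tuple Xs i w | i < n].

Lemma measurable_sample : measurable_fun [set: Omega] sample.
Proof.
apply/measurable_fun_tnthP => i.
rewrite (_ : _ \o _ = Xs i); first exact: measurable_funP.
by apply/funext => w /=; rewrite tnth_mktuple.
Qed.

HB.instance Definition _ := isMeasurableFun.Build _ _ _ _ sample measurable_sample.

Lemma law_density B : measurable B -> P B = (\int[mu]_(x in B) (s x)%:E)%E.
Proof. by move=> mB; have := variables_law iid (inl true) mB. Qed.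

Lemma variable_law i B : measurable B -> Pr (all_variables X Y Xs i @^-1` B) = P B.
Proof. by move=> mB; rewrite (variables_law iid)// law_density. Qed.

Lemma sample_law A : measurable A -> Pr (sample @^-1` A) = iid_law P n A.
Proof.
move: A; apply: (@tuple_law_unique _ _ _ _ (distribution Pr sample) (iid_law P n)).
  by rewrite -ge0_fin_numE// fin_num_measure.
move=> B mB; apply: etrans (esym (iid_law_box P mB)).
rewrite /distribution /pushforward.
(* [X] and [Y] are left unconstrained, which reduces the product rule to the observations. *)
pose B' (i : bool + 'I_n) := if i is inr j then B j else setT.
have mB' i : measurable (B' i) by case: i => //= j; exact: mB.
have := variables_independent iid mB'.
rewrite big_sumType /= big1 ?mul1e; last first.
  by move=> b _; rewrite preimage_setT; exact: probability_setT.
rewrite (_ : \bigcap_(i in _) _ = sample @^-1` box B); last first.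
  apply/seteqP; split=> [w Bw i|w Bw [b|j] _ //=].
    by rewrite tnth_mktuple; exact: (Bw (inr i) Logic.I).
  by have := Bw j; rewrite tnth_mktuple.
move=> H; apply: etrans H _; apply: eq_bigr => j _.
exact: (variable_law (inr j) (mB j)).
Qed.

Definition sample_pair (w : Omega) : T * T := (X w, Y w).

Lemma measurable_sample_pair : measurable_fun [set: Omega] sample_pair.
Proof. by apply: measurable_fun_pair; exact: measurable_funP. Qed.

HB.instance Definition _ :=
  isMeasurableFun.Build _ _ _ _ sample_pair measurable_sample_pair.

Lemma pair_law A : measurable A -> Pr (sample_pair @^-1` A) = (P \x P)%E A.
Proof.
move=> mA.
apply: esym; apply: (@product_measure_unique _ _ _ _ _ P P (distribution Pr sample_pair)) => //.
move=> B C mB mC; rewrite /distribution /pushforward.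
pose B' (i : bool + 'I_n) := match i with inl true => B | inl false => C | inr _ => setT end.
have mB2 i : measurable (B' i) by case: i => [[]|j] /=; [exact: mB|exact: mC|exact: measurableT].
have := variables_independent iid mB2.
rewrite big_sumType /= big_bool /= [X in (_ * X)%E]big1 ?mule1; last first.
  by move=> j _; rewrite preimage_setT; exact: probability_setT.
rewrite (_ : \bigcap_(i in _) _ = sample_pair @^-1` (B `*` C)); last first.
  apply/seteqP; split=> [w Bw|w [Bw Cw] [[]|j] _ //=].
  by split; [exact: (Bw (inl true) Logic.I)|exact: (Bw (inl false) Logic.I)].
move=> H; apply: etrans H _; congr (_ * _)%E; exact: (variable_law (inl false) mC).
Qed.

End SampleLaw.

(** * Inner products of kernels *)

Section SquareIntegrable.
Context {d : measure_display} {T : measurableType d} {R : realType}.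
Variable mu : {measure set T -> \bar R}.
Implicit Types f g h : T -> R.

Lemma normL2_sqr f : (normL2 mu f ^+ 2 = \int[mu]_x (f x ^+ 2)%:E)%E.
Proof.
have sq (y : \bar R) : (0 <= y)%E -> (y ^+ 2 = y `^ 2)%E.
  case: y => [r|_|//].
  - by rewrite lee_fin => r0; rewrite poweR_EFin -EFin_expe powR_mulrn.
  - by rewrite poweRyr ?pnatr_eq0// expe2 mulyy.
rewrite sq ?Lnorm_ge0// poweR_Lnorm//.
apply: eq_integral => x _.
by rewrite abse_EFin poweR_EFin powR_mulrn// real_normK ?num_real.
Qed.

Definition sqint f := measurable_fun [set: T] f /\ (\int[mu]_x (f x ^+ 2)%:E < +oo)%E.

Definition ip f g : R := \int[mu]_x (f x * g x).

Lemma sqint_sqr f : sqint f -> mu.-integrable [set: T] (fun x => (f x ^+ 2)%:E).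
Proof.
move=> [mf foo]; apply/integrableP; split.
  by apply/measurable_EFinP; exact: measurable_funX.
under eq_integral do rewrite abse_EFin ger0_norm ?sqr_ge0//.
exact: foo.
Qed.

Lemma sqint_mul f g : sqint f -> sqint g ->
  mu.-integrable [set: T] (EFin \o (fun x => f x * g x)).
Proof.
move=> sf sg.
apply: (le_integrable measurableT _ _ (integrableD measurableT (sqint_sqr sf) (sqint_sqr sg))).
  by apply/measurable_EFinP; apply: measurable_funM; [case: sf|case: sg].
move=> x _ /=; rewrite lee_fin [leRHS]ger0_norm ?addr_ge0 ?sqr_ge0//.
rewrite ler_norml; have := sqr_ge0 (f x - g x); have := sqr_ge0 (f x + g x).
rewrite sqrrB sqrrD => h1 h2; apply/andP; split; nra.
Qed.

Lemma normL2_sqr_ip f : sqint f -> (normL2 mu f ^+ 2 = (ip f f)%:E)%E.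
Proof.
move=> sf; rewrite normL2_sqr /ip /Rintegral fineK.
  by apply: eq_integral => x _; rewrite expr2.
by apply: integrable_fin_num => //; exact: sqint_mul.
Qed.

Lemma sqint_normL2 f : measurable_fun [set: T] f -> (normL2 mu f ^+ 2 < +oo)%E -> sqint f.
Proof. by move=> mf; rewrite normL2_sqr. Qed.

Lemma sqintD f g : sqint f -> sqint g -> sqint (fun x => f x + g x).
Proof.
move=> sf sg; have [mf _] := sf; have [mg _] := sg.
split; first exact: measurable_funD.
have i2 c (h : T -> \bar R) : mu.-integrable setT h -> mu.-integrable setT (fun x => (c%:E * h x)%E).
  by move=> ih; apply: integrableZl.
have := integrableD measurableT (i2 2 _ (sqint_sqr sf)) (i2 2 _ (sqint_sqr sg)).
move=> /integrableP[_]; apply: le_lt_trans; apply: ge0_le_integral => //.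
- by move=> x _; rewrite lee_fin sqr_ge0.
- by apply/measurable_EFinP; apply: measurable_funX; exact: measurable_funD.
- apply: measurableT_comp => //; apply: emeasurable_funD.
    by apply: measurable_funeM; exact: measurable_int (sqint_sqr sf).
  by apply: measurable_funeM; exact: measurable_int (sqint_sqr sg).
move=> x _; rewrite -!EFinM -EFinD abse_EFin lee_fin.
apply: le_trans (ler_norm _).
have := sqr_ge0 (f x - g x); rewrite sqrrB sqrrD => h1; nra.
Qed.

Lemma sqintZ c f : sqint f -> sqint (fun x => c * f x).
Proof.
move=> sf; have [mf foo] := sf; split.
  by apply: measurable_funM.
under eq_integral do rewrite exprMn EFinM.
rewrite ge0_integralZl//.
- by rewrite lte_mul_pinfty ?lee_fin ?sqr_ge0.
- exact: measurable_int (sqint_sqr sf).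
- by move=> x _; rewrite lee_fin sqr_ge0.
- by rewrite lee_fin sqr_ge0.
Qed.

Lemma sqintN f : sqint f -> sqint (fun x => - f x).
Proof.
by move=> /(sqintZ (- 1)); under eq_fun do rewrite mulN1r.
Qed.

Lemma sqintB f g : sqint f -> sqint g -> sqint (fun x => f x - g x).
Proof. by move=> sf sg; apply: sqintD => //; exact: sqintN. Qed.

Lemma sqint0 : sqint (fun=> 0).
Proof. by split=> //; under eq_integral do rewrite expr0n/=; rewrite integral0. Qed.

Lemma sqint_sum (I : Type) (r : seq I) (F : I -> T -> R) :
  (forall i, sqint (F i)) -> sqint (fun x => \sum_(i <- r) F i x).
Proof.
move=> sF; elim: r => [|i r ih].
  by under eq_fun do rewrite big_nil; exact: sqint0.
by under eq_fun do rewrite big_cons; exact: sqintD.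
Qed.

Lemma ipC f g : ip f g = ip g f.
Proof. by apply: eq_Rintegral => x _; rewrite mulrC. Qed.

Lemma ipDl f g h : sqint f -> sqint g -> sqint h ->
  ip (fun x => f x + g x) h = ip f h + ip g h.
Proof.
move=> sf sg sh; rewrite /ip -RintegralD//; try exact: sqint_mul.
by apply: eq_Rintegral => x _; rewrite mulrDl.
Qed.

Lemma ipZl c f h : sqint f -> sqint h -> ip (fun x => c * f x) h = c * ip f h.
Proof.
move=> sf sh; rewrite /ip -RintegralZl//; try exact: sqint_mul.
by apply: eq_Rintegral => x _; rewrite mulrA.
Qed.

Lemma ipNl f h : sqint f -> sqint h -> ip (fun x => - f x) h = - ip f h.
Proof.
move=> sf sh; rewrite -[RHS]mulN1r -ipZl//.
by congr ip; apply/funext => x; rewrite mulN1r.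
Qed.

Lemma ipBl f g h : sqint f -> sqint g -> sqint h ->
  ip (fun x => f x - g x) h = ip f h - ip g h.
Proof. by move=> sf sg sh; rewrite ipDl ?ipNl//; exact: sqintN. Qed.

Lemma ipDr f g h : sqint f -> sqint g -> sqint h ->
  ip h (fun x => f x + g x) = ip h f + ip h g.
Proof. by move=> sf sg sh; rewrite ipC ipDl// !(ipC h). Qed.

Lemma ipZr c f h : sqint f -> sqint h -> ip h (fun x => c * f x) = c * ip h f.
Proof. by move=> sf sh; rewrite ipC ipZl// (ipC h). Qed.

Lemma ipBr f g h : sqint f -> sqint g -> sqint h ->
  ip h (fun x => f x - g x) = ip h f - ip h g.
Proof. by move=> sf sg sh; rewrite ipC ipBl// !(ipC h). Qed.

Lemma ip_suml (I : Type) (r : seq I) (F : I -> T -> R) h :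
  (forall i, sqint (F i)) -> sqint h ->
  ip (fun x => \sum_(i <- r) F i x) h = \sum_(i <- r) ip (F i) h.
Proof.
move=> sF sh; elim: r => [|i r ih].
  rewrite big_nil /ip -[RHS](Rintegral_set0 mu (fun=> 0)) /Rintegral integral_set0.
  by under eq_integral do rewrite big_nil mul0r; rewrite integral0.
rewrite big_cons -ih -ipDl//; last exact: sqint_sum.
by congr ip; apply/funext => x; rewrite big_cons.
Qed.

Lemma ip_ge0 f : 0 <= ip f f.
Proof. by apply: Rintegral_ge0 => x _; rewrite -expr2 sqr_ge0. Qed.

Lemma ip_sqrB f g : sqint f -> sqint g ->
  ip (fun x => f x - g x) (fun x => f x - g x) = ip f f - 2 * ip f g + ip g g.
Proof.
move=> sf sg; have sB := sqintB sf sg.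
by rewrite ipBl// !ipBr// (ipC g f); ring.
Qed.

Lemma ip_cauchy f g : sqint f -> sqint g -> ip f g ^+ 2 <= ip f f * ip g g.
Proof.
move=> sf sg.
have H c : 0 <= ip f f - 2 * c * ip f g + c ^+ 2 * ip g g.
  have sc := sqintZ c sg.
  have -> : ip f f - 2 * c * ip f g + c ^+ 2 * ip g g =
      ip (fun x => f x - c * g x) (fun x => f x - c * g x).
    by rewrite ip_sqrB// ipZr// ipZl// ipZr//; ring.
  exact: ip_ge0.
have g0 := ip_ge0 g.
move: g0; rewrite le_eqVlt => /predU1P[g0|g0].
  rewrite -g0 mulr0; rewrite -g0 in H.
  have [->|fg] := eqVneq (ip f g) 0; first by rewrite expr0n.
  (* When [g] has norm 0 the quadratic in [c] is affine, and at this [c] it would equal -1. *)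
  have := H ((ip f f + 1) / (2 * ip f g)).
  have -> : 2 * ((ip f f + 1) / (2 * ip f g)) * ip f g = ip f f + 1.
    by field.
  by rewrite mulr0; lra.
have := H (ip f g / ip g g).
have -> : ip f f - 2 * (ip f g / ip g g) * ip f g + (ip f g / ip g g) ^+ 2 * ip g g =
   (ip f f * ip g g - ip f g ^+ 2) / ip g g by field; rewrite gt_eqF.
by rewrite pmulr_lge0 ?invr_gt0// subr_ge0.
Qed.

Lemma ip_eq0 f g : sqint f -> sqint g -> ip f f = 0 -> ip f g = 0.
Proof.
move=> sf sg f0; have := ip_cauchy sf sg; rewrite f0 mul0r => h.
by apply/eqP; rewrite -sqrf_eq0 eq_le h sqr_ge0.
Qed.

End SquareIntegrable.

Section SquareDensity.
Context {d : measure_display} {T : measurableType d} {R : realType}.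
Variables (mu : {measure set T -> \bar R}) (h : T -> R).
Hypothesis sh : sqint mu h.

(** The proof of square integrability is an argument so that the finite-measure structure below can
    be attached to the term itself. *)
Definition sqr_measure (_ : sqint mu h) (B : set T) : \bar R :=
  (\int[mu]_(x in B) (h x ^+ 2)%:E)%E.

Local Notation nu := (sqr_measure sh).

Let mh2 : measurable_fun [set: T] (fun x => (h x ^+ 2)%:E).
Proof. by apply/measurable_EFinP; apply: measurable_funX; case: sh. Qed.

Let h20 x : (0 <= (h x ^+ 2)%:E)%E. Proof. by rewrite lee_fin sqr_ge0. Qed.

Let nu0 : nu set0 = 0%E. Proof. by rewrite /sqr_measure integral_set0. Qed.

Let nu_ge0 B : (0 <= nu B)%E. Proof. by apply: integral_ge0. Qed.

Let nu_sigma_additive : semi_sigma_additive nu.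
Proof. exact: semi_sigma_additive_nng_induced. Qed.

HB.instance Definition _ := isMeasure.Build _ _ _ nu nu0 nu_ge0 nu_sigma_additive.

Let nu_fin : fin_num_fun nu.
Proof.
move=> B mB; rewrite ge0_fin_numE//; apply: le_lt_trans (proj2 sh).
by apply: ge0_subset_integral.
Qed.

HB.instance Definition _ := @Measure_isFinite.Build _ _ _ nu nu_fin.

(* The measure [mu] need not be sigma-finite; Fubini's theorem is applied to the
   finite measure [h^2 mu] and the integrand [k / h] (with [k / 0 = 0]). *)
Lemma ip_mean (P : probability T R) (k : T -> T -> R) (C : R) :
  measurable_fun [set: T * T] (fun z => k z.1 z.2) ->
  (exists M, forall x z, `|k x z| <= M) ->
  (forall x, (\int[mu]_z (k x z ^+ 2)%:E <= C%:E)%E) ->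
  measurable_fun [set: T] (fun x => ip mu h (k x)) /\
  ip mu h (fun z => \int[P]_x k x z) = \int[P]_x ip mu h (k x).
Proof.
move=> mk [M kM] kC; have [mh hoo] := sh.
(* The inverse of [h], with value 0 where [h] vanishes, written with a real power so that its
   measurability follows from that of powers. *)
pose inv z := h z * (`|h z| `^ (-1)) ^+ 2.
have invE z : inv z = (h z)^-1.
  rewrite /inv powR_inv1 ?normr_ge0// exprVn real_normK ?num_real//.
  have [->|h0] := eqVneq (h z) 0; first by rewrite mul0r invr0.
  by field.
have minv : measurable_fun [set: T] inv.
  apply: measurable_funM => //; apply: measurable_funX.
  apply: (@measurableT_comp _ _ _ _ _ _ (fun y : R => y `^ (-1))).
    exact: measurable_powR.
  exact: measurableT_comp.
pose rho (z : T * T) : \bar R := (k z.1 z.2 * inv z.2)%:E.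
have mrho : measurable_fun [set: T * T] rho.
  apply/measurable_EFinP; apply: measurable_funM => //.
  exact: measurableT_comp.
have mkx x : measurable_fun [set: T] (k x).
  exact: (measurableT_comp mk (pair1_measurable x)).
have mki x : measurable_fun [set: T] (fun z => k x z * inv z) by exact: measurable_funM.
have inv2 z : inv z * h z ^+ 2 = h z.
  rewrite invE; have [->|h0] := eqVneq (h z) 0; first by rewrite expr0n mulr0.
  by field.
have dens (f : T -> R) : measurable_fun [set: T] f ->
    (\int[nu]_z (f z)%:E = \int[mu]_z (f z * h z ^+ 2)%:E)%E.
  by apply: integral_density => //; exact: measurable_funX.
have FE x : (\int[nu]_z rho (x, z) = \int[mu]_z (h z * k x z)%:E)%E.
  apply: (etrans (dens _ (mki x))); apply: eq_integral => z _; congr EFin.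
  by rewrite -mulrA inv2 mulrC.
have skx x : sqint mu (k x).
  by split=> //; apply: le_lt_trans (kC x) _; rewrite ltry.
have Ffin x : (\int[mu]_z (h z * k x z)%:E)%E \is a fin_num.
  by apply: integrable_fin_num => //; exact: sqint_mul.
set H := fine (\int[mu]_z (h z ^+ 2)%:E)%E.
have HE : (\int[mu]_z (h z ^+ 2)%:E = H%:E)%E.
  by rewrite fineK// ge0_fin_numE//; apply: integral_ge0.
(* Against [h ^+ 2], the integrand [|k / h|] becomes [|h * k|], which is at most [h ^+ 2 + k ^+ 2];
   its integral in [z] is at most [H + C] uniformly in [x]. *)
have irho : (P \x nu)%E.-integrable [set: T * T] rho.
  apply/integrable12ltyP => //.
  apply: (@le_lt_trans _ _ (\int[P]_x (H + C)%:E)%E); last first.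
    rewrite integral_cst//= [X in (_ * X)%E](probability_setT P) mule1 ltry//.
  apply: ge0_le_integral => //.
  - by move=> x _; apply: integral_ge0 => z _; exact: abse_ge0.
  - apply: (measurable_fun_fubini_tonelli_F (m2 := nu) (abse \o rho)).
      exact: measurableT_comp.
    by move=> z; exact: abse_ge0.
  move=> x _.
  have -> : (\int[nu]_z `|rho (x, z)| = \int[mu]_z `|h z * k x z|%:E)%E.
    transitivity (\int[nu]_z (`|k x z * inv z|)%:E)%E.
      by apply: eq_integral => z _; rewrite abse_EFin.
    apply: (etrans (dens (fun z => `|k x z * inv z|) _)); first exact: measurableT_comp.
    apply: eq_integral => z _; congr EFin.
    rewrite -[in LHS](ger0_norm (sqr_ge0 (h z))) -normrM -mulrA inv2.
    by rewrite mulrC.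
  rewrite EFinD -HE; apply: (@le_trans _ _ (\int[mu]_z (h z ^+ 2)%:E + \int[mu]_z (k x z ^+ 2)%:E)%E).
    rewrite -ge0_integralD//; last 2 first.
    - by move=> z _; rewrite lee_fin sqr_ge0.
    - by apply/measurable_EFinP; exact: measurable_funX.
    apply: ge0_le_integral => //.
    - by apply/measurable_EFinP; apply: measurableT_comp => //; exact: measurable_funM.
    - apply: emeasurable_funD => //; apply/measurable_EFinP; exact: measurable_funX.
    move=> z _; rewrite -EFinD lee_fin ler_norml.
    have := sqr_ge0 (h z - k x z); have := sqr_ge0 (h z + k x z).
    by rewrite sqrrB sqrrD => h1 h2; apply/andP; split; nra.
  by rewrite leeD2l.
have mF : measurable_fun [set: T] (fun x => ip mu h (k x)).
  apply/measurable_EFinP.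
  apply: (eq_measurable_fun (fubini_F nu rho)).
    by move=> x _; rewrite /fubini_F FE /= /ip /Rintegral fineK.
  exact: measurable_fubini_F irho.
split=> //.
have bk z : bmeas (fun x => k x z).
  split; last by exists M.
  exact: (measurableT_comp mk (pair2_measurable z)).
have Fub := Fubini irho.
rewrite /ip /Rintegral; congr fine.
transitivity (\int[P]_x \int[nu]_z rho (x, z))%E; last first.
  by apply: eq_integral => x _; rewrite FE fineK.
apply: etrans (esym Fub).
transitivity (\int[nu]_z ((\int[P]_x k x z) * inv z)%:E)%E.
  apply: esym; apply: (etrans (dens (fun z => (\int[P]_x k x z) * inv z) _)).
    apply: measurable_funM => //.
    have bkk : bmeas (fun z : T * T => k z.1 z.2) by split => //; exists M.
    by have [] := bmeas_ex1 P P bkk.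
  apply: eq_integral => z _; congr EFin.
  by rewrite -mulrA inv2 mulrC.
apply: eq_integral => z _; rewrite /fubini_G /rho /= mulrC -exZ//.
rewrite ex_EFin; last by apply: bmeasM; [exact: bmeas_cst|exact: bk].
by apply: eq_integral => x _; rewrite mulrC.
Qed.

End SquareDensity.

Lemma ex_sqr_le {d : measure_display} {T : measurableType d} {R : realType}
  (P : probability T R) (f : T -> R) :
  bmeas f -> (\int[P]_x f x) ^+ 2 <= \int[P]_x f x ^+ 2.
Proof.
move=> bf; set e := \int[P]_x f x.
have bc c : bmeas (fun _ : T => c : R) by exact: bmeas_cst.
have : \int[P]_v (0 : R) <= \int[P]_v (f v - e) ^+ 2.
  apply: ex_le; [exact: bc|by apply: bmeasX; exact: bmeasB|].
  by move=> v; exact: sqr_ge0.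
rewrite ex_cst.
have -> : \int[P]_v (f v - e) ^+ 2 = \int[P]_v (f v ^+ 2 + ((- 2 * e) * f v + e ^+ 2)).
  by apply: eq_Rintegral => v _; ring.
have b1 : bmeas (fun v => (- 2 * e) * f v) by exact: bmeasM.
rewrite exD; [|exact: bmeasX|exact: bmeasD].
by rewrite exD// exZ// ex_cst -/e; lra.
Qed.

Section KernelFacts.
Context {d : measure_display} {T : measurableType d} {R : realType}.
Variables (mu : {measure set T -> \bar R}) (P : probability T R) (s : T -> R) (S : R).
Hypotheses (ms : measurable_fun [set: T] s) (s0 : forall x, 0 <= s x).
Hypothesis sS : forall x, s x <= S.
Hypothesis Ps : forall B, measurable B -> P B = (\int[mu]_(x in B) (s x)%:E)%E.

Lemma law_meanE (f : T -> R) : measurable_fun [set: T] f ->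
  law_mean mu s f = \int[P]_x f x.
Proof.
by move=> mf; rewrite /law_mean /Rintegral; congr fine; rewrite (integral_density ms s0 Ps).
Qed.

Lemma integral_s : (\int[mu]_x (s x)%:E = 1)%E.
Proof. by rewrite -Ps// probability_setT. Qed.

Lemma integral_law_le (f : T -> R) : measurable_fun [set: T] f -> (forall x, 0 <= f x) ->
  (\int[P]_x (f x)%:E <= S%:E * \int[mu]_x (f x)%:E)%E.
Proof.
move=> mf f0; rewrite (integral_density ms s0 Ps)//.
have S0 : 0 <= S := le_trans (s0 point) (sS point).
have mfe : measurable_fun [set: T] (EFin \o f) by exact/measurable_EFinP.
rewrite -ge0_integralZl//; last by move=> x _; rewrite lee_fin.
apply: ge0_le_integral => //.
- by move=> x _; rewrite lee_fin mulr_ge0.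
- by apply/measurable_EFinP; exact: measurable_funM.
- exact: measurable_funeM.
by move=> x _; rewrite -EFinM lee_fin mulrC ler_wpM2r.
Qed.

Lemma ex_le_ip (f : T -> R) : bmeas f -> sqint mu f ->
  \int[P]_x f x ^+ 2 <= S * ip mu f f.
Proof.
move=> bf sf; rewrite -lee_fin ex_EFin; last exact: bmeasX.
have [mf _] := bf.
have H : (\int[P]_x (f x ^+ 2)%:E <= S%:E * \int[mu]_x (f x ^+ 2)%:E)%E.
  by apply: integral_law_le => [|x]; [exact: measurable_funX|exact: sqr_ge0].
by apply: (le_trans H); rewrite EFinM -normL2_sqr_ip// normL2_sqr.
Qed.

(** Since [s ^+ 2 <= S * s] and [s] has integral 1. *)
Lemma sqint_s : sqint mu s.
Proof.
have S0 : 0 <= S := le_trans (s0 point) (sS point).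
split=> //; apply: (@le_lt_trans _ _ (\int[mu]_x (S%:E * (s x)%:E))%E).
  apply: ge0_le_integral => //.
  - by move=> x _; rewrite lee_fin sqr_ge0.
  - by apply/measurable_EFinP; exact: measurable_funX.
  - by apply: measurable_funeM; exact/measurable_EFinP.
  by move=> x _; rewrite -EFinM lee_fin expr2 ler_wpM2r.
rewrite ge0_integralZl//; last 2 first.
- exact/measurable_EFinP.
- by move=> x _; rewrite lee_fin.
by rewrite integral_s mule1 ltry.
Qed.

Variables (k : T -> T -> R) (M : R).
Hypothesis ksym : forall x y, k x y = k y x.
Hypothesis mk : measurable_fun [set: T * T] (fun z => k z.1 z.2).
Hypothesis kM : forall x y, `|k x y| <= M.
Hypothesis kM2 : forall x, (\int[mu]_z (k x z ^+ 2)%:E <= M%:E)%E.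
Hypothesis mA : measurable_fun [set: T * T] (fun z => A_ker mu k z.1 z.2).

Local Notation sk := (s_ker mu s k).
Local Notation A := (A_ker mu k).
Local Notation Theta := (Theta_ker mu k).

Lemma M_ge0 : 0 <= M. Proof. exact: le_trans (kM point point). Qed.

Lemma bmeas_ker : bmeas (fun z : T * T => k z.1 z.2).
Proof. by split=> //; exists M. Qed.

Lemma bmeas_ker1 x : bmeas (k x). Proof. exact: (bmeas_pair1 x bmeas_ker). Qed.

Lemma sqint_ker x : sqint mu (k x).
Proof.
split; first by have [] := bmeas_ker1 x.
by apply: le_lt_trans (kM2 x) _; rewrite ltry.
Qed.

Lemma s_kerE x : sk x = \int[P]_y k x y.
Proof.
rewrite /s_ker -[LHS]/(law_mean mu s (fun y => k y x)) law_meanE.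
  by apply: eq_Rintegral => y _.
by have [] := bmeas_pair2 x bmeas_ker.
Qed.

Lemma bmeas_s_ker : bmeas sk.
Proof.
rewrite (_ : sk = fun x => \int[P]_y k x y); last by apply/funext => x; exact: s_kerE.
exact: (@bmeas_ex2 _ _ _ _ _ P P (fun z => k z.1 z.2) bmeas_ker).
Qed.

(** [A_k] is the Gram kernel of the functions [k x] in L^2, which opens it to the Cauchy-Schwarz
    inequality. *)
Lemma A_ip x y : A x y = ip mu (k x) (k y).
Proof. by apply: eq_Rintegral => z _; rewrite (ksym z y). Qed.

Lemma A_sym x y : A x y = A y x.
Proof. by rewrite !A_ip ipC. Qed.

Lemma Theta_ip x : Theta x = ip mu (k x) (k x). Proof. exact: A_ip. Qed.

Lemma Theta_bounds x : 0 <= Theta x <= M.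
Proof.
rewrite Theta_ip ip_ge0 /= -lee_fin -normL2_sqr_ip; last exact: sqint_ker.
by rewrite normL2_sqr.
Qed.

Lemma A_le x y : `|A x y| <= M.
Proof.
have /andP[tx tx'] := Theta_bounds x; have /andP[ty ty'] := Theta_bounds y.
rewrite -ler_sqr ?nnegrE ?M_ge0// real_normK ?num_real// A_ip.
apply: (le_trans (ip_cauchy (sqint_ker x) (sqint_ker y))).
by rewrite -!Theta_ip expr2 ler_pM.
Qed.

Lemma bmeas_A : bmeas (fun z : T * T => A z.1 z.2).
Proof. by split=> //; exists M => z; exact: A_le. Qed.

Lemma bmeas_Theta : bmeas Theta.
Proof.
split; last by exists M => x; have /andP[t0 tM] := Theta_bounds x; rewrite ger0_norm.
apply: (@measurableT_comp _ _ _ _ _ _ (fun z : T * T => A z.1 z.2) _ (fun x => (x, x))) => //.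
exact: measurable_fun_pair.
Qed.

Lemma bmeas_chi : bmeas (chi_ker k).
Proof.
split; last by exists M => x; exact: kM.
apply: (@measurableT_comp _ _ _ _ _ _ (fun z : T * T => k z.1 z.2) _ (fun x => (x, x))) => //.
exact: measurable_fun_pair.
Qed.

Lemma ip_s_ker x : ip mu s (k x) = sk x.
Proof. by apply: eq_Rintegral => y _; rewrite mulrC (ksym x y). Qed.

(** For symmetric [g], the second-order term of its Hoeffding decomposition. *)
Definition degenerate (g : T -> T -> R) : T -> T -> R := fun x y =>
  g x y - \int[P]_z g x z - \int[P]_z g y z + \int[P]_u \int[P]_z g u z.

Section Degenerate.
Variables (g : T -> T -> R) (D a c : R).
Hypothesis bg : bmeas (fun z : T * T => g z.1 z.2).
Hypothesis gs : forall x y, g x y = g y x.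
Hypothesis gD : forall x y, `|g x y| <= D.
Hypothesis ga : \int[P]_u \int[P]_v g u v ^+ 2 <= a.
Hypothesis gc : forall u, \int[P]_v g u v ^+ 2 <= c.

Let g1 u := \int[P]_z g u z.
Let g2 := \int[P]_u g1 u.

Let bmeas_g u : bmeas (g u). Proof. exact: (bmeas_pair1 u bg). Qed.

Let bmeas_g1 : bmeas g1. Proof. exact: (@bmeas_ex2 _ _ _ _ _ P P _ bg). Qed.

Let bg2 : bmeas (fun z : T * T => g z.1 z.2 ^+ 2). Proof. exact: bmeasX. Qed.

Lemma bmeas_degenerate : bmeas (fun z : T * T => degenerate g z.1 z.2).
Proof.
apply: bmeasD; last exact: bmeas_cst.
apply: bmeasB; last exact: (bmeas_snd (T1 := T) bmeas_g1).
by apply: bmeasB => //; exact: (bmeas_fst (T2 := T) bmeas_g1).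
Qed.

Lemma degenerate_sym x y : degenerate g x y = degenerate g y x.
Proof. by rewrite /degenerate (gs x y); ring. Qed.

Lemma degenerate_centered x : \int[P]_y degenerate g x y = 0.
Proof.
rewrite /degenerate exD; [|apply: bmeasB => //; apply: bmeasB => //; exact: bmeas_cst|exact: bmeas_cst].
rewrite exB//; last by apply: bmeasB => //; exact: bmeas_cst.
rewrite exB//; last exact: bmeas_cst.
by rewrite !ex_cst subrr sub0r addNr.
Qed.

Lemma degenerate_le x y : `|degenerate g x y| <= 4 * D.
Proof.
have h1 u : `|g1 u| <= D by exact: ex_norm.
have h2 : `|g2| <= D by exact: ex_norm.
rewrite /degenerate -/(g1 x) -/(g1 y) -/g2.
apply: le_trans (ler_normD _ _) _; apply: le_trans (lerD (ler_normB _ _) (lexx _)) _.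
apply: le_trans (lerD (lerD (ler_normB _ _) (lexx _)) (lexx _)) _.
by have := h1 x; have := h1 y; have := gD x y; lra.
Qed.

Let sqr_ex_le u : g1 u ^+ 2 <= c.
Proof. exact: le_trans (ex_sqr_le P (bmeas_g u)) (gc u). Qed.

Lemma degenerate_sup x : \int[P]_y degenerate g x y ^+ 2 <= 16 * c.
Proof.
have g2c : g2 ^+ 2 <= c.
  by apply: le_trans (ex_sqr_le P bmeas_g1) _; apply: ex_le_cst => //; exact: bmeasX.
apply: (@le_trans _ _ (\int[P]_y (4 * g x y ^+ 2 + 12 * c))).
  apply: ex_le.
  - exact/bmeasX/(bmeas_pair1 x bmeas_degenerate).
  - by apply: bmeasD; [apply: bmeasM; [exact: bmeas_cst|exact: bmeasX]|exact: bmeas_cst].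
  move=> y; rewrite /degenerate -/(g1 x) -/(g1 y) -/g2.
  have := sqr_ex_le x; have := sqr_ex_le y; move: g2c.
  set p := g x y; set q := g1 x; set r := g1 y; set t := g2 => h1 h2 h3.
  (* These six squares add up to [4 * (p ^+ 2 + q ^+ 2 + r ^+ 2 + t ^+ 2) - (p - q - r + t) ^+
     2]. *)
  have : 0 <= (p + q) ^+ 2 + (p + r) ^+ 2 + (p - t) ^+ 2 + (q - r) ^+ 2 + (q + t) ^+ 2 + (r + t) ^+ 2.
    by rewrite !addr_ge0// sqr_ge0.
  nra.
rewrite exD; [|by apply: bmeasM; [exact: bmeas_cst|exact: bmeasX]|exact: bmeas_cst].
rewrite exZ; last exact: bmeasX.
by rewrite ex_cst; have := gc x; lra.
Qed.

(** By Jensen the two projections and the mean of [g] have mean square at most [a], so each of the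
    four terms contributes [4 * a]. *)
Lemma degenerate_variance : \int[P]_x \int[P]_y degenerate g x y ^+ 2 <= 16 * a.
Proof.
pose G u := \int[P]_v g u v ^+ 2.
have bG : bmeas G := @bmeas_ex2 _ _ _ _ _ P P _ bg2.
have g1G u : g1 u ^+ 2 <= G u by exact: ex_sqr_le.
have bc r : bmeas (fun _ : T => r : R) by exact: bmeas_cst.
have bg12 : bmeas (fun u => g1 u ^+ 2) by exact: bmeasX.
have g1a : \int[P]_u g1 u ^+ 2 <= a by apply: le_trans ga; exact: ex_le.
have g2a : g2 ^+ 2 <= a by exact: le_trans (ex_sqr_le P bmeas_g1) g1a.
have bd2 := bmeasX 2 bmeas_degenerate.
apply: (@le_trans _ _ (\int[P]_x (8 * G x + 8 * a))); last first.
  rewrite exD//; last by apply: bmeasM.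
  by rewrite ex_cst exZ//; have Ga : \int[P]_x G x <= a := ga; lra.
apply: ex_le; [exact: (@bmeas_ex2 _ _ _ _ _ P P _ bd2)|by apply: bmeasD => //; exact: bmeasM|].
move=> x.
have bgx2 : bmeas (fun y => g x y ^+ 2) by exact: bmeasX.
apply: (@le_trans _ _ (\int[P]_y (4 * g x y ^+ 2 + (4 * g1 y ^+ 2 + (4 * G x + 4 * a))))).
  apply: ex_le.
  - exact: (bmeas_pair1 x bd2).
  - by do 2?[apply: bmeasD]; rewrite ?bc//; apply: bmeasM.
  move=> y; rewrite /degenerate -/(g1 x) -/(g1 y) -/g2 /=.
  have := g1G x; move: g2a.
  set p := g x y; set q := g1 x; set r := g1 y; set t := g2 => h2 h3.
  have : 0 <= (p + q) ^+ 2 + (p + r) ^+ 2 + (p - t) ^+ 2 + (q - r) ^+ 2 + (q + t) ^+ 2 + (r + t) ^+ 2.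
    by rewrite !addr_ge0// sqr_ge0.
  nra.
have b4 : bmeas (fun y => 4 * g x y ^+ 2) by exact: bmeasM.
have b4' : bmeas (fun y => 4 * g1 y ^+ 2) by exact: bmeasM.
rewrite exD//; last exact: bmeasD.
by rewrite exD// ex_cst !exZ// -/(G x); lra.
Qed.

End Degenerate.

Hypothesis ssk : sqint mu sk.

Lemma kernel_bounded : exists B, forall x z, `|k x z| <= B.
Proof. by exists M. Qed.

(** [s_k] is the mean of the random function [k X], and by [ip_mean] the inner product commutes with
    this mean. *)
Lemma ip_s_ker_mean h : sqint mu h ->
  measurable_fun [set: T] (fun x => ip mu h (k x)) /\
  ip mu h sk = \int[P]_x ip mu h (k x).
Proof.
move=> sh; have [m e] := ip_mean sh P mk kernel_bounded kM2.
split=> //; rewrite -e; congr ip; apply/funext => z.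
by rewrite s_kerE; apply: eq_Rintegral => x _.
Qed.

Lemma ip_ker_le h x : sqint mu h -> ip mu h (k x) ^+ 2 <= ip mu h h * Theta x.
Proof. by move=> sh; rewrite Theta_ip; apply: ip_cauchy => //; exact: sqint_ker. Qed.

Lemma ip_ker_bound h x : sqint mu h -> ip mu h (k x) ^+ 2 <= M * ip mu h h.
Proof.
move=> sh; apply: (le_trans (ip_ker_le x sh)); rewrite mulrC.
by rewrite ler_wpM2r ?ip_ge0//; have /andP[] := Theta_bounds x.
Qed.

Lemma bmeas_ip_ker h : sqint mu h -> bmeas (fun x => ip mu h (k x)).
Proof.
move=> sh; split; first by have [] := ip_s_ker_mean sh.
exists (M * ip mu h h + 1) => x.
have h2 := ip_ker_bound x sh; rewrite -real_normK ?num_real// in h2.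
have := sqr_ge0 (`|ip mu h (k x)| - 1); rewrite sqrrB => h1.
have := normr_ge0 (ip mu h (k x)); nra.
Qed.

Lemma mean_A x : \int[P]_y A x y = ip mu sk (k x).
Proof.
have [_ e] := ip_s_ker_mean (sqint_ker x).
by rewrite ipC e; apply: eq_Rintegral => y _; exact: A_ip.
Qed.

Lemma mean_mean_A : \int[P]_x \int[P]_y A x y = ip mu sk sk.
Proof.
by have [_ ->] := ip_s_ker_mean ssk; apply: eq_Rintegral => x _; exact: mean_A.
Qed.

Lemma ex_ker_sqr_le u : \int[P]_v k u v ^+ 2 <= S * Theta u.
Proof.
rewrite Theta_ip; apply: ex_le_ip; [exact: bmeas_ker1|exact: sqint_ker].
Qed.

Lemma ex_Theta_bounds : 0 <= \int[P]_x Theta x <= M.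
Proof.
apply/andP; split; first by apply: Rintegral_ge0 => x _; case/andP: (Theta_bounds x).
by apply: ex_le_cst => [|x]; [exact: bmeas_Theta|case/andP: (Theta_bounds x)].
Qed.

End KernelFacts.

(** * Decompositions of the loss and of the contrast *)

Section SampleIdentities.
Context {d : measure_display} {T : measurableType d} {R : realType}.
Variables (mu : {measure set T -> \bar R}) (P : probability T R) (s : T -> R) (S : R).
Hypotheses (ms : measurable_fun [set: T] s) (s0 : forall x, 0 <= s x).
Hypothesis sS : forall x, s x <= S.
Hypothesis Ps : forall B, measurable B -> P B = (\int[mu]_(x in B) (s x)%:E)%E.
Variables (k : T -> T -> R) (M : R).
Hypothesis ksym : forall x y, k x y = k y x.
Hypothesis mk : measurable_fun [set: T * T] (fun z => k z.1 z.2).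
Hypothesis kM : forall x y, `|k x y| <= M.
Hypothesis kM2 : forall x, (\int[mu]_z (k x z ^+ 2)%:E <= M%:E)%E.
Hypothesis mA : measurable_fun [set: T * T] (fun z => A_ker mu k z.1 z.2).
Hypothesis ssk : sqint mu (s_ker mu s k).

Local Notation sk := (s_ker mu s k).
Local Notation A := (A_ker mu k).
Local Notation Theta := (Theta_ker mu k).
Local Notation chi := (chi_ker k).

Let sqk x : sqint mu (k x). Proof. exact: sqint_ker mk kM kM2 x. Qed.
Let sqs : sqint mu s. Proof. exact: sqint_s ms s0 sS Ps. Qed.

(** Hoeffding's decomposition evaluated on the sample: each point lies in [2 * (size xs - 1)]
    ordered pairs of distinct positions. *)
Lemma pairsum_degenerate (g : T -> T -> R) (xs : seq T) :
  pairsum (degenerate P g) xs = pairsum g xs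
  - 2 * ((size xs)%:R - 1) * (\sum_(u <- xs) \int[P]_z g u z)
  + (size xs)%:R * ((size xs)%:R - 1) * \int[P]_u \int[P]_z g u z.
Proof.
set g1 := fun u => \int[P]_z g u z; set g2 := \int[P]_u \int[P]_z g u z.
have cst (c : R) : \sum_(u <- xs) c = (size xs)%:R * c.
  elim: (xs) => [|x l ih]; first by rewrite big_nil mul0r.
  by rewrite big_cons ih /= -natr1 mulrDl mul1r addrC.
rewrite /pairsum.
have E u : \sum_(v <- xs) degenerate P g u v =
   \sum_(v <- xs) g u v - (size xs)%:R * g1 u - \sum_(v <- xs) g1 v + (size xs)%:R * g2.
  by rewrite /degenerate -/g2 big_split /= cst sumrB sumrB cst.
under eq_bigr do rewrite E.
rewrite big_split /= cst sumrB sumrB cst -mulr_sumr.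
rewrite /degenerate -/g2 [X in _ - X]big_split /= cst sumrB sumrB /g1.
ring.
Qed.

Variables (n : nat) (t : n.-tuple T).
Hypothesis n0 : (0 < n)%N.
Local Notation N := (n%:R : R).
Local Notation hat := (s_hat (tnth t) k).
Local Notation sum f := (\sum_(y <- t) f y).

Let N0 : N != 0. Proof. by rewrite pnatr_eq0 -lt0n. Qed.

Let hatE : hat = fun x => N^-1 * \sum_(y <- t) k y x.
Proof. by apply/funext => x; rewrite /s_hat big_tuple. Qed.

Lemma sqint_hat : sqint mu hat.
Proof. by rewrite hatE; apply: sqintZ; apply: sqint_sum. Qed.

Lemma ip_hat h : sqint mu h -> ip mu hat h = N^-1 * \sum_(y <- t) ip mu h (k y).
Proof.
move=> sh; rewrite hatE ipZl//; last exact: sqint_sum.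
rewrite ip_suml//; congr (_ * _); apply: eq_bigr => y _; exact: ipC.
Qed.

Lemma ip_hat_hat : ip mu hat hat = N^-1 ^+ 2 * (sum Theta + pairsum A t).
Proof.
rewrite (ip_hat sqint_hat) expr2 -mulrA; congr (_ * _).
have E y : ip mu hat (k y) = N^-1 * \sum_(u <- t) A y u.
  rewrite ip_hat//; congr (_ * _); apply: eq_bigr => u _.
  by rewrite A_ip.
under eq_bigr do rewrite E.
rewrite -mulr_sumr; congr (_ * _).
by rewrite /pairsum addrC subrK.
Qed.

Definition sample_loss : R := ip mu (fun x => s x - hat x) (fun x => s x - hat x).

Lemma lossE : (normL2 mu (s \- hat)%R ^+ 2 = sample_loss%:E)%E.
Proof. by rewrite normL2_sqr_ip//; apply: sqintB => //; exact: sqint_hat. Qed.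

Lemma sample_lossE : sample_loss = ip mu s s + ip mu hat hat - 2 * N^-1 * sum sk.
Proof.
rewrite /sample_loss ip_sqrB//; last exact: sqint_hat.
rewrite (ipC mu s) ip_hat//.
have -> : \sum_(y <- t) ip mu s (k y) = sum sk.
  by apply: eq_bigr => y _; exact: ip_s_ker.
ring.
Qed.

Definition bias : R := ip mu (fun x => sk x - s x) (fun x => sk x - s x).

Definition cross x : R := ip mu (fun x => sk x - s x) (k x).

Definition centered_sum (f : T -> R) : R := \sum_(y <- t) (f y - \int[P]_z f z).

Lemma centered_sumE f : centered_sum f = sum f - N * \int[P]_z f z.
Proof.
rewrite /centered_sum sumrB; congr (_ - _).
by rewrite big_const_seq count_predT size_tuple iter_addr addr0 mulr_natl.
Qed.

(** Removing the projections of [A] from the pair sum leaves [2 / N] times the sum of [<s_k, k y>];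
    together with the [- 2 / N] sum of [s_k y = <s, k y>] it forms the cross term. What the missing
    diagonal leaves over carries a further factor [1 / N]. *)
Lemma loss_decomposition : sample_loss = bias
  + N^-1 ^+ 2 * sum Theta + N^-1 ^+ 2 * pairsum (degenerate P A) t
  - 2 * N^-1 ^+ 2 * (\sum_(y <- t) ip mu sk (k y)) + N^-1 * ip mu sk sk
  + 2 * N^-1 * centered_sum cross.
Proof.
have sh : sqint mu (fun x => sk x - s x) by exact: sqintB.
have [mc ec] := ip_s_ker_mean ms s0 Ps ksym mk kM kM2 sh.
rewrite sample_lossE ip_hat_hat centered_sumE pairsum_degenerate size_tuple.
rewrite (mean_mean_A ms s0 Ps ksym mk kM kM2 ssk).
have -> : \sum_(u <- t) \int[P]_z A u z = \sum_(y <- t) ip mu sk (k y).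
  by apply: eq_bigr => y _; rewrite (mean_A ms s0 Ps ksym mk kM kM2).
rewrite /cross -ec.
have -> : \sum_(y <- t) ip mu (fun x => sk x - s x) (k y) =
   \sum_(y <- t) ip mu sk (k y) - sum sk.
  rewrite -sumrB; apply: eq_bigr => y _; rewrite ipBl//; congr (_ - _).
  exact: ip_s_ker.
rewrite /bias ip_sqrB// ipBl// (ipC mu s).
field.
exact: N0.
Qed.

(** This is [F_k]. The sum of [s_k] enters with [2 * (N - 1) / N ^+ 2] from the projections of the
    pair sum of [k] and with [- 1 / N] from the loss, whence the factor [1 - 2 / N] and the leftover
    mean. *)
Definition fluctuation : R := N^-1 ^+ 2 * centered_sum chi
  + N^-1 ^+ 2 * pairsum (degenerate P k) t
  + (1 - 2 / N) * (N^-1 * centered_sum sk) - N^-1 * \int[P]_x sk x.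

Lemma contrast_decomposition : emp_mean (tnth t) (contrast mu hat) =
  sample_loss - ip mu s s - 2 * (\int[P]_x chi x) / N - 2 * fluctuation.
Proof.
rewrite /emp_mean /contrast.
rewrite normL2_sqr_ip; last exact: sqint_hat.
rewrite /= sumrB sumr_const card_ord -mulr_natl -mulr_sumr.
have -> : \sum_(i < n) hat (tnth t i) = N^-1 * (sum chi + pairsum k t).
  rewrite /s_hat -mulr_sumr; congr (_ * _).
  rewrite /pairsum addrC subrK [RHS]big_tuple; apply: eq_bigr => i _.
  by rewrite big_tuple; apply: eq_bigr => j _; rewrite ksym.
rewrite sample_lossE /fluctuation !centered_sumE pairsum_degenerate size_tuple.
have E y : \int[P]_z k y z = sk y by rewrite (s_kerE ms s0 Ps ksym mk kM).
have -> : \int[P]_u \int[P]_z k u z = \int[P]_u sk u by apply: eq_Rintegral => u _.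
have -> : \sum_(u <- t) \int[P]_z k u z = sum sk by apply: eq_bigr => u _.
field.
exact: N0.
Qed.

End SampleIdentities.

(** * Real inequalities *)

Section RealInequalities.
Context {R : realType}.
Implicit Types (y z p q r e C H : R).

Lemma ler_norm_of_sqr y z : 0 <= z -> y ^+ 2 <= z ^+ 2 -> `|y| <= z.
Proof. by move=> z0 yz; rewrite -ler_sqr ?nnegrE// real_normK ?num_real. Qed.

(** The hypothesis does not involve [e], so one event gives the conclusion for every [e]; the square
    of the right side already contains the cross product [2 * C * (p * q)]. *)
Lemma deviation_amgm y p q e C : 0 < e <= 1 -> 1 <= C -> 0 <= p -> 0 <= q ->
  y ^+ 2 <= C * (p * q + q ^+ 2) -> `|y| <= e * p + C * q / e.
Proof.
move=> /andP[e0 e1] C1 p0 q0 H.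
have Cq : 0 <= C * q by rewrite mulr_ge0//; lra.
have ie : C * q <= C * q / e by rewrite ler_pdivlMr// ler_piMr.
have i0 : 0 <= C * q / e by apply: le_trans ie.
apply: ler_norm_of_sqr; first by rewrite addr_ge0// mulr_ge0// ltW.
apply: (le_trans H).
have -> : (e * p + C * q / e) ^+ 2 = (e * p) ^+ 2 + 2 * C * (p * q) + (C * q / e) ^+ 2.
  by field; rewrite gt_eqF.
have h1 : (C * q) ^+ 2 <= (C * q / e) ^+ 2 by apply: lerXn2r; rewrite ?nnegrE.
have h2 : C * q ^+ 2 <= (C * q) ^+ 2.
  rewrite exprMn ler_wpM2r ?sqr_ge0// expr2 ler_peMl//; lra.
have h3 : 0 <= C * (p * q) by rewrite mulr_ge0 ?mulr_ge0//; lra.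
have h4 := sqr_ge0 (e * p).
by rewrite mulrDr; lra.
Qed.

(** For the cross term: [H] is the bias and [r] the geometric mean of [p] and [q]. Splitting first
    [H] from [r], then [p] from [q] inside [r], produces the third power of [e]. *)
Lemma deviation_amgm3 y H p q r e C : 0 < e <= 1 -> 1 <= C -> 0 <= H -> 0 <= p -> 0 <= q ->
  0 <= r -> r ^+ 2 = p * q -> y ^+ 2 <= C * (H * r + H * q + q ^+ 2) ->
  `|y| <= e * (H + p) + C ^+ 2 * q / e ^+ 3.
Proof.
move=> /andP[e0 e1] C1 H0 p0 q0 r0 rpq Hy.
set Q := C ^+ 2 * q / e ^+ 3.
have e3 : 0 < e ^+ 3 by exact: exprn_gt0.
have C0 : 0 <= C by lra.
have Q0 : 0 <= Q by rewrite divr_ge0 ?mulr_ge0 ?sqr_ge0// ltW.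
have eH : 0 <= e * H by rewrite mulr_ge0// ltW.
have ep : 0 <= e * p by rewrite mulr_ge0// ltW.
have hr : 2 * C * r <= e * (e * p + Q).
  have l0 : 0 <= 2 * C * r by rewrite !mulr_ge0.
  have r1 : 0 <= e * (e * p + Q) by rewrite mulr_ge0 ?addr_ge0// ltW.
  rewrite -ler_sqr ?nnegrE//.
  have -> : (2 * C * r) ^+ 2 = 4 * (C ^+ 2 * q) * p.
    by rewrite exprMn rpq; ring.
  have -> : C ^+ 2 * q = e ^+ 3 * Q by rewrite /Q; field; rewrite gt_eqF.
  have -> : (e * (e * p + Q)) ^+ 2 = 4 * (e ^+ 3 * Q) * p + (e * (e * p - Q)) ^+ 2 by ring.
  by rewrite lerDl; exact: sqr_ge0.
have hq : C * q <= e * Q.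
  have -> : e * Q = C ^+ 2 * q / e ^+ 2 by rewrite /Q; field; rewrite gt_eqF.
  rewrite ler_pdivlMr ?exprn_gt0//.
  have e21 : e ^+ 2 <= 1 by rewrite expr_le1// ltW.
  apply: (@le_trans _ _ (C * q)); first by rewrite ler_piMr// mulr_ge0.
  by rewrite ler_wpM2r// expr2 ler_peMl.
have hQ : C * q ^+ 2 <= Q ^+ 2.
  have qQ : C * q <= Q by apply: (le_trans hq); rewrite ler_piMl.
  apply: (@le_trans _ _ ((C * q) ^+ 2)).
    by rewrite exprMn ler_wpM2r ?sqr_ge0// expr2 ler_peMl.
  have Cq0 : 0 <= C * q by exact: mulr_ge0.
  by apply: lerXn2r; rewrite ?nnegrE.
apply: ler_norm_of_sqr; first by rewrite addr_ge0// mulr_ge0 ?addr_ge0// ltW.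
apply: (le_trans Hy).
have hr' := ler_wpM2l H0 hr.
have hq' := ler_wpM2l H0 hq.
have s1 := sqr_ge0 (e * H); have s2 := sqr_ge0 (e * p).
have s3 : 0 <= e * p * Q by exact: mulr_ge0.
have s4 : 0 <= e * H * (e * p) by exact: mulr_ge0.
have s5 : 0 <= e * H * Q by exact: mulr_ge0.
have s6 : 0 <= H * (C * r) by rewrite !mulr_ge0.
have -> : (e * (H + p) + Q) ^+ 2 = (e * H) ^+ 2 + (e * p) ^+ 2 + Q ^+ 2 +
   2 * (e * p * Q) + 2 * (e * H * (e * p)) + 2 * (e * H * Q) by ring.
have hr2 : H * (2 * C * r) <= e * H * (e * p) + e * H * Q.
  by apply: (le_trans hr'); rewrite le_eqVlt; apply/orP; left; apply/eqP; ring.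
have hq2 : H * (C * q) <= e * H * Q.
  by apply: (le_trans hq'); rewrite le_eqVlt; apply/orP; left; apply/eqP; ring.
have -> : C * (H * r + H * q + q ^+ 2) = H * (C * r) + H * (C * q) + C * q ^+ 2 by ring.
have e2 : H * (2 * C * r) = 2 * (H * (C * r)) by ring.
rewrite e2 in hr2.
lra.
Qed.

(** Here [p] is the mean and [y2] the deviation of the diagonal part, [y4] the degenerate part, [y5]
    the cross term. The term [sa] is not concentrated: it is compared with the empirical diagonal
    [y2 + p], and [y2] is bounded again. *)
Lemma loss_bracket (L b p kk q e C y2 y4 y5 sa : R) : 0 < e <= 1 -> 1 <= C ->
  0 <= b -> 0 <= p -> 0 <= kk <= q ->
  L = b + (y2 + p) + y4 - 2 * sa + kk + 2 * y5 ->
  2 * `|sa| <= e * (y2 + p) + kk / e ->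
  `|y2| <= e * p + C * q / e -> `|y4| <= e * p + C * q / e ->
  `|y5| <= e * (b + p) + C ^+ 2 * q / e ^+ 3 ->
  `|L - b - p| <= 6 * e * (b + p) + 7 * C ^+ 2 * q / e ^+ 3.
Proof.
move=> /andP[e0 e1] C1 b0 p0 /andP[k0 kq] LE hsa h2 h4 h5.
have q0 : 0 <= q by lra.
set Q := q / e ^+ 3.
have e3 : 0 < e ^+ 3 by exact: exprn_gt0.
have Q0 : 0 <= Q by rewrite divr_ge0// ltW.
have qe : q / e <= Q.
  rewrite /Q ler_wpM2l// lef_pV2 ?posrE// exprS ler_piMr ?(ltW e0)//.
  by rewrite expr_le1// ltW.
have qq : q <= Q.
  apply: le_trans qe; rewrite ler_pdivlMr// ler_piMr//.
have C2 : C <= C ^+ 2 by rewrite expr2 ler_peMl//; lra.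
have ke : kk / e <= Q.
  by apply: le_trans qe; rewrite ler_wpM2r// invr_ge0 ltW.
rewrite -!mulrA -/Q in h2 h4 h5 *.
have Cqe : C * (q / e) <= C ^+ 2 * Q.
  apply: ler_pM => //; first lra.
  by rewrite divr_ge0// ltW.
have CQ : Q <= C ^+ 2 * Q by rewrite ler_peMl//; nra.
have ep : 0 <= e * p by rewrite mulr_ge0// ltW.
have eb : 0 <= e * b by rewrite mulr_ge0// ltW.
have ey2 : e * y2 <= `|y2|.
  apply: (le_trans (ler_norm _)); rewrite normrM (gtr0_norm e0).
  by rewrite ler_piMl.
have -> : L - b - p = y2 + y4 - 2 * sa + kk + 2 * y5 by rewrite LE; ring.
apply: (le_trans (ler_normD _ _)); apply: (le_trans (lerD (ler_normD _ _) (lexx _))).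
apply: (le_trans (lerD (lerD (ler_normB _ _) (lexx _)) (lexx _))).
apply: (le_trans (lerD (lerD (lerD (ler_normD _ _) (lexx _)) (lexx _)) (lexx _))).
rewrite (ger0_norm k0) !normrM (gtr0_norm (ltr0Sn _ 1)).
rewrite !mulrDr in hsa h5 *.
lra.
Qed.

Lemma mul_le_sqrD (y z : R) : 4 * (y * z) <= (y + z) ^+ 2.
Proof. by have := sqr_ge0 (y - z); rewrite sqrrB sqrrD; lra. Qed.

Lemma norm_one_sub_le (y : R) : 1 <= y -> `|1 - 2 / y| <= 1.
Proof.
move=> y1; have y0 : 0 < y by lra.
have /andP[u v] : 0 <= 2 / y <= 2 by rewrite divr_ge0 ?(ltW y0)//= ler_pdivrMr// ler_peMr.
by rewrite ler_norml; apply/andP; split; lra.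
Qed.

(** The deviation of the difference of means, [y6], is measured by the squared distance [D], which
    the two biases [b] and [b'] control. *)
Lemma fluctuation_bracket (y1 y1' y3 y3' y6 m m' b b' p p' D c e z : R) :
  0 < e -> `|c| <= 1 -> D <= 2 * b + 2 * b' ->
  `|y1| <= e * p + z -> `|y1'| <= e * p' + z ->
  `|y3| <= e * p + z -> `|y3'| <= e * p' + z ->
  `|y6| <= e * D + z -> `|m| <= z -> `|m'| <= z ->
  `|y1 - y1' + (y3 - y3') + c * y6 - (m - m')| <= 2 * e * (b + p + (b' + p')) + 7 * z.
Proof.
move=> e0 c1 bD h1 h1' h3 h3' h6 hm hm'.
apply: (le_trans (ler_normB _ _)); apply: (le_trans (lerD (ler_normD _ _) (ler_normB _ _))).
apply: (le_trans (lerD (lerD (ler_normD _ _) (lexx _)) (lexx _))).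
apply: (le_trans (lerD (lerD (lerD (ler_normB _ _) (ler_normB _ _)) (lexx _)) (lexx _))).
have h6' : `|c * y6| <= e * D + z.
  by rewrite normrM; apply: le_trans h6; rewrite ler_piMl.
have eD : e * D <= e * (2 * b + 2 * b') by rewrite ler_wpM2l// ltW.
have -> : 2 * e * (b + p + (b' + p')) = e * (2 * b + 2 * b') + (e * p + e * p) + (e * p' + e * p') by ring.
lra.
Qed.

End RealInequalities.

(** * Deviations under the assumptions on the kernels *)

Lemma normL2E {d : measure_display} {T : measurableType d} {R : realType}
    (mu : {measure set T -> \bar R}) (f : T -> R) :
  sqint mu f -> normL2 mu f = (Num.sqrt (ip mu f f))%:E.
Proof.
move=> sf; have := normL2_sqr_ip sf; have : (0 <= normL2 mu f)%E by exact: Lnorm_ge0.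
case: (normL2 mu f) => [r|_|//].
- rewrite lee_fin -EFin_expe => r0 [<-].
  by rewrite sqrtr_sqr ger0_norm.
- by rewrite expe2 mulyy.
Qed.

Lemma ub_ereal_sup_range {I : Type} {R : realType} (F : I -> \bar R) (c : \bar R) :
  (ereal_sup (range F) <= c)%E -> forall i, (F i <= c)%E.
Proof. by move=> H i; apply: le_trans H; apply: ereal_sup_ubound; exists i. Qed.

Section Setting.
Context {d d0 : measure_display} {T : measurableType d} {Omega : measurableType d0}
  {R : realType}.
Variables (mu : {measure set T -> \bar R}) (Pr : probability Omega R) (s : T -> R) (n : nat).
Variables (X Y : {RV Pr >-> T}) (Xs : 'I_n -> {RV Pr >-> T}).
Variables (K : finType) (ker : K -> T -> T -> R) (Gamma Upsilon : R).
Hypothesis n0 : (0 < n)%N.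
Hypothesis iid : iid_with_density mu s X Y Xs.
Hypothesis ka : kernel_assumptions mu s n X Y ker Gamma Upsilon.

Local Notation P := (distribution Pr X).
Local Notation N := (n%:R : R).
Let S : R := fine (supnorm s).
Let M : R := Gamma * N.

Let supnorm_fin : supnorm s = S%:E.
Proof.
rewrite /S fineK// ge0_fin_numE; first exact: density_bounded iid.
by apply: le_trans (ereal_sup_ubound _); last by exists point.
Qed.

Lemma s_le_sup x : s x <= S.
Proof.
rewrite -lee_fin -supnorm_fin; apply: ereal_sup_ubound; exists x => //.
by rewrite ger0_norm// (density_ge0 iid).
Qed.

Let ms := density_measurable iid.
Let s0 := density_ge0 iid.
Let Ps : forall B, measurable B -> P B = (\int[mu]_(x in B) (s x)%:E)%E := law_density iid.

Lemma S_ge0 : 0 <= S. Proof. exact: le_trans (s0 point) (s_le_sup point). Qed.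

Lemma Gamma_S_le : Gamma * (1 + S) <= Upsilon.
Proof.
have := Upsilon_s ka; rewrite ge_max => /andP[+ _].
by rewrite supnorm_fin -EFinD -EFinM lee_fin.
Qed.

Lemma Upsilon_consequences :
  [/\ 1 <= Upsilon, S <= Upsilon, Gamma <= Upsilon, S * Gamma <= Upsilon & 1 <= Gamma].
Proof.
have g1 := Gamma_ge1 ka; have S0 := S_ge0; have H := Gamma_S_le.
by split; nra.
Qed.

Lemma ker_sym k x y : ker k x y = ker k y x.
Proof. exact: kernel_sym (all_kernels ka k) x y. Qed.

Lemma ker_measurable k : measurable_fun [set: T * T] (fun z => ker k z.1 z.2).
Proof. exact: kernel_measurable (all_kernels ka k). Qed.

Lemma ker_le k x y : `|ker k x y| <= M.
Proof.
have := kernels_size ka k; rewrite /kernel_size ge_max => /andP[_ H].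
by have := ub_ereal_sup_range H (x, y); rewrite lee_fin.
Qed.

Lemma ker_sqr_le k x : (\int[mu]_y (ker k x y ^+ 2)%:E <= M%:E)%E.
Proof.
have := kernels_size ka k; rewrite /kernel_size ge_max => /andP[H _].
exact: (ub_ereal_sup_range H x).
Qed.

Lemma sqint_s_ker k : sqint mu (s_ker mu s (ker k)).
Proof.
apply: sqint_normL2.
  by have [] := bmeas_s_ker ms s0 Ps (ker_sym k) (ker_measurable k) (ker_le k).
have := Upsilon_s ka; rewrite ge_max => /andP[_ H].
by apply: le_lt_trans (ub_ereal_sup_range H k) _; rewrite ltry.
Qed.

Lemma ip_s_ker_le k : ip mu (s_ker mu s (ker k)) (s_ker mu s (ker k)) <= Upsilon.
Proof.
have := Upsilon_s ka; rewrite ge_max => /andP[_ H].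
have := ub_ereal_sup_range H k; rewrite normL2_sqr_ip ?lee_fin//.
exact: sqint_s_ker.
Qed.

Definition mean_Theta k : R := \int[P]_x Theta_ker mu (ker k) x.

Let bTheta k : bmeas (Theta_ker mu (ker k)).
Proof.
exact: (bmeas_Theta (ker_sym k) (ker_measurable k) (ker_le k) (ker_sqr_le k) (A_measurable ka k)).
Qed.

Let bA k : bmeas (fun z : T * T => A_ker mu (ker k) z.1 z.2).
Proof.
exact: (bmeas_A (ker_sym k) (ker_measurable k) (ker_le k) (ker_sqr_le k) (A_measurable ka k)).
Qed.

Lemma law_mean_Theta k : law_mean mu s (Theta_ker mu (ker k)) = mean_Theta k.
Proof. by rewrite (law_meanE ms s0 Ps)//; have [] := bTheta k. Qed.

Lemma mean_Theta_bounds k : 0 <= mean_Theta k <= M.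
Proof.
exact: (ex_Theta_bounds P (ker_sym k) (ker_measurable k) (ker_le k) (ker_sqr_le k) (A_measurable ka k)).
Qed.

Lemma chi_variance k : \int[P]_x chi_ker (ker k) x ^+ 2 <= Upsilon * N * mean_Theta k.
Proof.
rewrite -law_mean_Theta -(law_meanE ms s0 Ps); first exact: Upsilon_chi ka k.
by have [] := bmeasX 2 (bmeas_chi (ker_measurable k) (ker_le k)).
Qed.

Lemma A_variance k :
  \int[P]_u \int[P]_v A_ker mu (ker k) u v ^+ 2 <= Upsilon * mean_Theta k.
Proof.
have bA2 := bmeasX 2 (bA k).
rewrite -(@ex_prod _ _ _ _ _ P P _ bA2) -lee_fin -law_mean_Theta.
apply: le_trans (Upsilon_AXY ka k); rewrite unlock.
rewrite (@ex_EFin _ _ _ (P \x P)%E)//.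
have mA2 : measurable_fun [set: T * T] (fun z => (A_ker mu (ker k) z.1 z.2 ^+ 2)%:E).
  by have [m _] := bA2; exact/measurable_EFinP.
have <- : (\int[distribution Pr (sample_pair X Y)]_z (A_ker mu (ker k) z.1 z.2 ^+ 2)%:E =
    \int[(P \x P)%E]_z (A_ker mu (ker k) z.1 z.2 ^+ 2)%:E)%E.
  by apply: eq_measure_integral => B mB _; exact: (pair_law iid mB).
rewrite ge0_integral_distribution//; last by move=> z; rewrite lee_fin sqr_ge0.
Qed.

Lemma A_sup k u : \int[P]_v A_ker mu (ker k) u v ^+ 2 <= Upsilon * N.
Proof.
have := ub_ereal_sup_range (Upsilon_AX ka k) u; rewrite unlock => H.
have bAu : bmeas (fun v => A_ker mu (ker k) u v ^+ 2).
  exact: (bmeas_pair1 u (bmeasX 2 (bA k))).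
rewrite -lee_fin ex_EFin//; apply: le_trans H.
rewrite ge0_integral_distribution//; last 2 first.
- by have [m _] := bAu; exact/measurable_EFinP.
- by move=> v; rewrite lee_fin sqr_ge0.
rewrite le_eqVlt; apply/orP; left; apply/eqP; apply: eq_integral => w _ /=.
by rewrite (A_sym mu (ker_sym k)).
Qed.

Lemma ker_variance k :
  \int[P]_u \int[P]_v ker k u v ^+ 2 <= S * mean_Theta k.
Proof.
have bk2 := bmeasX 2 (bmeas_ker (ker_measurable k) (ker_le k)).
rewrite -exZ//; apply: ex_le.
- exact: (@bmeas_ex2 _ _ _ _ _ P P _ bk2).
- by apply: bmeasM => //; exact: bmeas_cst.
move=> u; exact: (ex_ker_sqr_le ms s0 s_le_sup Ps (ker_sym k) (ker_measurable k) (ker_le k) (ker_sqr_le k)).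
Qed.

Lemma ker_sup k u : \int[P]_v ker k u v ^+ 2 <= S * M.
Proof.
apply: (le_trans (ex_ker_sqr_le ms s0 s_le_sup Ps (ker_sym k) (ker_measurable k) (ker_le k) (ker_sqr_le k) u)).
rewrite ler_wpM2l ?S_ge0//.
by have /andP[] := Theta_bounds (ker_sym k) (ker_measurable k) (ker_le k) (ker_sqr_le k) u.
Qed.

Lemma bmeas_ip_kernel k h : sqint mu h -> bmeas (fun x => ip mu h (ker k x)).
Proof.
exact: (bmeas_ip_ker ms s0 Ps (ker_sym k) (ker_measurable k) (ker_le k) (ker_sqr_le k)).
Qed.

Lemma ip_kernel_bound k h x : sqint mu h -> ip mu h (ker k x) ^+ 2 <= M * ip mu h h.
Proof.
exact: (ip_ker_bound (ker_sym k) (ker_measurable k) (ker_le k) (ker_sqr_le k)).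
Qed.

(** After division by its norm [h] lies in the unit ball, and [x |-> <h, k x>] becomes an element of
    [B_ker]; the bound on [v2_ker] then applies, with the maximum enlarged to a sum. *)
Lemma ip_kernel_variance k h : sqint mu h ->
  \int[P]_x ip mu h (ker k x) ^+ 2 <=
  (Upsilon + Num.sqrt (Upsilon * mean_Theta k)) * ip mu h h.
Proof.
move=> sh; set H := ip mu h h.
have [U1 _ _ _ _] := Upsilon_consequences.
have skx x : sqint mu (ker k x) := sqint_ker (ker_measurable k) (ker_le k) (ker_sqr_le k) x.
have H0 : 0 <= H by exact: ip_ge0.
have bh := bmeas_ip_kernel k sh.
(* A function [h] of norm 0 cannot be normalized, but all its inner products vanish. *)
move: H0; rewrite le_eqVlt => /predU1P[H0|H0].
  rewrite -H0 mulr0; apply: ex_le_cst; first exact: bmeasX.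
  by move=> x; rewrite (ip_eq0 sh (skx x) (esym H0)) expr0n.
pose c := Num.sqrt H.
have c0 : 0 < c by rewrite sqrtr_gt0.
have cH : c ^+ 2 = H by rewrite sqr_sqrtr// ltW.
pose a x := c^-1 * h x.
have sa : sqint mu a by exact: sqintZ.
have aa : ip mu a a = 1.
  rewrite /a ipZl// ipZr// -/H -cH; field; by rewrite gt_eqF.
have ma : measurable_fun [set: T] a by case: sa.
have ha x : ip mu a (ker k x) = c^-1 * ip mu h (ker k x) by rewrite /a ipZl.
have Ba : B_ker mu (ker k) (fun x => ip mu a (ker k x)).
  exists a; split=> //; first by rewrite normL2E// aa sqrtr1.
  apply/funext => x; apply: eq_Rintegral => z _.
  by rewrite (ker_sym k x z).
have := Upsilon_v ka k; rewrite law_mean_Theta => V.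
have ba := bmeasX 2 (bmeas_ip_kernel k sa).
have : ((\int[P]_x ip mu a (ker k x) ^+ 2)%:E <= v2_ker mu s (ker k))%E.
  rewrite -(law_meanE ms s0 Ps); last by case: ba.
  by apply: ereal_sup_ubound; exists (fun x => ip mu a (ker k x)).
move=> /le_trans /(_ V); rewrite lee_fin => V'.
have -> : \int[P]_x ip mu h (ker k x) ^+ 2 = H * \int[P]_x ip mu a (ker k x) ^+ 2.
  rewrite -exZ//; apply: eq_Rintegral => x _; rewrite ha -cH.
  by field; rewrite gt_eqF.
rewrite mulrC ler_wpM2r ?(ltW H0)//; apply: (le_trans V').
by rewrite ge_max lerDl sqrtr_ge0 lerDr; lra.
Qed.

Definition s_ker_diff k k' : T -> R :=
  fun x => s_ker mu s (ker k) x - s_ker mu s (ker k') x.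

Definition s_ker_dist k k' : R := ip mu (s_ker_diff k k') (s_ker_diff k k').

Lemma sqint_s_ker_diff k k' : sqint mu (s_ker_diff k k').
Proof. by apply: sqintB; exact: sqint_s_ker. Qed.

Lemma s_ker_diff_sup k k' x :
  `|s_ker_diff k k' x| <= Upsilon + Num.sqrt (Upsilon * N) * Num.sqrt (s_ker_dist k k').
Proof.
have [U1 _ _ _ _] := Upsilon_consequences.
have := ub_ereal_sup_range (Upsilon_sup ka k k') x.
rewrite (normL2E (sqint_s_ker_diff k k')) -EFinM -EFin_max lee_fin => /le_trans; apply.
by rewrite ge_max lerDl lerDr mulr_ge0 ?sqrtr_ge0//; lra.
Qed.

End Setting.

Lemma tail_weaken {d : measure_display} {T : measurableType d} {R : realType}
    (Q : probability T R) (Z : T -> R) (w B C : R) (e : \bar R) :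
  bmeas Z -> 0 < w -> w ^+ 2 * B <= C ->
  (Q [set t | (B < Z t ^+ 2)%R] <= e)%E -> (Q [set t | (C < (w * Z t) ^+ 2)%R] <= e)%E.
Proof.
move=> bZ w0 wB; apply: le_trans; apply: le_measure.
- rewrite inE; apply: (measurable_bmeas_gt C (f := fun t => (w * Z t) ^+ 2)).
  by apply: bmeasX; apply: bmeasM => //; exact: bmeas_cst.
- rewrite inE; apply: (measurable_bmeas_gt B (f := fun t => Z t ^+ 2)); exact: bmeasX.
move=> t /= CZ; have := le_lt_trans wB CZ.
by rewrite exprMn ltr_pM2l// exprn_gt0.
Qed.

Lemma finite_union_tail {d : measure_display} {T : measurableType d} {R : realType}
    (Q : probability T R) (I : finType) (B : I -> set T) (e : R) :
  (forall i, measurable (B i)) -> (forall i, Q (B i) <= e%:E)%E ->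
  exists G, [/\ measurable G, ((1 - #|I|%:R * e)%:E <= Q G)%E & forall t, G t -> forall i, ~ B i t].
Proof.
move=> mB QB; pose U (l : seq I) := \big[setU/set0]_(i <- l) B i.
have mU l : measurable (U l) by apply: bigsetU_measurable.
have QU l : (Q (U l) <= ((size l)%:R * e)%:E)%E.
  elim: l => [|i l ih]; first by rewrite /U big_nil measure0 mul0r.
  rewrite /U big_cons -/(U l); apply: (le_trans (measureU2 _ _ _)) => //.
  by rewrite /= -natr1 mulrDl mul1r addrC EFinD leeD.
exists (~` U (enum I)); split.
- exact: measurableC.
- rewrite (probability_setC Q)// EFinB leeB//.
  by apply: (le_trans (QU _)); rewrite -cardE.
move=> t Ut i Bi; apply: Ut; rewrite /U -bigcup_seq.
by exists i => //=; rewrite mem_enum.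
Qed.

(** The constant of [pairsum_tail], times 16 for passing from [g] to its degenerate part, times 2
    for merging the two lower-order terms into [q ^+ 2]. The sums of single points need only
    [3 * (expR 1 * 256)]. *)
Definition dev_const (R : realType) : R := 32 * (expR 1 * (32 * 32 * 32)).

Lemma dev_const_ge (R : realType) : 3 * (expR 1 * 256) <= dev_const R.
Proof.
rewrite /dev_const; have : 0 <= expR 1 :> R by exact: expR_ge0.
by move: (expR 1) => E e0; lra.
Qed.

Section Events.
Context {d d0 : measure_display} {T : measurableType d} {Omega : measurableType d0}
  {R : realType}.
Variables (mu : {measure set T -> \bar R}) (Pr : probability Omega R) (s : T -> R) (n : nat).
Variables (X Y : {RV Pr >-> T}) (Xs : 'I_n -> {RV Pr >-> T}).
Variables (K : finType) (ker : K -> T -> T -> R) (Gamma Upsilon : R).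
Hypothesis n0 : (0 < n)%N.
Hypothesis iid : iid_with_density mu s X Y Xs.
Hypothesis ka : kernel_assumptions mu s n X Y ker Gamma Upsilon.
Variable x : R.
Hypothesis x1 : 1 <= x.

Local Notation P := (distribution Pr X).
Local Notation Q := (iid_law P n).
Local Notation N := (n%:R : R).
Local Notation K0 := (dev_const R).
Local Notation S := (fine (supnorm s)).
Local Notation M := (Gamma * N).
Local Notation c1 := (expR 1 * 256 : R).
Local Notation V k := (mean_Theta mu X ker k).
Local Notation sk k := (s_ker mu s (ker k)).

Let q : R := Upsilon * x ^+ 2 / N.

Let N_neq0 : N != 0. Proof. by rewrite pnatr_eq0 -lt0n. Qed.
Let Ni0 : 0 < N^-1. Proof. by rewrite invr_gt0 ltr0n. Qed.

Let Ups := Upsilon_consequences iid ka.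

Let c1_ge0 : 0 <= c1. Proof. by rewrite mulr_ge0// expR_ge0. Qed.

Let c1_le : 3 * c1 <= K0. Proof. exact: dev_const_ge. Qed.

Let x_ge0 : 0 <= x. Proof. exact: le_trans x1. Qed.

Let x_le : x <= x ^+ 2. Proof. by rewrite expr2 ler_peMl. Qed.

Let x2_le : x ^+ 2 <= x ^+ 4.
Proof. exact: ler_weXn2l. Qed.

Let x3_le : x ^+ 3 <= x ^+ 4.
Proof. exact: ler_weXn2l. Qed.

Lemma bmeas_centered_sum (f : T -> R) : bmeas f -> bmeas (fun t : n.-tuple T => centered_sum P t f).
Proof.
move=> bf; apply: (bmeas_tuple_sum n (f := fun y => f y - \int[P]_z f z)).
by apply: bmeasB => //; exact: bmeas_cst.
Qed.

(** The factor [x] of the variance term is enlarged to [x ^+ 2], so that all deviations are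
    expressed with the same [q]. *)
Lemma sum_event (f : T -> R) (v : R) : bmeas f -> (forall y, `|f y| <= M) -> 0 <= v ->
  \int[P]_y f y ^+ 2 <= Upsilon * N * v ->
  (Q [set t | (K0 * (v / N * q + q ^+ 2) < (N^-1 ^+ 2 * centered_sum P t f) ^+ 2)%R]
    <= (expR (- x))%:E)%E.
Proof.
have [U1 SU GU SGU G1] := Ups; have xx := x1.
move=> bf fM v0 fv.
have M0 : 0 < M by rewrite mulr_gt0 ?ltr0n//; lra.
apply: tail_weaken (bmeas_centered_sum bf) _ _ (sum_tail n bf M0 fM fv x1).
  by rewrite exprn_gt0.
rewrite [leLHS](_ : _ = N^-1 ^+ 2 * (c1 * (x * (Upsilon * v) + x ^+ 2 * Gamma ^+ 2))); last first.
  by field.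
rewrite [leRHS](_ : _ = N^-1 ^+ 2 * (K0 * (x ^+ 2 * (Upsilon * v) + x ^+ 4 * Upsilon ^+ 2))); last first.
  by rewrite /q; field.
have Uv : 0 <= Upsilon * v by rewrite mulr_ge0//; lra.
have GU2 : Gamma ^+ 2 <= Upsilon ^+ 2 by apply: lerXn2r; rewrite ?nnegrE; lra.
rewrite ler_wpM2l ?exprn_ge0 ?(ltW Ni0)//; apply: ler_pM => //.
- by rewrite addr_ge0// mulr_ge0 ?sqr_ge0//; lra.
- have := c1_ge0; have := c1_le; lra.
by apply: lerD; apply: ler_pM; rewrite ?sqr_ge0//; lra.
Qed.

(** The mixed term [x ^+ 3 * Upsilon] and the supremum term [x ^+ 4 * Gamma ^+ 2] are both at most
    [x ^+ 4 * Upsilon ^+ 2], because [1 <= x], [1 <= Upsilon] and [Gamma <= Upsilon]. *)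
Lemma pair_event (g : T -> T -> R) (v : R) : bmeas (fun z : T * T => g z.1 z.2) ->
  (forall y z, g y z = g z y) -> (forall y z, `|g y z| <= M) -> 0 <= v ->
  \int[P]_y \int[P]_z g y z ^+ 2 <= Upsilon * v ->
  (forall y, \int[P]_z g y z ^+ 2 <= Upsilon * N) ->
  (Q [set t | (K0 * (v / N * q + q ^+ 2) < (N^-1 ^+ 2 * pairsum (degenerate P g) t) ^+ 2)%R]
    <= (expR (- x))%:E)%E.
Proof.
have [U1 SU GU SGU G1] := Ups; have xx := x1.
move=> bg gs gM v0 ga gc.
have M0 : 0 < 4 * M by rewrite !mulr_gt0 ?ltr0n//; lra.
have bd := bmeas_degenerate P bg.
apply: tail_weaken (bmeas_pairsum n bd) _ _ (pairsum_tail n bd (degenerate_sym P gs)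
  (degenerate_centered P bg) M0 (degenerate_le P bg gM)
  (degenerate_sup bg gc) (degenerate_variance bg ga) x1).
  by rewrite exprn_gt0.
rewrite [leLHS](_ : _ = N^-1 ^+ 2 * (K0 * (2^-1 * (x ^+ 2 * (Upsilon * v) +
   x ^+ 3 * Upsilon + x ^+ 4 * Gamma ^+ 2)))); last first.
  by rewrite /dev_const; field.
rewrite [leRHS](_ : _ = N^-1 ^+ 2 * (K0 * (x ^+ 2 * (Upsilon * v) + x ^+ 4 * Upsilon ^+ 2))); last first.
  by rewrite /q; field.
have Uv : 0 <= Upsilon * v by rewrite mulr_ge0//; lra.
have GU2 : Gamma ^+ 2 <= Upsilon ^+ 2 by apply: lerXn2r; rewrite ?nnegrE; lra.
have UN : Upsilon <= Upsilon ^+ 2 by rewrite expr2 ler_peMl//; lra.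
have K00 : 0 <= K0 by have := c1_ge0; have := c1_le; lra.
rewrite ler_wpM2l ?exprn_ge0 ?(ltW Ni0)// ler_wpM2l//.
have x0 m : 0 <= x ^+ m by rewrite exprn_ge0//; lra.
have UN0 : 0 <= Upsilon by lra.
have h1 : x ^+ 3 * Upsilon <= x ^+ 4 * Upsilon ^+ 2 by apply: ler_pM.
have h2 : x ^+ 4 * Gamma ^+ 2 <= x ^+ 4 * Upsilon ^+ 2 by rewrite ler_wpM2l.
have h3 : 0 <= x ^+ 2 * (Upsilon * v) by rewrite mulr_ge0.
lra.
Qed.

Lemma sqr_sum_le (a b : R) : (a + b) ^+ 2 <= 2 * a ^+ 2 + 2 * b ^+ 2.
Proof. by have := sqr_ge0 (a - b); rewrite sqrrB sqrrD; lra. Qed.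

Let r k : R := x * Num.sqrt (Upsilon * V k) / N.

Let crossk k := cross mu s (ker k).
Let biask k := bias mu s (ker k).

Let sh k : sqint mu (fun y => sk k y - s y).
Proof.
apply: sqintB; first exact: sqint_s_ker iid ka k.
exact: (sqint_s (density_measurable iid) (density_ge0 iid) (s_le_sup iid) (law_density iid)).
Qed.

Lemma cross_event k :
  (Q [set t | (K0 * (biask k * r k + biask k * q + q ^+ 2) <
     (N^-1 * centered_sum P t (crossk k)) ^+ 2)%R] <= (expR (- x))%:E)%E.
Proof.
have [U1 SU GU SGU G1] := Ups; have xx := x1.
set H := biask k.
have H0 : 0 <= H by exact: ip_ge0.
have M0 : 0 <= M by rewrite mulr_ge0//; lra.
(* The added 1 keeps the bound positive when the bias is 0, as [sum_tail] requires; it costs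
   [(x / N) ^+ 2], which is at most [q ^+ 2]. *)
pose b := Num.sqrt (M * H) + 1.
have b0 : 0 < b by rewrite ltr_wpDl// sqrtr_ge0.
have b2 : b ^+ 2 <= 2 * (M * H) + 2.
  apply: (le_trans (sqr_sum_le _ _)); rewrite sqr_sqrtr ?mulr_ge0//; lra.
have fb y : `|crossk k y| <= b.
  apply: (@le_trans _ _ (Num.sqrt (M * H))); last by rewrite /b lerDl.
  apply: ler_norm_of_sqr; first exact: sqrtr_ge0.
  rewrite sqr_sqrtr; last exact: mulr_ge0.
  exact: (ip_kernel_bound ka k y (sh k)).
have bf : bmeas (crossk k) := bmeas_ip_kernel iid ka k (sh k).
set rho := Num.sqrt (Upsilon * V k).
have rho0 : 0 <= rho by exact: sqrtr_ge0.
have fv : \int[P]_y crossk k y ^+ 2 <= (Upsilon + rho) * H := ip_kernel_variance iid ka k (sh k).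
apply: tail_weaken (bmeas_centered_sum bf) Ni0 _ (sum_tail n bf b0 fb fv x1).
apply: (@le_trans _ _ (N^-1 ^+ 2 * (c1 * (x * (N * ((Upsilon + rho) * H) + x * (2 * (M * H) + 2)))))).
  rewrite ler_wpM2l ?exprn_ge0 ?(ltW Ni0)// -!mulrA ler_wpM2l ?expR_ge0//.
  rewrite ler_wpM2l// ler_wpM2l; [|lra|by rewrite lerD2l ler_wpM2l//; lra].
  by [].
rewrite [leLHS](_ : _ = c1 * (H * (x * rho / N) + H * (x * Upsilon / N) +
   2 * (H * (x ^+ 2 * Gamma / N)) + 2 * (x / N) ^+ 2)); last by field.
have xN : x / N <= q.
  rewrite /q ler_pM2r//; apply: (le_trans x_le).
  by rewrite ler_peMl ?sqr_ge0.
have q1 : x * Upsilon / N <= q.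
  by rewrite /q ler_pM2r// mulrC ler_wpM2l//; lra.
have q2 : x ^+ 2 * Gamma / N <= q.
  by rewrite /q ler_pM2r// mulrC ler_wpM2r ?sqr_ge0.
have x0 : 0 <= x by lra.
have xN0 : 0 <= x / N by rewrite divr_ge0.
have q3 : (x / N) ^+ 2 <= q ^+ 2 by apply: lerXn2r; rewrite ?nnegrE// (le_trans xN0).
have Hr0 : 0 <= H * (x * rho / N) by rewrite mulr_ge0// divr_ge0// mulr_ge0.
have hq1 := ler_wpM2l H0 q1; have hq2 := ler_wpM2l H0 q2.
have q0 : 0 <= q by exact: le_trans xN.
have Hq : 0 <= H * q by rewrite mulr_ge0.
have qq : 0 <= q ^+ 2 by exact: sqr_ge0.
apply: (@le_trans _ _ (3 * c1 * (H * r k + H * q + q ^+ 2))); last first.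
  by rewrite ler_wpM2r// !addr_ge0.
rewrite -(mulrA 3) (mulrCA 3) ler_wpM2l// /r -/rho; lra.
Qed.

(** The supremum of [s_k - s_k'] may grow like [sqrt (Upsilon * N * D)]; its square, multiplied by
    [(x / N) ^+ 2], is exactly [D * q] and joins the variance term. *)
Lemma diff_event k k' :
  (Q [set t | (K0 * (s_ker_dist mu s ker k k' * q + q ^+ 2) <
     (N^-1 * centered_sum P t (s_ker_diff mu s ker k k')) ^+ 2)%R] <= (expR (- x))%:E)%E.
Proof.
have [U1 SU GU SGU G1] := Ups; have xx := x1.
set D := s_ker_dist mu s ker k k'.
have D0 : 0 <= D by exact: ip_ge0.
pose b := Upsilon + Num.sqrt (Upsilon * N) * Num.sqrt D.
have b0 : 0 < b by rewrite ltr_pwDl ?mulr_ge0 ?sqrtr_ge0//; lra.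
have UN0 : 0 <= Upsilon * N by rewrite mulr_ge0//; lra.
have b2 : b ^+ 2 <= 2 * Upsilon ^+ 2 + 2 * (Upsilon * N * D).
  by apply: (le_trans (sqr_sum_le _ _)); rewrite exprMn !sqr_sqrtr.
have fb := s_ker_diff_sup iid ka k k'.
have bf : bmeas (s_ker_diff mu s ker k k').
  apply: bmeasB.
    exact: (bmeas_s_ker (density_measurable iid) (density_ge0 iid) (law_density iid)
     (ker_sym ka k) (ker_measurable ka k) (ker_le ka k)).
  exact: (bmeas_s_ker (density_measurable iid) (density_ge0 iid) (law_density iid)
     (ker_sym ka k') (ker_measurable ka k') (ker_le ka k')).
have fv : \int[P]_y s_ker_diff mu s ker k k' y ^+ 2 <= S * D.
  apply: (ex_le_ip (density_measurable iid) (density_ge0 iid) (s_le_sup iid) (law_density iid)) => //.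
  exact: sqint_s_ker_diff iid ka k k'.
apply: tail_weaken (bmeas_centered_sum bf) Ni0 _ (sum_tail n bf b0 fb fv x1).
have x0 : 0 <= x by lra.
apply: (@le_trans _ _ (N^-1 ^+ 2 * (c1 * (x * (N * (Upsilon * D) + x * (2 * Upsilon ^+ 2 + 2 * (Upsilon * N * D))))))).
  rewrite ler_wpM2l ?exprn_ge0 ?(ltW Ni0)// -!mulrA ler_wpM2l ?expR_ge0//.
  rewrite ler_wpM2l// ler_wpM2l// lerD//; first by rewrite ler_wpM2l// ler_wpM2r.
  by apply: ler_wpM2l => //; apply: (le_trans b2); rewrite -!mulrA.
rewrite [leLHS](_ : _ = c1 * (D * (x * Upsilon / N) + 2 * (x * Upsilon / N) ^+ 2 +
  2 * (D * q))); last by rewrite /q; field.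
have q1 : x * Upsilon / N <= q.
  by rewrite /q ler_pM2r// mulrC ler_wpM2l//; lra.
have xN0 : 0 <= x * Upsilon / N by rewrite divr_ge0// mulr_ge0//; lra.
have q0 : 0 <= q by exact: le_trans q1.
have q3 : (x * Upsilon / N) ^+ 2 <= q ^+ 2 by apply: lerXn2r; rewrite ?nnegrE.
have hq1 := ler_wpM2l D0 q1.
have Dq : 0 <= D * q by rewrite mulr_ge0.
have qq : 0 <= q ^+ 2 by exact: sqr_ge0.
apply: (@le_trans _ _ (3 * c1 * (D * q + q ^+ 2))); last first.
  by rewrite ler_wpM2r// !addr_ge0.
rewrite -(mulrA 3) (mulrCA 3) ler_wpM2l//; lra.
Qed.

End Events.

Lemma ip_sqrB_le {d : measure_display} {T : measurableType d} {R : realType}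
    (mu : {measure set T -> \bar R}) (f g : T -> R) : sqint mu f -> sqint mu g ->
  ip mu (fun x => f x - g x) (fun x => f x - g x) <= 2 * ip mu f f + 2 * ip mu g g.
Proof.
move=> sf sg; rewrite ip_sqrB//.
have := ip_ge0 mu (fun x => f x + g x).
rewrite ipDl ?ipDr//; try exact: sqintD.
by rewrite (ipC mu g f); lra.
Qed.

Section GoodEvent.
Context {d d0 : measure_display} {T : measurableType d} {Omega : measurableType d0}
  {R : realType}.
Variables (mu : {measure set T -> \bar R}) (Pr : probability Omega R) (s : T -> R) (n : nat).
Variables (X Y : {RV Pr >-> T}) (Xs : 'I_n -> {RV Pr >-> T}).
Variables (K : finType) (ker : K -> T -> T -> R) (Gamma Upsilon : R).
Hypothesis n0 : (0 < n)%N.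
Hypothesis iid : iid_with_density mu s X Y Xs.
Hypothesis ka : kernel_assumptions mu s n X Y ker Gamma Upsilon.
Variable x : R.
Hypothesis x1 : 1 <= x.

Local Notation P := (distribution Pr X).
Local Notation Q := (iid_law P n).
Local Notation N := (n%:R : R).
Local Notation K0 := (dev_const R).
Local Notation q := (Upsilon * x ^+ 2 / N).
Local Notation V k := (mean_Theta mu X ker k).
Local Notation sk k := (s_ker mu s (ker k)).
Local Notation r k := (x * Num.sqrt (Upsilon * V k) / N).
Local Notation b k := (bias mu s (ker k)).

Let ms := density_measurable iid.
Let s0 := density_ge0 iid.
Let Ps : forall B, measurable B -> P B = (\int[mu]_(x in B) (s x)%:E)%E := law_density iid.

(** No bound mentions [theta] or [e]; these are chosen only after the sample is fixed. *)
Record good_sample (t : n.-tuple T) : Prop := GoodSample {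
  good_chi : forall k, (N^-1 ^+ 2 * centered_sum P t (chi_ker (ker k))) ^+ 2 <=
    K0 * (V k / N * q + q ^+ 2) ;
  good_Theta : forall k, (N^-1 ^+ 2 * centered_sum P t (Theta_ker mu (ker k))) ^+ 2 <=
    K0 * (V k / N * q + q ^+ 2) ;
  good_ker : forall k, (N^-1 ^+ 2 * pairsum (degenerate P (ker k)) t) ^+ 2 <=
    K0 * (V k / N * q + q ^+ 2) ;
  good_A : forall k, (N^-1 ^+ 2 * pairsum (degenerate P (A_ker mu (ker k))) t) ^+ 2 <=
    K0 * (V k / N * q + q ^+ 2) ;
  good_cross : forall k, (N^-1 * centered_sum P t (cross mu s (ker k))) ^+ 2 <=
    K0 * (b k * r k + b k * q + q ^+ 2) ;
  good_diff : forall k k', (N^-1 * centered_sum P t (s_ker_diff mu s ker k k')) ^+ 2 <=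
    K0 * (s_ker_dist mu s ker k k' * q + q ^+ 2) }.

Let bTheta k : bmeas (Theta_ker mu (ker k)).
Proof.
exact: (bmeas_Theta (ker_sym ka k) (ker_measurable ka k) (ker_le ka k) (ker_sqr_le ka k)
  (A_measurable ka k)).
Qed.

Let bA k : bmeas (fun z : T * T => A_ker mu (ker k) z.1 z.2).
Proof.
exact: (bmeas_A (ker_sym ka k) (ker_measurable ka k) (ker_le ka k) (ker_sqr_le ka k)
  (A_measurable ka k)).
Qed.

Let bchi k : bmeas (chi_ker (ker k)) := bmeas_chi (ker_measurable ka k) (ker_le ka k).

Let bker k : bmeas (fun z : T * T => ker k z.1 z.2) := bmeas_ker (ker_measurable ka k) (ker_le ka k).

Let bsk k : bmeas (sk k) :=
  bmeas_s_ker ms s0 Ps (ker_sym ka k) (ker_measurable ka k) (ker_le ka k).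

Let ssk k : sqint mu (sk k) := sqint_s_ker iid ka k.

Let ss : sqint mu s := sqint_s ms s0 (s_le_sup iid) Ps.

Let ssks k : sqint mu (fun y => sk k y - s y). Proof. exact: sqintB. Qed.

Let bcross k : bmeas (cross mu s (ker k)). Proof. exact: (bmeas_ip_kernel iid ka k (ssks k)). Qed.

Let V0 k : 0 <= V k. Proof. by have /andP[] := mean_Theta_bounds ka k. Qed.

Let Theta_var k : \int[P]_y Theta_ker mu (ker k) y ^+ 2 <= Upsilon * N * V k.
Proof.
have [U1 SU GU SGU G1] := Upsilon_consequences iid ka.
apply: (@le_trans _ _ (Gamma * N * V k)); last first.
  by rewrite ler_wpM2r// ler_wpM2r.
rewrite -exZ//; apply: ex_le; [exact: bmeasX|by apply: bmeasM => //; exact: bmeas_cst|].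
move=> y; have /andP[t0 tM] :=
  Theta_bounds (ker_sym ka k) (ker_measurable ka k) (ker_le ka k) (ker_sqr_le ka k) y.
by rewrite expr2 ler_wpM2r.
Qed.

Let ker_var k : \int[P]_u \int[P]_v ker k u v ^+ 2 <= Upsilon * V k.
Proof.
have [U1 SU GU SGU G1] := Upsilon_consequences iid ka.
by apply: (le_trans (ker_variance iid ka k)); rewrite ler_wpM2r.
Qed.

Let ker_sup' k u : \int[P]_v ker k u v ^+ 2 <= Upsilon * N.
Proof.
have [U1 SU GU SGU G1] := Upsilon_consequences iid ka.
by apply: (le_trans (ker_sup iid ka k u)); rewrite mulrA ler_wpM2r.
Qed.

(** Five families over kernels and one over pairs of kernels, hence [5 * #|K| + #|K| ^ 2], at most
    [6 * #|K| ^ 2], events. *)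
Definition event_index : finType := (K + K + K + K + K + K * K)%type.

Definition bad_event (i : event_index) : set (n.-tuple T) :=
  match i with
  | inl (inl (inl (inl (inl k)))) => [set t |
      K0 * (V k / N * q + q ^+ 2) < (N^-1 ^+ 2 * centered_sum P t (chi_ker (ker k))) ^+ 2]
  | inl (inl (inl (inl (inr k)))) => [set t |
      K0 * (V k / N * q + q ^+ 2) < (N^-1 ^+ 2 * centered_sum P t (Theta_ker mu (ker k))) ^+ 2]
  | inl (inl (inl (inr k))) => [set t |
      K0 * (V k / N * q + q ^+ 2) < (N^-1 ^+ 2 * pairsum (degenerate P (ker k)) t) ^+ 2]
  | inl (inl (inr k)) => [set t |
      K0 * (V k / N * q + q ^+ 2) < (N^-1 ^+ 2 * pairsum (degenerate P (A_ker mu (ker k))) t) ^+ 2]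
  | inl (inr k) => [set t |
      K0 * (b k * r k + b k * q + q ^+ 2) < (N^-1 * centered_sum P t (cross mu s (ker k))) ^+ 2]
  | inr (k, k') => [set t |
      K0 * (s_ker_dist mu s ker k k' * q + q ^+ 2) <
        (N^-1 * centered_sum P t (s_ker_diff mu s ker k k')) ^+ 2]
  end.

Lemma measurable_bad_event i : measurable (bad_event i).
Proof.
have cs w (f : T -> R) : bmeas f -> bmeas (fun t : n.-tuple T => (w * centered_sum P t f) ^+ 2).
  by move=> bf; apply: bmeasX; apply: bmeasM; [exact: bmeas_cst|exact: bmeas_centered_sum].
have ps w (g : T -> T -> R) : bmeas (fun z : T * T => g z.1 z.2) ->
    bmeas (fun t : n.-tuple T => (w * pairsum (degenerate P g) t) ^+ 2).
  move=> bg; apply: bmeasX; apply: bmeasM; first exact: bmeas_cst.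
  by apply: bmeas_pairsum; exact: bmeas_degenerate.
case: i => [[[[[k|k]|k]|k]|k]|[k k']] /=.
- exact: (measurable_bmeas_gt _ (cs _ _ (bchi k))).
- exact: (measurable_bmeas_gt _ (cs _ _ (bTheta k))).
- exact: (measurable_bmeas_gt _ (ps _ _ (bker k))).
- exact: (measurable_bmeas_gt _ (ps _ _ (bA k))).
- exact: (measurable_bmeas_gt _ (cs _ _ (bcross k))).
- exact: (measurable_bmeas_gt _ (cs _ _ (bmeasB (bsk k) (bsk k')))).
Qed.

Lemma bad_event_small i : (Q (bad_event i) <= (expR (- x))%:E)%E.
Proof.
case: i => [[[[[k|k]|k]|k]|k]|[k k']] /=.
- apply: (sum_event n0 iid ka x1 (bchi k)) => //.
    by move=> y; exact: (ker_le ka k y y).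
  exact: (chi_variance iid ka k).
- apply: (sum_event n0 iid ka x1 (bTheta k)) => //.
  move=> y; have /andP[t0 tM] :=
    Theta_bounds (ker_sym ka k) (ker_measurable ka k) (ker_le ka k) (ker_sqr_le ka k) y.
  by rewrite ger0_norm.
- apply: (pair_event n0 iid ka x1 (bker k)) => //.
    by move=> y z; exact: (ker_sym ka k).
  by move=> y z; exact: (ker_le ka k).
- apply: (pair_event n0 iid ka x1 (bA k)) => //.
  + by move=> y z; exact: (A_sym mu (ker_sym ka k)).
  + exact: (A_le (ker_sym ka k) (ker_measurable ka k) (ker_le ka k) (ker_sqr_le ka k)).
  + exact: (A_variance iid ka k).
  + by move=> y; exact: (A_sup ka k).
- exact: (cross_event n0 iid ka x1 k).
- exact: (diff_event n0 iid ka x1 k k').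
Qed.

Lemma good_event : exists G : set (n.-tuple T), [/\ measurable G,
  ((1 - 6 * #|K|%:R ^+ 2 * expR (- x))%:E <= Q G)%E & forall t, G t -> good_sample t].
Proof.
have [G [mG QG GB]] := finite_union_tail measurable_bad_event bad_event_small.
exists G; split=> //.
  apply: le_trans QG; rewrite lee_fin lerD2l lerN2 ler_wpM2r ?expR_ge0//.
  rewrite !card_sum card_prod !natrD natrM.
  have : #|K|%:R <= #|K|%:R ^+ 2 :> R by rewrite expr2 -natrM ler_nat; case: #|K| => // m; rewrite leq_pmull.
  lra.
move=> t Gt; have B := GB t Gt.
split=> [k|k|k|k|k|k k'].
- by have /negP := B (inl (inl (inl (inl (inl k))))); rewrite -leNgt.
- by have /negP := B (inl (inl (inl (inl (inr k))))); rewrite -leNgt.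
- by have /negP := B (inl (inl (inl (inr k)))); rewrite -leNgt.
- by have /negP := B (inl (inl (inr k))); rewrite -leNgt.
- by have /negP := B (inl (inr k)); rewrite -leNgt.
- by have /negP := B (inr (k, k')); rewrite -leNgt.
Qed.

Let N_ge1 : 1 <= N. Proof. by rewrite ler1n. Qed.
Let N_gt0 : 0 < N. Proof. by rewrite ltr0n. Qed.
Let Ni0 : 0 < N^-1. Proof. by rewrite invr_gt0. Qed.
Let K0_ge1 : 1 <= K0.
Proof.
have := dev_const_ge R; have : 1 <= expR 1 :> R by rewrite -[leLHS]expR0 ler_expR.
by lra.
Qed.

Let U_N_le_q : Upsilon / N <= q.
Proof.
have [U1 SU GU SGU G1] := Upsilon_consequences iid ka.
rewrite ler_pM2r// ler_peMr//; first by lra.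
by rewrite exprn_ege1.
Qed.

Let q_ge0 : 0 <= q.
Proof.
have [U1 SU GU SGU G1] := Upsilon_consequences iid ka.
by apply: le_trans U_N_le_q; rewrite divr_ge0//; lra.
Qed.

Lemma good_loss_bracket t k e : good_sample t -> 0 < e <= 1 ->
  `|sample_loss mu s (ker k) t - b k - V k / N| <=
  6 * e * (b k + V k / N) + 7 * K0 ^+ 2 * q / e ^+ 3.
Proof.
move=> gt he; have /andP[e0 e1] := he.
have [U1 SU GU SGU G1] := Upsilon_consequences iid ka.
have p0 : 0 <= V k / N by rewrite divr_ge0.
have b0 : 0 <= b k by exact: ip_ge0.
have h2 := deviation_amgm he K0_ge1 p0 q_ge0 (good_Theta gt k).
have h4 := deviation_amgm he K0_ge1 p0 q_ge0 (good_A gt k).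
have r0 : 0 <= r k by rewrite divr_ge0// mulr_ge0 ?sqrtr_ge0// (le_trans _ x1).
have r2 : r k ^+ 2 = V k / N * q.
  rewrite expr_div_n exprMn sqr_sqrtr; last by rewrite mulr_ge0//; lra.
  by field; rewrite gt_eqF.
have h5 := deviation_amgm3 he K0_ge1 b0 p0 q_ge0 r0 r2 (good_cross gt k).
have kk := ip_s_ker_le iid ka k.
set kk' := ip mu (sk k) (sk k) in kk.
have kk0 : 0 <= kk' by exact: ip_ge0.
pose sa := N^-1 ^+ 2 * (\sum_(y <- t) ip mu (sk k) (ker k y)).
have ET : N^-1 ^+ 2 * (\sum_(y <- t) Theta_ker mu (ker k) y) =
    N^-1 ^+ 2 * centered_sum P t (Theta_ker mu (ker k)) + V k / N.
  by rewrite centered_sumE /mean_Theta; field; rewrite gt_eqF.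
apply: (loss_bracket (sa := sa) (kk := N^-1 * kk') he K0_ge1 b0 p0 _ _ _ h2 h4 h5).
- rewrite mulr_ge0 ?(ltW Ni0)//=; apply: le_trans U_N_le_q.
  by rewrite mulrC ler_wpM2r// ltW.
- rewrite (loss_decomposition ms s0 (s_le_sup iid) Ps (ker_sym ka k) (ker_measurable ka k)
    (ker_le ka k) (ker_sqr_le ka k) (ssk k) t n0) -ET /sa /kk'.
  by ring.
rewrite -ET /sa normrM ger0_norm ?exprn_ge0 ?(ltW Ni0)//.
(* Pointwise Cauchy-Schwarz and arithmetic-geometric mean inequality: [2 * |<s_k, k y>|] is at most
   [e * Theta_k y + |s_k|^2 / e], so no deviation bound is used for this sum. *)
apply: (@le_trans _ _ (N^-1 ^+ 2 * \sum_(y <- t) (e * Theta_ker mu (ker k) y + kk' / e))).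
  rewrite mulrCA ler_wpM2l ?exprn_ge0 ?(ltW Ni0)//.
  apply: (le_trans (ler_wpM2l _ (ler_norm_sum _ _ _)))=> //.
  rewrite mulr_sumr; apply: ler_sum => y _.
  have /andP[t0 _] :=
    Theta_bounds (ker_sym ka k) (ker_measurable ka k) (ker_le ka k) (ker_sqr_le ka k) y.
  have := ip_ker_le (ker_sym ka k) (ker_measurable ka k) (ker_le ka k) (ker_sqr_le ka k) y (ssk k).
  rewrite -/kk' => H.
  have et : 0 <= e * Theta_ker mu (ker k) y by rewrite mulr_ge0// ltW.
  have ke : 0 <= kk' / e by rewrite divr_ge0// ltW.
  have -> : 2 * `|ip mu (sk k) (ker k y)| = `|2 * ip mu (sk k) (ker k y)|.
    by rewrite normrM (@ger0_norm _ 2).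
  apply: ler_norm_of_sqr; first exact: addr_ge0.
  rewrite exprMn; apply: (@le_trans _ _ (4 * (kk' * Theta_ker mu (ker k) y))).
    have -> : 2 ^+ 2 = 4 :> R by ring.
    by rewrite ler_wpM2l.
  have -> : 4 * (kk' * Theta_ker mu (ker k) y) =
     4 * ((e * Theta_ker mu (ker k) y) * (kk' / e)) by field; rewrite gt_eqF.
  exact: mul_le_sqrD.
rewrite big_split /= -mulr_sumr big_const_seq count_predT size_tuple iter_addr addr0.
rewrite -[kk' / e *+ n]mulr_natl le_eqVlt; apply/orP; left; apply/eqP.
by field; rewrite !gt_eqF.
Qed.

(** By Jensen and the bound [S] on the density, the square of the mean is at most [S] times the
    squared norm of [s_k], and both are at most [Upsilon]. *)
Let mean_s_ker_le k : `|\int[P]_y sk k y| <= Upsilon.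
Proof.
have [U1 SU GU SGU G1] := Upsilon_consequences iid ka.
apply: ler_norm_of_sqr; first lra.
apply: (le_trans (ex_sqr_le P (bsk k))).
apply: (le_trans (ex_le_ip ms s0 (s_le_sup iid) Ps (bsk k) (ssk k))).
have kk := ip_s_ker_le iid ka k; have S0 := S_ge0 iid.
by rewrite expr2; apply: ler_pM => //; exact: ip_ge0.
Qed.

Lemma good_fluctuation t k k' e : good_sample t -> 0 < e <= 1 ->
  `|fluctuation mu P s (ker k) t - fluctuation mu P s (ker k') t| <=
  2 * e * (b k + V k / N + (b k' + V k' / N)) + 7 * K0 * q / e.
Proof.
move=> gt he; have /andP[e0 e1] := he.
have [U1 SU GU SGU G1] := Upsilon_consequences iid ka.
have p0 j : 0 <= V j / N by rewrite divr_ge0.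
have b0 j : 0 <= b j by exact: ip_ge0.
have h1 j := deviation_amgm he K0_ge1 (p0 j) q_ge0 (good_chi gt j).
have h3 j := deviation_amgm he K0_ge1 (p0 j) q_ge0 (good_ker gt j).
have D0 : 0 <= s_ker_dist mu s ker k k' by exact: ip_ge0.
have h6 := deviation_amgm he K0_ge1 D0 q_ge0 (good_diff gt k k').
(* [s_k - s_k'] is the difference of [s_k - s] and [s_k' - s]. *)
have D2 : s_ker_dist mu s ker k k' <= 2 * b k + 2 * b k'.
  apply: le_trans (ip_sqrB_le (ssks k) (ssks k')).
  rewrite le_eqVlt; apply/orP; left; apply/eqP; rewrite /s_ker_dist /s_ker_diff.
  by congr ip; apply/funext => y; ring.
have cd : centered_sum P t (s_ker_diff mu s ker k k') =
    centered_sum P t (sk k) - centered_sum P t (sk k').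
  by rewrite !centered_sumE /s_ker_diff exB// sumrB; ring.
have m1 := mean_s_ker_le k; have m2 := mean_s_ker_le k'.
have nm j : `|N^-1 * \int[P]_y sk j y| <= q.
  rewrite normrM (gtr0_norm Ni0); apply: le_trans U_N_le_q.
  by rewrite [leRHS]mulrC ler_wpM2l ?mean_s_ker_le// ltW.
have qe : q <= K0 * q / e.
  rewrite ler_pdivlMr//; apply: (@le_trans _ _ q); first by rewrite ler_piMr.
  by rewrite ler_peMl.
have E : fluctuation mu P s (ker k) t - fluctuation mu P s (ker k') t =
  N^-1 ^+ 2 * centered_sum P t (chi_ker (ker k)) - N^-1 ^+ 2 * centered_sum P t (chi_ker (ker k'))
  + (N^-1 ^+ 2 * pairsum (degenerate P (ker k)) t - N^-1 ^+ 2 * pairsum (degenerate P (ker k')) t)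
  + (1 - 2 / N) * (N^-1 * centered_sum P t (s_ker_diff mu s ker k k'))
  - (N^-1 * \int[P]_y sk k y - N^-1 * \int[P]_y sk k' y).
  rewrite cd /fluctuation.
  move: (centered_sum _ _ _) (centered_sum _ _ _) (centered_sum _ _ _) (centered_sum _ _ _)
    (pairsum _ _) (pairsum _ _) (\int[P]_y _) (\int[P]_y _) => u1 u2 u3 u4 u5 u6 u7 u8.
  by ring.
rewrite E -[7 * K0 * q]mulrA -[7 * (K0 * q) / e]mulrA.
apply: fluctuation_bracket D2 (h1 k) (h1 k') (h3 k) (h3 k') h6 _ _ => //.
- exact: norm_one_sub_le.
- exact: le_trans (nm k) qe.
- exact: le_trans (nm k') qe.
Qed.

End GoodEvent.

(** * The oracle inequalities *)

Section OracleReal.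
Context {R : realType}.
Local Notation K0 := (dev_const R).

(** The remainder of the loss bracket at [e = 1 / 12], where the loss is within half of the risk. *)
Definition bracket_const : R := 7 * K0 ^+ 2 * 12 ^+ 3.

(** The first two terms collect the remainders in [first_oracle_bound]; the 6 makes the constant
    also dominate the count of bad events. *)
Definition oracle_const : R := 8 * bracket_const + 28 * K0 + 6.

(** As above at [e = theta / 24], with [theta ^+ 3] taken out. *)
Definition second_bracket_const : R := 7 * K0 ^+ 2 * 24 ^+ 3.

Lemma dev_const_gt0 : 0 < K0.
Proof. by rewrite /dev_const !mulr_gt0// expR_gt0. Qed.

Lemma bracket_const_ge0 : 0 <= bracket_const.
Proof. by rewrite /bracket_const !mulr_ge0// sqr_ge0. Qed.

Lemma second_bracket_const_ge0 : 0 <= second_bracket_const.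
Proof. by rewrite /second_bracket_const !mulr_ge0// sqr_ge0. Qed.

Lemma oracle_const_ge6 : 6 <= oracle_const.
Proof.
have := dev_const_gt0; have := bracket_const_ge0; rewrite /oracle_const; lra.
Qed.

(** The bracket at [e = 1 / 12] gives [u <= 2 * L] up to a remainder, and likewise for [u']. The
    fluctuation at [e = th / 2] then costs [2 * th * (u + u')], at most [4 * th * (L + L')] up to a
    remainder. *)
Lemma first_oracle_bound (L L' u u' F F' a a' q th : R) :
  0 < th < 1 -> 0 <= q -> 0 <= u -> 0 <= u' ->
  (forall e : R, 0 < e <= 1 -> `|L - u| <= 6 * e * u + 7 * K0 ^+ 2 * q / e ^+ 3) ->
  (forall e : R, 0 < e <= 1 -> `|L' - u'| <= 6 * e * u' + 7 * K0 ^+ 2 * q / e ^+ 3) ->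
  (forall e : R, 0 < e <= 1 -> `|F' - F| <= 2 * e * (u' + u) + 7 * K0 * q / e) ->
  L' - 2 * F' + a' <= L - 2 * F + a ->
  (1 - 4 * th) * L' <= (1 + 4 * th) * L + (a - a' + oracle_const * (q / th)).
Proof.
move=> /andP[t0 t1] q0 u0 u0' HL HL' HF crit.
have i12 : 0 < 12^-1 :> R by [].
have j : 0 < (12^-1 : R) <= 1 by rewrite i12 invf_le1// ler1n.
have E : 7 * K0 ^+ 2 * q / 12^-1 ^+ 3 = bracket_const * q.
  by rewrite /bracket_const; field.
have := HL _ j; have := HL' _ j; rewrite E ler_norml => /andP[b1 _].
rewrite ler_norml => /andP[b2 _].
have h : 0 < th / 2 <= 1 by apply/andP; split; lra.
have := HF _ h; rewrite ler_norml => /andP[_ f1].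
have KQ : 7 * K0 * q / (th / 2) = 14 * K0 * (q / th) by field; rewrite gt_eqF.
rewrite KQ in f1.
have bq : bracket_const * q <= bracket_const * (q / th).
  by rewrite ler_wpM2l ?bracket_const_ge0// ler_pdivlMr// ler_piMr// ltW.
have Kq : 0 <= K0 * (q / th).
  by rewrite mulr_ge0 ?(ltW dev_const_gt0)// divr_ge0// ltW.
have qt : 0 <= q / th by rewrite divr_ge0// ltW.
have B0 := bracket_const_ge0.
have bq0 : 0 <= bracket_const * q by rewrite mulr_ge0.
have uL : u <= 2 * L + 2 * (bracket_const * q) by lra.
have uL' : u' <= 2 * L' + 2 * (bracket_const * q) by lra.
have tu : th * (u' + u) <= th * (2 * L + 2 * L' + 4 * (bracket_const * q)).
  by rewrite ler_wpM2l ?(ltW t0)//; lra.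
have tb : th * (bracket_const * q) <= bracket_const * q by rewrite ler_piMl// ltW.
have e1 : 2 * (th / 2) * (u' + u) = th * (u' + u) by field.
rewrite e1 in f1.
have -> : (1 - 4 * th) * L' = L' - 4 * (th * L') by ring.
have -> : (1 + 4 * th) * L = L + 4 * (th * L) by ring.
have -> : oracle_const * (q / th) = 8 * (bracket_const * (q / th)) + 28 * (K0 * (q / th)) + 6 * (q / th).
  by rewrite /oracle_const; ring.
have e2 : th * (2 * L + 2 * L' + 4 * (bracket_const * q)) =
   2 * (th * L) + 2 * (th * L') + 4 * (th * (bracket_const * q)) by ring.
rewrite e2 in tu; rewrite -mulrA in f1.
move: (th * L) (th * L') (th * (bracket_const * q)) (th * (u' + u)) (bracket_const * q)
  (bracket_const * (q / th)) (K0 * (q / th)) tb tu f1 bq Kq bq0 => x1 x2 x3 x4 x5 x6 x7.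
move: (q / th) qt crit {HL HL' HF E KQ b1 b2 B0 e1 e2 uL uL' i12 j h} => x8.
by lra.
Qed.

(** The penalty terms are absorbed into the risks [u] and [u'], and these into the losses up to the
    factor [1 + th / 2], which needs the bracket at [e] of order [th]. The numerator on the left may
    be negative; only the denominator is divided by. *)
Lemma second_oracle_bound (L L' u u' p p' a a' q th de de' rho : R) :
  0 < th < 1 -> 0 <= q -> 0 <= p <= u -> 0 <= p' <= u' -> 0 <= L -> 0 <= L' ->
  0 < de -> de <= de' -> 0 <= rho ->
  (forall e : R, 0 < e <= 1 -> `|L - u| <= 6 * e * u + 7 * K0 ^+ 2 * q / e ^+ 3) ->
  (forall e : R, 0 < e <= 1 -> `|L' - u'| <= 6 * e * u' + 7 * K0 ^+ 2 * q / e ^+ 3) ->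
  (forall e : R, 0 < e < 1 ->
    (1 - 4 * e) * L' <= (1 + 4 * e) * L + (a - a' + oracle_const * (q / e))) ->
  a <= (de' - 1) * p + rho -> (de - 1) * p' - rho <= a' ->
  (Num.min de 1 - 5 * th) / (Num.max de' 1 + (4 + de') * th) * L' <=
  L + (2 * second_bracket_const + 4 * oracle_const) * (q / th ^+ 3) + 2 * rho.
Proof.
move=> /andP[t0 t1] q0 /andP[p0 pu] /andP[p0' pu'] L0 L0' d0 dd r0 HL HL' H1 Ha Ha'.
set W := second_bracket_const * (q / th ^+ 3).
have th3 : 0 < th ^+ 3 by exact: exprn_gt0.
have Q3 : 0 <= q / th ^+ 3 by rewrite divr_ge0// ltW.
have W0 : 0 <= W by rewrite mulr_ge0// second_bracket_const_ge0.
have j : 0 < th / 24 <= 1 by apply/andP; split; lra.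
have E : 7 * K0 ^+ 2 * q / (th / 24) ^+ 3 = W.
  by rewrite /W /second_bracket_const; field; rewrite gt_eqF.
(* At [e = th / 24] the bracket reads [(1 - th / 4) * v <= z + W], and [(1 + th / 2) * (1 - th / 4)]
   is at least 1 for [th] in (0, 1). *)
have uW z v : 0 <= v -> `|z - v| <= 6 * (th / 24) * v + W -> v <= (1 + th / 2) * (z + W).
  move=> v0; rewrite ler_norml => /andP[h _].
  have h' : (1 - th / 4) * v <= z + W by lra.
  have := ler_wpM2l (_ : 0 <= 1 + th / 2) h'.
  move=> /(_ ltac:(lra)); apply: le_trans.
  rewrite mulrA ler_peMl//.
  have -> : (1 + th / 2) * (1 - th / 4) = 1 + th * (2 - th) / 8 by field.
  by rewrite lerDl divr_ge0// mulr_ge0//; lra.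
have u0 : 0 <= u by lra.
have u0' : 0 <= u' by lra.
have hu : u <= (1 + th / 2) * (L + W) by apply: uW => //; rewrite -E; exact: HL.
have hu' : u' <= (1 + th / 2) * (L' + W) by apply: uW => //; rewrite -E; exact: HL'.
pose D := Num.max de' 1 - 1; pose c := 1 - Num.min de 1.
have D0 : 0 <= D by rewrite /D subr_ge0 le_max lexx orbT.
have Dd : D <= de' by rewrite /D lerBlDr ge_max; apply/andP; split; lra.
have c0 : 0 <= c by rewrite /c subr_ge0 ge_min lexx orbT.
have c1 : c <= 1 by rewrite /c gerBl le_min ltW//= ler01.
have ha : a <= D * u + rho.
  apply: (le_trans Ha); rewrite lerD2r; apply: (@le_trans _ _ (D * p)).
    by rewrite ler_wpM2r// /D lerB// le_max lexx.
  by rewrite ler_wpM2l.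
have ha' : - a' <= c * u' + rho.
  have : (1 - de) * p' <= c * u'.
    apply: (@le_trans _ _ (c * p')).
      by rewrite ler_wpM2r// /c lerB// ge_min lexx.
    by rewrite ler_wpM2l.
  by lra.
(* At [th / 4] the first inequality has coefficients [1 - th] and [1 + th], which leaves room for
   the terms in [th] coming from the risks. *)
have t4 : 0 < th / 4 < 1 by apply/andP; split; lra.
have := H1 _ t4.
set Z := oracle_const * (q / (th / 4)).
have ZW : Z <= 4 * oracle_const * (q / th ^+ 3).
  have O0 : 0 <= oracle_const by have := oracle_const_ge6; lra.
  have -> : Z = 4 * oracle_const * (q / th) by rewrite /Z; field; rewrite gt_eqF.
  rewrite ler_wpM2l ?mulr_ge0// ler_wpM2l// lef_pV2 ?posrE//.
  by rewrite exprS ler_piMr ?(ltW t0)// expr_le1// ltW.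
move=> H.
have hDu := ler_wpM2l D0 hu; have hcu := ler_wpM2l c0 hu'.
have -> : Num.max de' 1 = 1 + D by rewrite /D; ring.
have -> : Num.min de 1 = 1 - c by rewrite /c; ring.
have d'0 : 0 <= de' by lra.
have thd : 0 <= (4 + de') * th by rewrite mulr_ge0//; lra.
set den := 1 + D + (4 + de') * th.
have den0 : 0 < den by rewrite /den; lra.
have main : (1 - c - 5 * th) * L' <= den * L + (2 * (1 + D) * W + 2 * rho + Z).
  have k1 : 0 <= (1 - c) * th * L' by rewrite !mulr_ge0//; lra.
  have k2 : 0 <= th * L' by rewrite mulr_ge0// ltW.
  have k3 : 0 <= th * L by rewrite mulr_ge0// ltW.
  have k4 : D * (th * L) <= de' * (th * L) by rewrite ler_wpM2r.
  have k5 : D * (th * W) <= D * W by rewrite ler_wpM2l// ler_piMl// ltW.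
  have k6 : c * (th * W) <= W.
    by rewrite mulrA ler_piMl// mulr_ile1// ltW.
  have k7 : c * W <= W by rewrite ler_piMl.
  have e1 : D * ((1 + th / 2) * (L + W)) = D * L + D * W + D * (th * L) / 2 + D * (th * W) / 2 by field.
  have e2 : c * ((1 + th / 2) * (L' + W)) = c * L' + c * W + (th * L' - (1 - c) * th * L') / 2 + c * (th * W) / 2 by field.
  have e3 : den * L = L + D * L + 4 * (th * L) + de' * (th * L) by rewrite /den; ring.
  have e4 : (1 - c - 5 * th) * L' = L' - c * L' - 5 * (th * L') by ring.
  have e5 : 2 * (1 + D) * W = 2 * W + 2 * (D * W) by ring.
  have e6 : (1 - 4 * (th / 4)) * L' = L' - th * L' by field.
  have e7 : (1 + 4 * (th / 4)) * L = L + th * L by field.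
  have k8 : 0 <= D * W by rewrite mulr_ge0.
  have k9 : D * (th * L) / 2 <= de' * (th * L).
    by have : 0 <= D * (th * L) by [rewrite mulr_ge0]; lra.
  rewrite e1 in hDu; rewrite e2 in hcu; rewrite e6 e7 in H; rewrite e3 e4 e5.
  move: (D * L) (D * W) (D * (th * L)) (D * (th * W)) (c * L') (c * W) ((1 - c) * th * L')
    (c * (th * W)) (th * L) (th * L') hDu hcu H k1 k2 k3 k4 k5 k6 k7 k8 k9 => *.
  by lra.
(* The remainder must survive division by [den]: this uses [1 + D <= den], so that the final
   constant is free of [de']. *)
have rest : 2 * (1 + D) * W + 2 * rho + Z <= den * (2 * W + 2 * rho + Z).
  have Z0 : 0 <= Z.
    rewrite /Z mulr_ge0//; first by have := oracle_const_ge6; lra.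
    by rewrite divr_ge0// ltW//; lra.
  have h1 : 1 + D <= den by rewrite /den lerDl.
  have h2 : 2 * (1 + D) * W <= den * (2 * W).
    by rewrite [leLHS](_ : _ = (1 + D) * (2 * W)); [rewrite ler_wpM2r// mulr_ge0|ring].
  have h3 : 2 * rho + Z <= den * (2 * rho + Z).
    by rewrite ler_peMl//; lra.
  rewrite [leRHS](_ : _ = den * (2 * W) + den * (2 * rho + Z)); last by ring.
  lra.
have -> : (1 - c - 5 * th) / den * L' = den^-1 * ((1 - c - 5 * th) * L') by ring.
rewrite ler_pdivrMl//.
apply: (le_trans main).
rewrite -[X in _ <= den * X]addrA [leRHS]mulrDr lerD2l.
apply: (le_trans rest); rewrite ler_wpM2l ?(ltW den0)//.
have -> : (2 * second_bracket_const + 4 * oracle_const) * (q / th ^+ 3) = 2 * W + 4 * oracle_const * (q / th ^+ 3).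
  by rewrite /W; ring.
lra.
Qed.

End OracleReal.

Section OracleInequality.
Context {d d0 : measure_display} {T : measurableType d} {Omega : measurableType d0}
  {R : realType}.
Variables (mu : {measure set T -> \bar R}) (Pr : probability Omega R) (s : T -> R) (n : nat).
Variables (X Y : {RV Pr >-> T}) (Xs : 'I_n -> {RV Pr >-> T}).
Variables (K : finType) (ker : K -> T -> T -> R) (Gamma Upsilon : R).
Variable pen : Omega -> K -> R.
Hypothesis n0 : (0 < n)%N.
Hypothesis iid : iid_with_density mu s X Y Xs.
Hypothesis ka : kernel_assumptions mu s n X Y ker Gamma Upsilon.

Local Notation P := (distribution Pr X).
Local Notation N := (n%:R : R).

Let ms := density_measurable iid.
Let s0 := density_ge0 iid.
Let Ps : forall B, measurable B -> P B = (\int[mu]_(x in B) (s x)%:E)%E := law_density iid.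

Lemma dataE w : data Xs w = tnth (sample Xs w).
Proof. by apply/funext => i; rewrite tnth_mktuple. Qed.

Definition real_loss w k : R := sample_loss mu s (ker k) (sample Xs w).

Lemma real_lossE w k : loss mu s Xs ker w k = (real_loss w k)%:E.
Proof.
rewrite /loss dataE (lossE ms s0 (s_le_sup iid) Ps (ker_measurable ka k) (ker_le ka k)
  (ker_sqr_le ka k)).
by [].
Qed.

Lemma real_loss_ge0 w k : 0 <= real_loss w k. Proof. exact: ip_ge0. Qed.

Variable x : R.
Hypothesis x1 : 1 <= x.
Local Notation q := (Upsilon * x ^+ 2 / N).
Local Notation good w := (good_sample mu s X ker Upsilon x (sample Xs w)).

Lemma q_ge0 : 0 <= q.
Proof.
have [U1 _ _ _ _] := Upsilon_consequences iid ka.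
by rewrite divr_ge0// mulr_ge0 ?sqr_ge0//; lra.
Qed.

Let u k : R := bias mu s (ker k) + mean_Theta mu X ker k / N.

Lemma mean_Theta_div_le k : 0 <= mean_Theta mu X ker k / N <= u k.
Proof.
have /andP[V0 _] := mean_Theta_bounds ka k.
by rewrite divr_ge0//= lerDr ip_ge0.
Qed.

Let u_ge0 k : 0 <= u k.
Proof. by have /andP[h1 h2] := mean_Theta_div_le k; exact: le_trans h2. Qed.

Lemma real_loss_bracket w k : good w -> forall e : R, 0 < e <= 1 ->
  `|real_loss w k - u k| <= 6 * e * u k + 7 * dev_const R ^+ 2 * q / e ^+ 3.
Proof.
move=> gw e he; rewrite /u opprD addrA.
exact: (good_loss_bracket n0 iid ka x1 k gw he).
Qed.

(** In the comparison of the two criteria [ip mu s s] cancels, and [- 2 * P chi / n] from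
    [contrast_decomposition] turns each penalty into its [pen_dev]. *)
Lemma good_oracle w theta khat k : good w -> 0 < theta < 1 ->
  selected mu Xs ker pen w khat ->
  (1 - 4 * theta) * real_loss w khat <= (1 + 4 * theta) * real_loss w k +
    (pen_dev mu s n ker pen w k - pen_dev mu s n ker pen w khat + @oracle_const R * (q / theta)).
Proof.
move=> gw th sel.
apply: (first_oracle_bound (F := fluctuation mu P s (ker k) (sample Xs w))
  (F' := fluctuation mu P s (ker khat) (sample Xs w)) th q_ge0 (u_ge0 k) (u_ge0 khat)).
- exact: real_loss_bracket.
- exact: real_loss_bracket.
- by move=> e he; exact: (good_fluctuation n0 iid ka x1 khat k gw he).
have := sel k; rewrite /crit_pen dataE /pen_dev.
rewrite !(contrast_decomposition ms s0 (s_le_sup iid) Ps (ker_sym ka _) (ker_measurable ka _)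
  (ker_le ka _) (ker_sqr_le ka _) _ n0).
have E j : law_mean mu s (chi_ker (ker j)) = \int[P]_y chi_ker (ker j) y.
  apply: (law_meanE ms s0 Ps).
  by have [] := bmeas_chi (ker_measurable ka j) (ker_le ka j).
by rewrite !E /real_loss; lra.
Qed.

Lemma good_set : exists E : set Omega, [/\ measurable E,
  ((1 - 6 * #|K|%:R ^+ 2 * expR (- x))%:E <= Pr E)%E & forall w, E w -> good w].
Proof.
have [G [mG QG GG]] := good_event n0 iid ka x1.
exists (sample Xs @^-1` G); split.
- by rewrite -[X in measurable X]setTI; exact: measurable_sample.
- by rewrite (sample_law iid mG).
by move=> w; exact: GG.
Qed.

End OracleInequality.

(** Inclusion-exclusion, with the probability of the union at most 1. *)
Lemma probability_setI_ge {d : measure_display} {T : measurableType d} {R : realType}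
    (P : probability T R) (A B : set T) (a b : R) : measurable A -> measurable B ->
  ((1 - a)%:E <= P A)%E -> ((1 - b)%:E <= P B)%E -> ((1 - (a + b))%:E <= P (A `&` B))%E.
Proof.
move=> mA mB.
have Af : P A \is a fin_num by exact: fin_num_measure.
have If : P (A `&` B) \is a fin_num by apply: fin_num_measure; exact: measurableI.
have Bf : P B \is a fin_num by exact: fin_num_measure.
have U1 : (P (A `|` B) <= 1)%E by apply: probability_le1; exact: measurableU.
have UE : (P (A `|` B) = P A + P B - P (A `&` B))%E.
  by apply: measureUfinl => //; rewrite -ge0_fin_numE.
move: U1; rewrite UE -(fineK Af) -(fineK Bf) -(fineK If) -!EFinD !lee_fin; lra.
Qed.

Theorem theorem3p1 (R : realType) :
  (exists2 c0 : R, 0 < c0 &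
   forall (d d0 : measure_display) (T : measurableType d)
     (Omega : measurableType d0) (mu : {measure set T -> \bar R})
     (Pr : probability Omega R) (s : T -> R) (n : nat)
     (X Y : {RV Pr >-> T}) (Xs : 'I_n -> {RV Pr >-> T})
     (K : finType) (ker : K -> T -> T -> R) (Gamma Upsilon : R)
     (pen : Omega -> K -> R),
   (0 < n)%N ->
   iid_with_density mu s X Y Xs ->
   kernel_assumptions mu s n X Y ker Gamma Upsilon ->
   forall x : R, 1 <= x ->
   with_prob_ge Pr (1 - c0 * #|K|%:R ^+ 2 * expR (- x)) (fun w =>
     forall theta : R, 0 < theta < 1 ->
     forall khat : K, selected mu Xs ker pen w khat ->
     forall k : K,
       ((1 - 4 * theta)%:E * loss mu s Xs ker w khat <=
        (1 + 4 * theta)%:E * loss mu s Xs ker w k +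
        (pen_dev mu s n ker pen w k - pen_dev mu s n ker pen w khat
         + c0 * (Upsilon * x ^+ 2 / (theta * n%:R)))%:E)%E))
  /\
  (forall c1 : R, 0 < c1 ->
   exists2 c2 : R, 0 < c2 &
   forall (d d0 : measure_display) (T : measurableType d)
     (Omega : measurableType d0) (mu : {measure set T -> \bar R})
     (Pr : probability Omega R) (s : T -> R) (n : nat)
     (X Y : {RV Pr >-> T}) (Xs : 'I_n -> {RV Pr >-> T})
     (K : finType) (ker : K -> T -> T -> R) (Gamma Upsilon : R)
     (pen : Omega -> K -> R) (C delta delta' r : R),
   (0 < n)%N ->
   iid_with_density mu s X Y Xs ->
   kernel_assumptions mu s n X Y ker Gamma Upsilon ->
   0 < C -> 0 < delta -> delta <= delta' -> 0 <= r ->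
   (forall x : R, 1 <= x ->
    with_prob_ge Pr (1 - C * expR (- x)) (fun w =>
      forall k : K,
        (delta - 1) * law_mean mu s (Theta_ker mu (ker k)) / n%:R
          - c1 * r * (Upsilon * x ^+ 2 / n%:R)
        <= pen_dev mu s n ker pen w k
        <= (delta' - 1) * law_mean mu s (Theta_ker mu (ker k)) / n%:R
           + c1 * r * (Upsilon * x ^+ 2 / n%:R))) ->
   forall theta : R, 0 < theta < 1 ->
   forall x : R, 1 <= x ->
   with_prob_ge Pr (1 - c2 * (C + #|K|%:R ^+ 2) * expR (- x)) (fun w =>
     forall khat : K, selected mu Xs ker pen w khat ->
       (((Num.min delta 1 - 5 * theta) /
         (Num.max delta' 1 + (4 + delta') * theta))%:E
          * loss mu s Xs ker w khat <=
        ereal_inf (range (loss mu s Xs ker w)) +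
        (c2 * (r + (theta ^+ 3)^-1) * (Upsilon * x ^+ 2 / n%:R))%:E)%E)).
Proof.
have O6 := @oracle_const_ge6 R.
have B0 := @second_bracket_const_ge0 R.
split.
  (* One constant serves both the remainder and the probability, for which it must be at least 6. *)
  exists (@oracle_const R); first by lra.
  move=> d d0 T Omega mu Pr s n X Y Xs K ker Gamma Upsilon pen n0 iid ka x x1.
  have [E [mE PE EG]] := good_set n0 iid ka x1.
  exists E; split=> // [|w Ew theta th khat sel k].
    apply: le_trans PE; rewrite lee_fin lerD2l lerN2 ler_wpM2r ?expR_ge0//.
    by rewrite ler_wpM2r// exprn_ge0.
  rewrite !(real_lossE iid ka) -!EFinM -!EFinD lee_fin.
  have := good_oracle n0 iid ka x1 k (EG w Ew) th sel.
  congr (_ <= _ + (_ + _ * _)); rewrite invfM; ring.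
move=> c1 c10.
(* [2 * c1] pays for the penalty errors [c1 * r * q] at the two kernels, the next two terms for the
   remainder of [second_oracle_bound], and the 6 for the bad events. *)
set c2 : R := 2 * c1 + 2 * second_bracket_const + 4 * oracle_const + 6.
have c20 : 0 < c2 by rewrite /c2; lra.
exists c2 => // d d0 T Omega mu Pr s n X Y Xs K ker Gamma Upsilon pen C de de' r n0 iid ka.
move=> C0 de0 dde r0 Hpen th0 th x x1.
have [E [mE PE EG]] := good_set n0 iid ka x1.
have [F [mF PF FG]] := Hpen x x1.
exists (E `&` F); split; first exact: measurableI.
  have e0 : 0 <= expR (- x) by exact: expR_ge0.
  have k0 : 0 <= #|K|%:R ^+ 2 * expR (- x) :> R by rewrite mulr_ge0// exprn_ge0.
  have Ce0 : 0 <= C * expR (- x) by rewrite mulr_ge0// ltW.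
  apply: le_trans (probability_setI_ge mE mF PE PF); rewrite lee_fin lerD2l lerN2.
  rewrite -mulrDl ler_wpM2r// mulrDr [leRHS]addrC.
  by apply: lerD; [apply: ler_wpM2r|apply: ler_peMl]; rewrite ?exprn_ge0// ?(ltW C0)// /c2; lra.
move=> w [Ew Fw] khat sel.
have [U1 _ _ _ _] := Upsilon_consequences iid ka.
have q0 := q_ge0 iid ka x.
set q := Upsilon * x ^+ 2 / n%:R in q0.
have gw := EG w Ew.
have /andP[t0 t1] := th.
have main k : (Num.min de 1 - 5 * th0) / (Num.max de' 1 + (4 + de') * th0) *
    real_loss mu s Xs ker w khat <= real_loss mu s Xs ker w k + c2 * (r + (th0 ^+ 3)^-1) * q.
  have /andP[_ hk] := FG w Fw k; have /andP[hk' _] := FG w Fw khat.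
  rewrite (law_mean_Theta iid ka) -mulrA in hk.
  rewrite (law_mean_Theta iid ka) -mulrA in hk'.
  have rho0 : 0 <= c1 * r * q by rewrite mulr_ge0// mulr_ge0// ltW.
  apply: (le_trans (second_oracle_bound th q0 (mean_Theta_div_le (s:=s) ka k)
    (mean_Theta_div_le (s:=s) ka khat) (real_loss_ge0 mu s Xs ker w k) (real_loss_ge0 mu s Xs ker w khat)
    de0 dde rho0 (real_loss_bracket n0 iid ka x1 k gw) (real_loss_bracket n0 iid ka x1 khat gw)
    (fun e he => good_oracle n0 iid ka x1 k gw he sel) hk hk')).
  rewrite -addrA lerD2l.
  have th3 : 0 <= q / th0 ^+ 3 by rewrite divr_ge0// exprn_ge0// ltW.
  have rq : 0 <= r * q by rewrite mulr_ge0.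
  have c1rq : 0 <= c1 * (q / th0 ^+ 3) by rewrite mulr_ge0// ltW.
  have srq : 0 <= second_bracket_const * (r * q) by rewrite mulr_ge0.
  have orq : 0 <= oracle_const * (r * q) by rewrite mulr_ge0//; lra.
  have -> : c2 * (r + (th0 ^+ 3)^-1) * q = c2 * (r * q) + c2 * (q / th0 ^+ 3) by ring.
  rewrite /c2 -(mulrA c1).
  move: (r * q) (q / th0 ^+ 3) rq th3 c1rq srq orq => A B A0 B0' h1 h2 h3.
  lra.
rewrite (real_lossE iid ka) -EFinM -leeBlDr//.
apply: le_ereal_inf_tmp => _ [k _ <-].
by rewrite (real_lossE iid ka) leeBlDr// -EFinD lee_fin; exact: main.
Qed.
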